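(* Let $(X_{nk})_{n\in\mathbb N,\ s_n\le k\le k_n}$ be a square-integrable $\mathbb R^d$-valued lag martingale difference array adapted to $(\mathcal X_{nk})_{0\le k\le k_n,\,n\in\mathbb N}$, with lags $p_{nk}$ and $p_n=\max_{s_n\le k\le k_n}p_{nk}$. Assume that: (1) $\Psi_n\to\Psi$ in probability as $n\to\infty$ with $\Psi$ a $\mathcal G$-measurable symmetric positive semidefinite random matrix, and $\big\|\sum_{k=s_n}^{k_n}\mathbb E(D_{nk}D_{nk}^{\top}\mid\mathcal X_{n,k-1})-\Psi_n\big\|\to0$ in probability as $n\to\infty$; (2) $p_n\cdot\max_{(k,i)\in\mathcal R_n}\|E_{n,k+i,k-1}\|\to0$ in probability as $n\to\infty$; (3) for at least one $j\in\{1,2,3\}$, $C_{nj}(\epsilon)\to0$ in probability as $n\to\infty$ for every $\epsilon>0$. Then $\overline X_n:=\sum_{k=s_n}^{k_n}X_{nk}\to\Psi^{1/2}Z_d$ $\mathcal G$-stably as $n\to\infty$, where $Z_d$ is a standard Gaussian random vector in $\mathbb R^d$ that is independent of $\mathcal G$.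
   Context: Setup. $(k_n)_{n\in\mathbb N}$ is a nondecreasing sequence in $\mathbb N$ with $k_n\ge n$. On a probability space $(\Omega,\mathcal X,P)$, for each $n$, $(\mathcal X_{nk})_{0\le k\le k_n}$ is a filtration of sub-$\sigma$-fields of $\mathcal X$. Let $1\le s_n\le k_n$ and let $p_{nk}\in\{0,1,\dots,k-1\}$ for $s_n\le k\le k_n$ (nonrandom integers; $p_n$ may diverge). An array $(X_{nk})_{n\in\mathbb N,\,s_n\le k\le k_n}$ of $\mathbb R^d$-valued random vectors, with each $X_{nk}$ being $\mathcal X_{nk}$-measurable, is a lag martingale difference array (with lags $p_{nk}$) if every component of every $X_{nk}$ is integrable and $\mathbb E(X_{nk}\mid\mathcal X_{n,k-p_{nk}-1})=0_d$ for all $n$ and $s_n\le k\le k_n$. It is square-integrable if all components are in $L^2(P)$. $\|\cdot\|$ is the Euclidean norm on vectors (any fixed norm on matrices). Conventions: $X_{nr}=0_d$ and $p_{nr}=0$ for $r>k_n$. Projection horizon: $q_{n,s_n-1}=0$ and, recursively for $s_n\le k\le k_n$, $q_{nk}=\min\{q\in\{q_{n,k-1},q_{n,k-1}+1,\dots\}:\ q\ge p_{n,k+q}\}$. Projections: $E_{njl}=\mathbb E(X_{nj}\mid\mathcal X_{nl})$, $D_{n,k+i,k}=E_{n,k+i,k}-E_{n,k+i,k-1}$, $D_{nk}=\sum_{i=0}^{q_{nk}}D_{n,k+i,k}$. Index set $\mathcal R_n=\{(k,i)\in\mathbb Z^2:\ s_n\le k\le k_n,\ q_{n,k-1}\le i\le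 q_{nk}-1\}$; a maximum of norms over an empty set is $0$. With $\mathcal P_{nk}=\{(i,j)\in\mathbb Z^2:0\le i\le q_{nk},\ 0\le j\le1\}$ and $\epsilon>0$: $$C_{n1}(\epsilon)=\sum_{k=s_n}^{k_n}\mathbb E\Big[\Big(\sum_{i=0}^{q_{nk}}\|D_{n,k+i,k}\|\Big)^2 1\Big\{\sum_{i=0}^{q_{nk}}\|D_{n,k+i,k}\|\ge\epsilon\Big\}\Big|\mathcal X_{n,k-1}\Big],$$ $$C_{n2}(\epsilon)=\sum_{k=s_n}^{k_n}\mathbb E\Big[(q_{nk}+1)^2\max_{0\le i\le q_{nk}}\|D_{n,k+i,k}\|^2\, 1\Big\{\max_{0\le i\le q_{nk}}\|D_{n,k+i,k}\|\ge\tfrac{\epsilon}{q_{nk}+1}\Big\}\Big|\mathcal X_{n,k-1}\Big],$$ $$C_{n3}(\epsilon)=\sum_{k=s_n}^{k_n}\mathbb E\Big[4(q_{nk}+1)^2\max_{(i,j)\in\mathcal P_{nk}}\|E_{n,k+i,k-j}\|^2\, 1\Big\{\max_{(i,j)\in\mathcal P_{nk}}\|E_{n,k+i,k-j}\|\ge\tfrac{\epsilon}{2(q_{nk}+1)}\Big\}\Big|\mathcal X_{n,k-1}\Big].$$ Index sets: for $0\le j\le p_n$ and $s_n\le k\le k_n$, $\mathcal I_{nkj}=\{i\in\mathbb Z:\ j\le i\le\min(q_{n,k-i},\,k-s_n)\}$ (that is, $j\le i\le k-s_n$ and $i\le q_{n,k-i}$); $\mathcal I_{nk0}$ is nonempty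 and $i_{nk}=\max(\mathcal I_{nk0})$. Variance matrix: $$\Psi_n=\sum_{k=s_n}^{k_n}\mathrm{Var}(X_{nk}\mid\mathcal X_{n,k-i_{nk}-1})+2\sum_{k=s_n}^{k_n}\ \sum_{\substack{1\le j\le\min(p_n,k-s_n)\\ \mathcal I_{nkj}\ne\emptyset}}\mathrm{Sym}\{\mathrm{Cov}(X_{nk},X_{n,k-j}\mid\mathcal X_{n,k-\max(\mathcal I_{nkj})-1})\},$$ where $\mathrm{Sym}(A)=(A+A^\top)/2$ and $\mathrm{Var}(\cdot\mid\cdot)$, $\mathrm{Cov}(\cdot,\cdot\mid\cdot)$ denote conditional (cross-)covariance matrices. $\sigma$-fields: $\mathcal G_n=\bigcap_{m\ge n}\mathcal X_{m,k_n}$ and $\mathcal G=\sigma\big(\bigcup_{n\ge1}\mathcal G_n\big)$. For a symmetric positive semidefinite $Q$, $Q^{1/2}$ is its unique symmetric positive semidefinite square root. $Y_n\to Y$ $\mathcal G$-stably means that $(Y_n,V)\to(Y,V)$ in distribution for every $\mathcal G$-measurable random variable $V$ (the limit $Y$ may live on an extension of the probability space). *)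

(* Defs.v *)
From mathcomp Require Import all_boot all_order all_algebra.
From mathcomp Require Import all_classical all_reals all_analysis.

Set Implicit Arguments.
Unset Strict Implicit.
Unset Printing Implicit Defensive.

Import Order.TTheory GRing.Theory Num.Theory.
Import numFieldNormedType.Exports.

Local Open Scope classical_set_scope.
Local Open Scope ring_scope.

Section LinearAlgebra.
Context {R : realType}.

(* The library norm of a matrix is the sup norm, hence this definition. *)
Definition enorm (d : nat) (v : 'cV[R]_d) : R :=
  Num.sqrt (\sum_(i < d) v i 0 ^+ 2).

Definition Sym (d : nat) (A : 'M[R]_d) : 'M[R]_d := 2^-1 *: (A + A^T).

Definition psd (d : nat) (Q : 'M[R]_d) : Prop :=
  Q^T = Q /\ forall v : 'cV[R]_d, 0 <= (v^T *m Q *m v) 0 0.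

(* For [psd Q] there is exactly one such matrix; the value is [0] otherwise. *)
Definition psd_sqrt (d : nat) (Q : 'M[R]_d) : 'M[R]_d :=
  xget 0 [set S : 'M[R]_d | psd S /\ S *m S = Q].

End LinearAlgebra.

Section SigmaFields.
Context {disp : measure_display} {T : measurableType disp} {R : realType}.

Definition sub_sigma_field (G : set (set T)) : Prop :=
  sigma_algebra setT G /\ G `<=` measurable.

Definition measurable_wrt (G : set (set T)) (f : T -> R) : Prop :=
  preimage_set_system setT f measurable `<=` G.

Definition measurable_wrt_mx (G : set (set T)) (m n : nat)
    (A : T -> 'M[R]_(m, n)) : Prop :=
  forall i j, measurable_wrt G (fun w => A w i j).

Definition filtration (K : nat) (F : nat -> set (set T)) : Prop :=
  (forall j, (j <= K)%N -> sub_sigma_field (F j)) /\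
  (forall i j, (i <= j <= K)%N -> F i `<=` F j).

Definition sigma_vec (d : nat) (Z : T -> 'cV[R]_d) : set (set T) :=
  <<s \bigcup_(i in [set: 'I_d])
        preimage_set_system setT (fun w => Z w i 0) measurable >>.

(* [F m j] is the j-th field of the m-th row and [k m] the index of the last
   one; rows are numbered from 1. *)
Definition tail_field (k : nat -> nat) (F : nat -> nat -> set (set T))
    (n : nat) : set (set T) :=
  \bigcap_(m in [set m | (n <= m)%N]) F m (k n).

Definition limit_field (k : nat -> nat) (F : nat -> nat -> set (set T)) :
    set (set T) :=
  <<s \bigcup_(n in [set n | (1 <= n)%N]) tail_field k F n >>.

End SigmaFields.

Section Conditioning.
Context {disp : measure_display} {T : measurableType disp} {R : realType}.
Variable P : probability T R.
Implicit Types G : set (set T).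

Definition is_condexp G (f g : T -> R) : Prop :=
  [/\ measurable_wrt G g, g \in Lfun P 1%E &
      forall A, G A ->
        (\int[P]_(w in A) (g w)%:E = \int[P]_(w in A) (f w)%:E)%E].

(* An arbitrary version; one exists as soon as G is a sub-sigma-field and f is
   integrable, and any two versions agree P-almost everywhere. *)
Definition condexp G (f : T -> R) : T -> R :=
  xget (cst 0) [set g : T -> R | is_condexp G f g].

Definition condexp_mx G (m n : nat) (A : T -> 'M[R]_(m, n)) :
    T -> 'M[R]_(m, n) :=
  fun w => \matrix_(i, j) condexp G (fun w' => A w' i j) w.

Definition condcov G (d : nat) (X Y : T -> 'cV[R]_d) : T -> 'M[R]_d :=
  condexp_mx G (fun w => (X w - condexp_mx G X w) *m
                         (Y w - condexp_mx G Y w)^T).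

Definition condvar G (d : nat) (X : T -> 'cV[R]_d) : T -> 'M[R]_d :=
  condcov G X X.

End Conditioning.

(* The lag of the r-th variable is 0 beyond the end K of the row. *)
Definition ext_lag (K : nat) (p : nat -> nat) (r : nat) : nat :=
  if (r <= K)%N then p r else 0%N.

Lemma horizon_subproof (K : nat) (p : nat -> nat) (k q0 : nat) :
  exists q, (q0 <= q)%N && (ext_lag K p (k + q) <= q)%N.
Proof.
exists (maxn q0 K.+1); rewrite leq_maxl /= /ext_lag.
have /negbTE -> // : ~~ (k + maxn q0 K.+1 <= K)%N.
by rewrite -ltnNge (leq_trans (leq_maxr q0 K.+1)) // leq_addl.
Qed.

(* [horizon_from s K p j] is q_{s - 1 + j}, so that q_{s-1} = 0. *)
Fixpoint horizon_from (s K : nat) (p : nat -> nat) (j : nat) : nat :=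
  if j is j'.+1 then
    ex_minn (horizon_subproof K p (s + j') (horizon_from s K p j'))
  else 0%N.

Definition horizon (s K : nat) (p : nat -> nat) (k : nat) : nat :=
  horizon_from s K p (k.+1 - s).

(* The definitions of this section concern a single row of the array: the
   variables X s, ..., X K, their lags p s, ..., p K, and the fields
   F 0, ..., F K. *)
Section Row.
Context {disp : measure_display} {T : measurableType disp} {R : realType}.
Variables (P : probability T R) (d : nat).
Variables (s K : nat) (p : nat -> nat).
Variables (F : nat -> set (set T)) (X : nat -> T -> 'cV[R]_d).

Local Notation q := (horizon s K p).

Definition ext_var (r : nat) : T -> 'cV[R]_d :=
  if (r <= K)%N then X r else cst 0.

Definition max_lag : nat := \max_(s <= k < K.+1) p k.

Definition row_sum (w : T) : 'cV[R]_d := \sum_(s <= k < K.+1) X k w.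

Definition proj (j l : nat) : T -> 'cV[R]_d :=
  condexp_mx P (F l) (ext_var j).

(* [proj_diff i k] is D_{k+i,k}. *)
Definition proj_diff (i k : nat) (w : T) : 'cV[R]_d :=
  proj (k + i) k w - proj (k + i) k.-1 w.

Definition mart_diff (k : nat) (w : T) : 'cV[R]_d :=
  \sum_(0 <= i < (q k).+1) proj_diff i k w.

Definition cond_quad_var (w : T) : 'M[R]_d :=
  \sum_(s <= k < K.+1)
    condexp_mx P (F k.-1) (fun w' => mart_diff k w' *m (mart_diff k w')^T) w.

(* Maximum of ||E_{k+i,k-1}|| over s <= k <= K and q_{k-1} <= i <= q_k - 1. *)
Definition max_remainder (w : T) : R :=
  \big[Num.max/0]_(s <= k < K.+1) \big[Num.max/0]_(q k.-1 <= i < q k)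
    enorm (proj (k + i) k.-1 w).

Definition sum_norm (k : nat) (w : T) : R :=
  \sum_(0 <= i < (q k).+1) enorm (proj_diff i k w).

Definition max_norm (k : nat) (w : T) : R :=
  \big[Num.max/0]_(0 <= i < (q k).+1) enorm (proj_diff i k w).

Definition max_norm_proj (k : nat) (w : T) : R :=
  \big[Num.max/0]_(0 <= i < (q k).+1) \big[Num.max/0]_(0 <= j < 2)
    enorm (proj (k + i) (k - j) w).

Definition lindeberg1 (eps : R) (w : T) : R :=
  \sum_(s <= k < K.+1)
    condexp P (F k.-1)
      (fun w' => sum_norm k w' ^+ 2 * \1_[set x | eps <= sum_norm k x] w') w.

Definition lindeberg2 (eps : R) (w : T) : R :=
  \sum_(s <= k < K.+1)
    condexp P (F k.-1)
      (fun w' => (q k).+1%:R ^+ 2 * max_norm k w' ^+ 2 *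
         \1_[set x | eps / (q k).+1%:R <= max_norm k x] w') w.

Definition lindeberg3 (eps : R) (w : T) : R :=
  \sum_(s <= k < K.+1)
    condexp P (F k.-1)
      (fun w' => 4 * (q k).+1%:R ^+ 2 * max_norm_proj k w' ^+ 2 *
         \1_[set x | eps / (2 * (q k).+1%:R) <= max_norm_proj k x] w') w.

(* I_{kj}: the i with j <= i <= k - s and i <= q_{k-i}. *)
Definition lag_set (k j : nat) : seq nat :=
  [seq i <- index_iota j (k - s).+1 | (i <= q (k - i))%N].

Definition max_lag_set (k j : nat) : nat := \max_(i <- lag_set k j) i.

Definition variance_matrix (w : T) : 'M[R]_d :=
  \sum_(s <= k < K.+1)
    condvar P (F (k - max_lag_set k 0 - 1)%N) (X k) w +
  2 *: \sum_(s <= k < K.+1)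
    \sum_(1 <= j < (minn max_lag (k - s)).+1 | lag_set k j != [::])
      Sym (condcov P (F (k - max_lag_set k j - 1)%N) (X k) (X (k - j)%N) w).

End Row.

Section Arrays.
Context {disp : measure_display} {T : measurableType disp} {R : realType}.
Variables (P : probability T R) (d : nat).
Variables (s k : nat -> nat) (p : nat -> nat -> nat).
Variables (F : nat -> nat -> set (set T)) (X : nat -> nat -> T -> 'cV[R]_d).

Definition lag_martingale_difference : Prop :=
  forall n j, (1 <= n)%N -> (s n <= j <= k n)%N ->
    [/\ measurable_wrt_mx (F n j) (X n j),
        forall a, (fun w => X n j w a 0) \in Lfun P 1%E &
        {ae P, forall w, condexp_mx P (F n (j - p n j - 1)%N) (X n j) w = 0}].

Definition square_integrable : Prop :=
  forall n j, (1 <= n)%N -> (s n <= j <= k n)%N ->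
    forall a, (fun w => X n j w a 0) \in Lfun P 2%:E.

End Arrays.

Section Convergence.
Context {R : realType}.

Definition cvg_in_prob {disp} {T : measurableType disp} (P : probability T R)
    (V : normedModType R) (Y_ : nat -> T -> V) (Y : T -> V) : Prop :=
  forall eps : R, 0 < eps ->
    P [set w | eps <= `|Y_ n w - Y w|] @[n --> \oo] --> 0%E.

Definition cvg_in_distr {disp} {T : measurableType disp} (P : probability T R)
    {disp'} {T' : measurableType disp'} (P' : probability T' R)
    (S : topologicalType) (Y_ : nat -> T -> S) (Y : T' -> S) : Prop :=
  forall h : S -> R, continuous h -> (exists M : R, forall x, `|h x| <= M) ->
    ('E_P[h \o Y_ n] @[n --> \oo] --> 'E_P'[h \o Y])%E.

Definition is_extension {disp} {T : measurableType disp} (P : probability T R)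
    {disp'} {T' : measurableType disp'} (P' : probability T' R)
    (pi : T' -> T) : Prop :=
  measurable_fun setT pi /\ forall A, measurable A -> P' (pi @^-1` A) = P A.

(* The limit Y lives on the extension (T', P', pi) of (T, P), on which V is
   read as V \o pi. *)
Definition stable_cvg {disp} {T : measurableType disp} (P : probability T R)
    {disp'} {T' : measurableType disp'} (P' : probability T' R)
    (pi : T' -> T) (G : set (set T)) (d : nat)
    (Y_ : nat -> T -> 'cV[R]_d) (Y : T' -> 'cV[R]_d) : Prop :=
  forall V : T -> R, measurable_wrt G V ->
    cvg_in_distr P P' (fun n w => (Y_ n w, V w)) (fun w' => (Y w', V (pi w'))).

(* The coordinates are independent and N(0, 1)-distributed. *)
Definition standard_gaussian {disp} {T : measurableType disp}
    (P : probability T R) (d : nat) (Z : T -> 'cV[R]_d) : Prop :=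
  measurable_wrt_mx measurable Z /\
  forall B : 'I_d -> set R, (forall i, measurable (B i)) ->
    P [set w | forall i, B i (Z w i 0)] =
      (\prod_(i < d) normal_prob 0%R 1%R (B i))%E.

Definition indep_fields {disp} {T : measurableType disp} (P : probability T R)
    (G H : set (set T)) : Prop :=
  forall A B, G A -> H B -> (P (A `&` B) = P A * P B)%E.

End Convergence.

(* Main.v *)
From HB Require Import structures.
Require Import Defs.
From mathcomp Require Import all_boot all_order all_algebra.
From mathcomp Require Import all_classical all_reals all_analysis.
From mathcomp Require Import measurable_realfun.
From mathcomp Require Import ring lra zify.
Set Implicit Arguments.
Unset Strict Implicit.
Unset Printing Implicit Defensive.
Import Order.TTheory GRing.Theory Num.Theory.
Import numFieldNormedType.Exports.
Local Open Scope classical_set_scope.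
Local Open Scope ring_scope.

(** A lag martingale difference array becomes an ordinary one by regrouping
    projections. Replace [X_j] by the telescoping sum of the differences
    [E(X_j | F_l) - E(X_j | F_(l-1))] over [l <= j], and collect at each time [k]
    the differences at [l = k] of the variables [X_(k+i)] whose index is at most
    the horizon [q_k]. The sums [D_k] obtained in this way are martingale
    differences. The horizon is defined so that the lag condition kills the
    projections at its boundary; what remains of the difference between the
    row sum and the sum of the [D_k] are the terms that enter the window when
    the horizon grows ([row_sumE]). There are at most [p_n] of them
    ([row_rem_le]), so the second hypothesis makes their sum vanish in
    probability. The first hypothesis says that the conditional variances of the
    [D_k] add up to a matrix with limit [Psi], and each of the three versions of
    the third one gives a conditional Lindeberg condition for the scalar
    projections [u . D_k] ([lindeberg_row1], [lindeberg_row2],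
    [lindeberg_row3]).

    Next comes a stable central limit theorem for a scalar martingale difference
    row with partial sums [S_k] and conditional variances [V_k]. The process
    [exp (V_k / 2) cos (S_k + theta)] is almost a martingale: in its increments
    the terms of first order have conditional mean 0, those of second order
    cancel, and the Lindeberg condition bounds the rest. Stopping the row before
    [V_k] exceeds a constant keeps the process bounded ([exp_mart_row]). An event
    [A] of the limit field can be taken in the field of a fixed time [r] of all
    late rows; the at most [r] steps before that time are small by the Lindeberg
    condition, and at the later ones [A] is known. Hence the process minus
    [cos theta] tends to 0 when tested against [A], and then against all bounded
    functions measurable with respect to the limit field ([exp_mart_weak]).
    Testing with [zeta exp (- eta2 / 2)], where [eta2] is the limit of the
    conditional variances, gives the limit of the mean of [zeta cos (S + theta)]
    ([scalar_stable_limit]).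

    For a variable [V] measurable with respect to the limit field this yields
    the limit of the means of [cos (u . Xbar_n + v V + theta)]
    ([projection_limit]). It equals the mean of
    [cos (u . (Psi^(1/2) Z) + v V + theta)]: given the limit field,
    [u . (Psi^(1/2) Z)] is Gaussian with variance [u . (Psi u)]
    ([Ex_cos_mixture], [psd_sqrtP]). Together with tightness
    ([projection_tight]), convergence of all these means implies convergence in
    distribution of the pair of [Xbar_n] and [V], since trigonometric polynomials
    approximate continuous functions on boxes ([trig_approx_box],
    [trig_determining]). *)

(** * Expectations of real functions *)

(** This turns statements about a sub-sigma-field into statements about a
    measurable space, where the theory of measurable functions applies. *)
Lemma measurable_wrtE {disp} {T : measurableType disp} {R : realType}
    (G : set (set T)) (f : T -> R) : sigma_algebra setT G ->
  measurable_wrt G f <->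
  measurable_fun [set: g_sigma_algebraType G] (f : g_sigma_algebraType G -> R).
Proof.
move=> sG; have GE : <<s G >> = G by exact: sigma_algebra_id.
split=> [mf _ B mB|mf A [B mB <-]].
  by rewrite /measurable /= GE; apply: mf; exists B.
by have := mf measurableT B mB; rewrite /measurable /= GE.
Qed.

Section expectation.
Context {disp : measure_display} {T : measurableType disp} {R : realType}.
Variable P : probability T R.
Implicit Types (f g h B : T -> R) (A : set T).

Definition integ f := P.-integrable setT (EFin \o f).
Local Notation Ex := (Rintegral P setT).
Definition bdd (f : T -> R) := exists M : R, forall x, `|f x| <= M.

Lemma integP f : integ f <-> f \in Lfun P 1%E.
Proof. by split=> /Lfun1_integrable. Qed.

Lemma integ_meas f : integ f -> measurable_fun setT f.
Proof. by move=> /measurable_int/measurable_EFinP. Qed.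

Lemma integ_le f g : measurable_fun setT f -> (forall x, `|f x| <= `|g x|) ->
  integ g -> integ f.
Proof.
move=> mf fg ig; apply: le_integrable ig => //; first exact/measurable_EFinP.
by move=> x _; rewrite !abse_EFin lee_fin.
Qed.

Lemma integD f g : integ f -> integ g -> integ (fun x => f x + g x).
Proof. by move=> fi gi; exact: (integrableD _ fi gi). Qed.

Lemma integZ (c : R) f : integ f -> integ (fun x => c * f x).
Proof. by move=> fi; exact: (integrableZl _ c fi). Qed.

Lemma integN f : integ f -> integ (fun x => - f x).
Proof. by move=> /integrableN; apply. Qed.

Lemma integB f g : integ f -> integ g -> integ (fun x => f x - g x).
Proof. by move=> fi gi; apply: integD => //; exact: integN. Qed.

Lemma integ_sum I (s : seq I) (p : pred I) (F : I -> T -> R) :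
  (forall i, p i -> integ (F i)) -> integ (fun x => \sum_(i <- s | p i) F i x).
Proof.
move=> Fi; rewrite /integ.
rewrite (_ : EFin \o _ = fun x => (\sum_(i <- s | p i) (F i x)%:E)%E); last first.
  by apply/funext => x; rewrite /= sumEFin.
by apply: (@integrable_sum _ _ _ _ _ _ _ _ _ (fun i x => (F i x)%:E)).
Qed.

Lemma integ_abs f : integ f -> integ (fun x => `|f x|).
Proof. by move=> fi; exact: (integrable_norm fi). Qed.

Lemma integ_cst (c : R) : integ (cst c).
Proof. exact: finite_measure_integrable_cst. Qed.

Lemma integ_bdd f : measurable_fun setT f -> bdd f -> integ f.
Proof.
move=> mf [M fM]; apply: (integ_le mf _ (integ_cst M)) => x.
by rewrite (le_trans (fM x))// ler_norm.
Qed.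

Lemma integM_bdd B f : measurable_fun setT B -> bdd B -> integ f ->
  integ (fun x => B x * f x).
Proof.
move=> mB [M BM] fi; apply: (integ_le _ _ (integZ M fi)).
  by apply: measurable_funM => //; exact: integ_meas.
move=> x; rewrite !normrM ler_wpM2r//.
by rewrite (le_trans (BM x))// ler_norm.
Qed.

Lemma bdd_indic A : bdd (\1_A : T -> R).
Proof. by exists 1 => x; rewrite indicE; case: (_ \in _); rewrite ?normr1 ?normr0. Qed.

Lemma integM_indic A f : measurable A -> integ f ->
  integ (fun x => \1_A x * f x).
Proof.
by move=> mA fi; apply: integM_bdd; [exact: measurable_indic|exact: bdd_indic|].
Qed.

Lemma integ_indic A : measurable A -> integ (\1_A : T -> R).
Proof. by move=> mA; apply: integ_bdd; [exact: measurable_indic|exact: bdd_indic]. Qed.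

Lemma bddM f g : bdd f -> bdd g -> bdd (fun x => f x * g x).
Proof. by move=> [M fM] [N gN]; exists (M * N) => x; rewrite normrM ler_pM. Qed.

Lemma bddD f g : bdd f -> bdd g -> bdd (fun x => f x + g x).
Proof.
move=> [M fM] [N gN]; exists (M + N) => x.
by rewrite (le_trans (ler_normD _ _))// lerD.
Qed.

Lemma bdd_cst (c : R) : bdd (cst c).
Proof. by exists `|c|. Qed.

Lemma ExD f g : integ f -> integ g -> Ex (fun x => f x + g x) = Ex f + Ex g.
Proof. by move=> fi gi; exact: RintegralD. Qed.

Lemma ExB f g : integ f -> integ g -> Ex (fun x => f x - g x) = Ex f - Ex g.
Proof. by move=> fi gi; exact: RintegralB. Qed.

Lemma ExZ (c : R) f : integ f -> Ex (fun x => c * f x) = c * Ex f.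
Proof. by move=> fi; exact: RintegralZl. Qed.

Lemma Ex_cst (c : R) : Ex (cst c) = c.
Proof. rewrite -[RHS]mulr1 /cst Rintegral_cst//; congr (_ * _).
exact: (congr1 fine (probability_setT P)). Qed.

Lemma Ex_sum (I : eqType) (s : seq I) (p : pred I) (F : I -> T -> R) :
  (forall i, p i -> integ (F i)) ->
  Ex (fun x => \sum_(i <- s | p i) F i x) = \sum_(i <- s | p i) Ex (F i).
Proof.
move=> Fi; elim: s => [|i s IH].
  by under eq_fun do rewrite big_nil; rewrite big_nil (Ex_cst 0).
under eq_fun do rewrite big_cons; rewrite big_cons.
case: ifPn => // pi; rewrite ExD ?IH//; first exact: Fi.
exact: integ_sum.
Qed.

Lemma Ex_le f g : integ f -> integ g -> (forall x, f x <= g x) -> Ex f <= Ex g.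
Proof. by move=> fi gi fg; apply: le_Rintegral => // x _. Qed.

Lemma Ex_ge0 f : (forall x, 0 <= f x) -> 0 <= Ex f.
Proof. by move=> f0; apply: Rintegral_ge0 => x _. Qed.

Lemma Ex_abs f : integ f -> `|Ex f| <= Ex (fun x => `|f x|).
Proof. by move=> fi; exact: le_normr_Rintegral. Qed.

Lemma Ex_abs_le f g : integ f -> integ g -> (forall x, `|f x| <= g x) ->
  `|Ex f| <= Ex g.
Proof.
move=> fi gi fg; apply: (le_trans (Ex_abs fi)); apply: Ex_le => //.
exact: integ_abs.
Qed.

Lemma Ex_EFin f : integ f -> (\int[P]_x (f x)%:E = (Ex f)%:E)%E.
Proof. by move=> fi; rewrite /Rintegral fineK//; exact: integrable_fin_num. Qed.

Lemma Ex_indic A : measurable A -> Ex (\1_A : T -> R) = fine (P A).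
Proof. by move=> mA; rewrite /Rintegral integral_indic// setIT. Qed.

Lemma Ex_in f A : \int[P]_(x in A) f x = Ex (fun x => \1_A x * f x).
Proof.
rewrite Rintegral_mkcond; congr (Rintegral P setT _); apply/funext => x.
by rewrite patchE indicE; case: ifPn => _; rewrite ?mul1r ?mul0r.
Qed.

Lemma integ_int f A : measurable A -> integ f ->
  (\int[P]_(x in A) (f x)%:E = (Ex (fun x => \1_A x * f x))%:E)%E.
Proof.
move=> mA fi; rewrite -Ex_in /Rintegral fineK//.
by apply: integrable_fin_num => //; exact: integrableS fi.
Qed.

Lemma Ex_ae_eq f g : integ f -> integ g -> {ae P, forall x, f x = g x} ->
  Ex f = Ex g.
Proof.
move=> fi gi fg; congr fine; apply: ae_eq_integral => //.
- exact: measurable_int fi.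
- exact: measurable_int gi.
- by apply: filterS fg => x /= ->.
Qed.

Lemma Ex_dom (f_ : nat -> T -> R) f g :
  (forall n, measurable_fun setT (f_ n)) -> integ g ->
  (forall x, f_ n x @[n --> \oo] --> f x) ->
  (forall n x, `|f_ n x| <= g x) -> integ f /\ Ex (f_ n) @[n --> \oo] --> Ex f.
Proof.
move=> mf gi ff fg.
have mf' : measurable_fun setT f.
  by apply: (@measurable_fun_cvg _ _ _ setT f_) => // x _; exact: ff.
have [||||| fi _ cf] := @dominated_convergence _ T R P setT measurableT
   (fun n x => (f_ n x)%:E) (fun x => (f x)%:E) (fun x => (g x)%:E).
- by move=> n; exact/measurable_EFinP.
- exact/measurable_EFinP.
- by apply: aeW => x _; apply: cvg_EFin; [exact: nearW|exact: ff].
- exact: gi.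
- by apply: aeW => x n _; rewrite abse_EFin lee_fin.
split=> //; rewrite /Rintegral; apply: fine_cvg.
rewrite fineK; last by apply: integrable_fin_num.
exact: cf.
Qed.

Lemma Ex_ge0_eq0 f : integ f -> (forall x, 0 <= f x) -> Ex f <= 0 ->
  {ae P, forall x, f x = 0}.
Proof.
move=> fi f0 Ef.
have : (\int[P]_x `|(f x)%:E| = 0)%E.
  under eq_integral do rewrite abse_EFin ger0_norm//.
  rewrite Ex_EFin//; congr EFin; apply/eqP; rewrite eq_le Ef/=.
  exact: Ex_ge0.
move/(ae_eq_integral_abs _ measurableT (measurable_int _ fi)).
by apply: filterS => x /(_ I)[].
Qed.

End expectation.
Notation "'Ex' [ P ]" := (Rintegral P setT) (at level 0, format "'Ex' [ P ]").

(** * Conditional expectations *)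

Section conditional_expectation.
Context {disp : measure_display} {T : measurableType disp} {R : realType}.
Variable P : probability T R.
Implicit Types (f g h B : T -> R) (A : set T).
Local Notation Ex := (Rintegral P setT).
Local Notation integ := (integ P).

Section wrt.
Variable G : set (set T).
Hypothesis sG : sigma_algebra setT G.

Lemma measurable_wrt_setT : G setT.
Proof. by case: sG => G0 GD _; rewrite -(setD0 setT); exact: GD. Qed.

Lemma measurable_wrt_cst (c : R) : measurable_wrt G (cst c : T -> R).
Proof. by apply/measurable_wrtE => //; exact: measurable_cst. Qed.

Lemma measurable_wrtD f g : measurable_wrt G f -> measurable_wrt G g ->
  measurable_wrt G (fun x => f x + g x).
Proof.
move=> /(measurable_wrtE _ sG) mf /(measurable_wrtE _ sG) mg.
by apply/(measurable_wrtE _ sG); exact: measurable_funD.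
Qed.

Lemma measurable_wrtM f g : measurable_wrt G f -> measurable_wrt G g ->
  measurable_wrt G (fun x => f x * g x).
Proof.
move=> /(measurable_wrtE _ sG) mf /(measurable_wrtE _ sG) mg.
by apply/(measurable_wrtE _ sG); exact: measurable_funM.
Qed.

Lemma measurable_wrt_comp (k : R -> R) f : measurable_fun setT k ->
  measurable_wrt G f -> measurable_wrt G (fun x => k (f x)).
Proof.
move=> mk /(measurable_wrtE _ sG) mf.
by apply/(measurable_wrtE _ sG); exact: (measurableT_comp mk mf).
Qed.

Lemma measurable_wrtB f g : measurable_wrt G f -> measurable_wrt G g ->
  measurable_wrt G (fun x => f x - g x).
Proof.
move=> mf mg; apply: measurable_wrtD => //.
by apply: (measurable_wrt_comp (k := -%R)) => //; exact: oppr_measurable.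
Qed.

Lemma measurable_wrtZ (c : R) f : measurable_wrt G f ->
  measurable_wrt G (fun x => c * f x).
Proof. by apply: measurable_wrtM; exact: measurable_wrt_cst. Qed.

Lemma measurable_wrt_sum I (s : seq I) (p : pred I) (F : I -> T -> R) :
  (forall i, p i -> measurable_wrt G (F i)) ->
  measurable_wrt G (fun x => \sum_(i <- s | p i) F i x).
Proof.
move=> mF; elim: s => [|i s IH].
  by under eq_fun do rewrite big_nil; exact: measurable_wrt_cst.
under eq_fun do rewrite big_cons; case: (boolP (p i)) => // pi.
by apply: measurable_wrtD => //; exact: mF.
Qed.

Lemma measurable_wrt_indic A : G A -> measurable_wrt G (\1_A : T -> R).
Proof.
move=> GA; apply/(measurable_wrtE _ sG).
apply: (@measurable_indic _ (g_sigma_algebraType G)).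
by rewrite /measurable /= sigma_algebra_id.
Qed.

Lemma measurable_wrt_le f g : measurable_wrt G f -> measurable_wrt G g ->
  G [set x | f x <= g x].
Proof.
move=> mf mg; apply: (measurable_wrtB mg mf); exists (`[0, +oo[%classic); first exact: measurable_itv.
by apply/seteqP; split=> x /=; rewrite in_itv/= andbT subr_ge0//; case.
Qed.

Lemma measurable_wrt_lt f g : measurable_wrt G f -> measurable_wrt G g ->
  G [set x | f x < g x].
Proof.
move=> mf mg; have := measurable_wrt_le mg mf; case: sG => _ GD _ /GD.
by congr G; apply/seteqP; split=> x /=; rewrite ltNge; [case=> _ /negP|move=> /negP; split].
Qed.

Lemma measurable_wrt_max f g : measurable_wrt G f -> measurable_wrt G g ->
  measurable_wrt G (fun x => Num.max (f x) (g x)).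
Proof.
move=> /(measurable_wrtE _ sG) mf /(measurable_wrtE _ sG) mg.
by apply/(measurable_wrtE _ sG); exact: measurable_maxr.
Qed.

Lemma measurable_wrt_min f g : measurable_wrt G f -> measurable_wrt G g ->
  measurable_wrt G (fun x => Num.min (f x) (g x)).
Proof.
move=> /(measurable_wrtE _ sG) mf /(measurable_wrtE _ sG) mg.
by apply/(measurable_wrtE _ sG); exact: measurable_minr.
Qed.

End wrt.

Lemma measurable_wrt_sub (G H : set (set T)) f : G `<=` H ->
  measurable_wrt G f -> measurable_wrt H f.
Proof. by move=> GH mf; exact: subset_trans mf GH. Qed.

Lemma measurable_wrt_fun (G : set (set T)) f : G `<=` measurable ->
  measurable_wrt G f -> measurable_fun setT f.
Proof. by move=> Gm mf _ B mB; apply: Gm; apply: mf; exists B. Qed.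

Section existence.
Variable G : set (set T).
Hypothesis hG : sub_sigma_field G.

Let sG : sigma_algebra setT G := hG.1.
Let TG := g_sigma_algebraType G.
Let toG (x : T) : TG := x.

Let mtoG : measurable_fun setT toG.
Proof.
move=> _ B; rewrite /measurable /= sigma_algebra_id// => GB.
by rewrite setTI; exact: hG.2.
Qed.

HB.instance Definition _ := isMeasurableFun.Build _ _ _ _ toG mtoG.

Let PG : probability TG R := distribution P toG.

(** The conditional expectation is the Radon-Nikodym derivative, on the coarser
    measurable space, of the charge with density [f]. *)
Lemma condexp_exists f : integ f -> exists g, is_condexp P G f g.
Proof.
move=> fi; pose nu := pushforward (induced_charge fi) toG.
have mtoG' : measurable_fun setT toG by exact: mtoG.
pose nuc0 : {charge set TG -> \bar R} :=
  [the charge _ _ of pushforward [the charge _ _ of induced_charge fi] toG].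
pose nuc := nuc0 mtoG'.
have numu : nuc `<< PG.
  apply/null_content_dominatesP => A mA PA0.
  rewrite /nuc /= /pushforward /induced_charge.
  apply: null_set_integral => //.
  - by rewrite -[X in measurable X]setTI; exact: mtoG.
  - by apply: measurable_funS (measurable_int _ fi).
pose g := Radon_Nikodym nuc PG.
have gfin x : g x \is a fin_num by exact: Radon_Nikodym_fin_num.
have gi : PG.-integrable setT g by exact: Radon_Nikodym_integrable.
have gE : g = EFin \o (fine \o g) by apply/funext => x /=; rewrite fineK.
have mg : measurable_fun setT (fine \o g).
  by apply/measurable_EFinP; rewrite -gE; exact: measurable_int gi.
have mg' : measurable_fun [set: T] (g \o toG).
  by apply: measurableT_comp; [exact: measurable_int gi|exact: mtoG].
have gi' : P.-integrable setT (g \o toG).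
  apply/integrableP; split => //.
  have /integrableP[_] := gi; rewrite ge0_integral_pushforward//=.
  by apply: measurableT_comp => //; exact: measurable_int gi.
have gE' : EFin \o (fun x : T => fine (g (toG x))) = g \o toG.
  by apply/funext => x /=; rewrite fineK.
exists (fun x => fine (g (toG x))); split.
- by apply/measurable_wrtE.
- by apply/Lfun1_integrable; rewrite gE'.
- move=> A GA; have mA : measurable (A : set TG).
    by rewrite /measurable /= sigma_algebra_id.
  have mA' : measurable A by exact: hG.2.
  transitivity (nuc A) => //.
  rewrite (Radon_Nikodym_integral numu mA) integral_pushforward//.
  + by apply: eq_integral => x _ /=; rewrite fineK.
  + by apply: integrableS gi'.
Qed.

Lemma condexpP f : integ f -> is_condexp P G f (condexp P G f).
Proof.
move=> /condexp_exists[g gP]; rewrite /condexp.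
by case: xgetP => [h _ //|/(_ g)].
Qed.

Lemma measurable_wrt_condexp f : measurable_wrt G (condexp P G f).
Proof.
by rewrite /condexp; case: xgetP => [h _ []//|_]; exact: measurable_wrt_cst.
Qed.

Lemma integ_condexp f : integ (condexp P G f).
Proof.
rewrite /condexp; case: xgetP => [h _ [] _ /integP//|_].
exact: integ_cst.
Qed.

Import HBNNSimple.

(** Non-negative multipliers are increasing limits of finite combinations of
    indicators of sets of [G]. *)
Lemma simple_approx B : measurable_wrt G B -> (forall x, 0 <= B x) ->
  exists g : nat -> T -> R,
    [/\ (forall m, exists (r : seq R) (A : R -> set T), (forall y, G (A y)) /\
           forall x, g m x \in r /\ g m x = \sum_(y <- r) y * \1_(A y) x),
        (forall m x, 0 <= g m x), (forall m x, g m x <= B x) &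
        (forall x, g m x @[m --> \oo] --> B x)].
Proof.
move=> mB B0.
have mB' : measurable_fun [set: TG] (EFin \o (B : TG -> R)).
  by apply/measurable_EFinP/measurable_wrtE.
pose g := nnsfun_approx measurableT mB'.
have gB (x : TG) : g n x @[n --> \oo] --> B x.
  have := @cvg_nnsfun_approx _ TG R setT measurableT _ mB' (fun x _ => B0 x) x I.
  by move/fine_cvg.
exists (fun n x => g n x); split=> //.
- move=> m; exists (finmap.enum_fset (fset_set (range (g m)))).
  exists (fun y => g m @^-1` [set y]); split=> [y|x].
    have := measurable_funPTI (g m) (@measurable_set1 R y).
    by rewrite /measurable /= sigma_algebra_id.
  split; first by rewrite in_fset_set// inE; exists x.
  by rewrite [LHS]fimfunE fsbig_finite.
- move=> n x; rewrite -(cvg_lim _ (gB x))//; apply: nondecreasing_cvgn_le.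
    by move=> m p mp; have /lefP/(_ x) := nd_nnsfun_approx measurableT mB' mp.
  by apply/cvg_ex; exists (B x).
Qed.

Let Ex_mul0_ge0 B h : integ h ->
  (forall A, G A -> Ex (fun x => \1_A x * h x) = 0) ->
  measurable_wrt G B -> (forall x, 0 <= B x) ->
  integ (fun x => B x * h x) ->
  Ex (fun x => B x * h x) = 0.
Proof.
move=> hi h0 mB B0 Bhi.
have [g [gr g0 gle gB]] := simple_approx mB B0.
have gh n : Ex (fun x => g n x * h x) = 0 /\ measurable_fun setT (g n).
  have [r [A [GA gE]]] := gr n; split.
    under eq_fun do rewrite (gE _).2 big_distrl/=.
    have iA y : integ (fun x => \1_(A y) x * h x).
      by apply: integM_indic => //; exact: hG.2.
    under eq_fun do under eq_bigr do rewrite -mulrA.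
    rewrite Ex_sum; last by move=> y _; exact: integZ.
    by rewrite big1// => y _; rewrite ExZ// h0 ?mulr0.
  rewrite (_ : g n = fun x => \sum_(y <- r) y * \1_(A y) x); last first.
    by apply/funext => x; exact: (gE x).2.
  apply: measurable_sum => y; apply: measurable_funM => //.
  by apply: measurable_indic; exact: hG.2.
have [||||_] := @Ex_dom _ _ _ P (fun n x => g n x * h x) (fun x => B x * h x)
  (fun x => `|B x * h x|).
- by move=> n; apply: measurable_funM; [exact: (gh n).2|exact: integ_meas hi].
- exact: integ_abs.
- by move=> x; apply: cvgMl; exact: gB.
- by move=> n x; rewrite !normrM ler_wpM2r// !ger0_norm ?B0// gle.
rewrite (_ : (fun n => _) = cst 0); last first.
  by apply/funext => n /=; exact: (gh n).1.
by move/(cvg_lim (@Rhausdorff R)) => <-; rewrite lim_cst.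
Qed.

Lemma Ex_mul0 B h : integ h ->
  (forall A, G A -> Ex (fun x => \1_A x * h x) = 0) ->
  measurable_wrt G B -> integ (fun x => B x * h x) ->
  Ex (fun x => B x * h x) = 0.
Proof.
move=> hi h0 mB Bhi.
have m0 : measurable_wrt G (cst 0 : T -> R) by exact: measurable_wrt_cst.
have mp : measurable_wrt G (fun x => Num.max (B x) 0) by exact: measurable_wrt_max.
have mn : measurable_wrt G (fun x => Num.max (- B x) 0).
  apply: measurable_wrt_max => //.
  by apply: (measurable_wrt_comp sG (k := -%R)) => //; exact: oppr_measurable.
have mh := integ_meas hi.
have ip : integ (fun x => Num.max (B x) 0 * h x).
  apply: integ_le Bhi.
    by apply: measurable_funM => //; exact: (measurable_wrt_fun hG.2 mp).
  move=> x; rewrite !normrM ler_wpM2r//.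
  by have [] := leP (B x) 0; rewrite ?normr0.
have iN : integ (fun x => Num.max (- B x) 0 * h x).
  apply: integ_le Bhi.
    by apply: measurable_funM => //; exact: (measurable_wrt_fun hG.2 mn).
  move=> x; rewrite !normrM ler_wpM2r//.
  by have [] := leP (- B x) 0; rewrite ?normr0// normrN.
have -> : (fun x => B x * h x) = (fun x => Num.max (B x) 0 * h x - Num.max (- B x) 0 * h x).
  apply/funext => x; rewrite -mulrBl; congr (_ * _).
  by have [] := leP (B x) 0 => Bx; have [] := leP (- B x) 0 => Bx'; lra.
rewrite ExB// !Ex_mul0_ge0 ?subrr// => x; by rewrite le_max lexx orbT.
Qed.

(** Testing against indicators suffices to test against every multiplier. *)
Lemma is_condexp_mul f g B : is_condexp P G f g -> integ f ->
  measurable_wrt G B -> integ (fun x => B x * f x) -> integ (fun x => B x * g x) ->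
  Ex (fun x => B x * g x) = Ex (fun x => B x * f x).
Proof.
move=> [mg /integP gi gf] fi mB Bfi Bgi; apply/eqP; rewrite -subr_eq0 -ExB//.
under eq_fun do rewrite -mulrBr.
apply/eqP; apply: Ex_mul0 => //.
- exact: integB.
- move=> A GA; have mA : measurable A by exact: hG.2.
  have iA k : integ k -> integ (fun x => \1_A x * k x) by exact: integM_indic.
  under eq_fun do rewrite mulrBr.
  rewrite ExB ?iA//; apply/eqP; rewrite subr_eq0.
  by have := gf A GA; rewrite !integ_int// => -[->].
- by under eq_fun do rewrite mulrBr; exact: integB.
Qed.

(** The form in which conditional expectations are used below: a statement
    about every bounded multiplier that makes no choice of a version. *)
Lemma condexp_mul f B : integ f -> measurable_wrt G B -> bdd B ->
  Ex (fun x => B x * condexp P G f x) = Ex (fun x => B x * f x).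
Proof.
move=> fi mB bB; have mB' := measurable_wrt_fun hG.2 mB.
apply: is_condexp_mul => //; first exact: condexpP.
- by apply: integM_bdd.
- by apply: integM_bdd => //; exact: integ_condexp.
Qed.

(** The set where the inequality fails belongs to [G], so it can be tested. *)
Lemma Ex_le_ae g1 g2 : integ g1 -> integ g2 -> measurable_wrt G g1 ->
  measurable_wrt G g2 ->
  (forall A, G A -> Ex (fun x => \1_A x * g1 x) <= Ex (fun x => \1_A x * g2 x)) ->
  {ae P, forall x, g1 x <= g2 x}.
Proof.
move=> i1 i2 m1 m2 h; pose A := [set x | g2 x < g1 x].
have GA : G A by exact: measurable_wrt_lt.
have mA : measurable A by exact: hG.2.
have iA k : integ k -> integ (fun x => \1_A x * k x) by exact: integM_indic.
have : {ae P, forall x, \1_A x * (g1 x - g2 x) = 0}.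
  apply: Ex_ge0_eq0; first by apply: iA; exact: integB.
    move=> x; rewrite indicE; case: (boolP (x \in A)) => [|_]; last by rewrite mul0r.
    by rewrite inE /A/= => /ltW; rewrite mul1r subr_ge0.
  under eq_fun do rewrite mulrBr.
  by rewrite ExB ?iA// subr_le0; exact: h.
apply: filterS => x; rewrite indicE leNgt; apply: contra_eqN => xA.
by rewrite mem_set// mul1r subr_eq0 gt_eqF.
Qed.

Lemma is_condexp_uniq f g : is_condexp P G f g -> integ f ->
  {ae P, forall x, condexp P G f x = g x}.
Proof.
move=> gP fi; have cP := condexpP fi.
have [mg /integP gi gf] := gP; have [mc /integP ci cf] := cP.
have H A : G A -> Ex (fun x => \1_A x * condexp P G f x) = Ex (fun x => \1_A x * g x).
  move=> GA; have mA : measurable A by exact: hG.2.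
  by have := gf A GA; rewrite -cf// !integ_int// => -[->].
have eq_lee (x y : R) : x = y -> x <= y by move=> ->.
have := Ex_le_ae ci gi mc mg (fun A GA => eq_lee _ _ (H A GA)).
have := Ex_le_ae gi ci mg mc (fun A GA => eq_lee _ _ (esym (H A GA))).
by apply: filterS2 => x h1 h2; apply/eqP; rewrite eq_le h1 h2.
Qed.

End existence.
End conditional_expectation.

(** * Square-integrable functions *)

Section square_integrable_functions.
Context {disp : measure_display} {T : measurableType disp} {R : realType}.
Variable P : probability T R.
Implicit Types (f g h B : T -> R) (A : set T).
Local Notation Ex := (Rintegral P setT).
Local Notation integ := (integ P).

Definition sqint f := measurable_fun setT f /\ integ (fun x => f x ^+ 2).

Lemma boolr_le1 (b : bool) : b%:R <= 1 :> R.
Proof. by case: b. Qed.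

Lemma Lfun2_sqint f : f \in Lfun P 2%:E -> sqint f.
Proof.
move=> fL; split; last exact: Lfun2_integrable_sqr.
by have := sub_Lfun_mfun fL; rewrite inE.
Qed.

Lemma sqintM f g : sqint f -> sqint g -> integ (fun x => f x * g x).
Proof.
move=> [mf fi] [mg gi]; apply: (integ_le _ _ (integD fi gi)).
  exact: measurable_funM.
move=> x; rewrite [leRHS]ger0_norm ?addr_ge0 ?sqr_ge0// normrM.
by rewrite -(real_normK (num_real (f x))) -(real_normK (num_real (g x))); nra.
Qed.

Lemma sqint_cst (c : R) : sqint (cst c).
Proof. by split; [exact: measurable_cst|exact: (integ_cst P (c ^+ 2))]. Qed.

Lemma sqint_integ f : sqint f -> integ f.
Proof.
move=> fi; have := sqintM (sqint_cst 1) fi.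
by under eq_fun do rewrite /cst mul1r.
Qed.

Lemma sqint_le f g : measurable_fun setT f -> (forall x, `|f x| <= `|g x|) ->
  sqint g -> sqint f.
Proof.
move=> mf fg [mg gi]; split=> //; apply: integ_le gi.
  exact: measurable_funX.
by move=> x; rewrite !normrX lerXn2r ?nnegrE.
Qed.

Lemma sqintD f g : sqint f -> sqint g -> sqint (fun x => f x + g x).
Proof.
move=> sf sg; have [mf fi] := sf; have [mg gi] := sg; split.
  exact: measurable_funD.
under eq_fun do rewrite sqrrD -mulr_natl.
apply: integD => //; apply: integD => //; apply: integZ; exact: sqintM.
Qed.

Lemma sqintZ (c : R) f : sqint f -> sqint (fun x => c * f x).
Proof.
move=> [mf fi]; split; first exact: measurable_funM.
by under eq_fun do rewrite exprMn; exact: integZ.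
Qed.

Lemma sqintB f g : sqint f -> sqint g -> sqint (fun x => f x - g x).
Proof.
move=> sf sg; under eq_fun do rewrite -mulN1r.
by apply: sqintD => //; exact: sqintZ.
Qed.

Lemma sqint_sum I (s : seq I) (p : pred I) (F : I -> T -> R) :
  (forall i, p i -> sqint (F i)) -> sqint (fun x => \sum_(i <- s | p i) F i x).
Proof.
move=> Fi; elim: s => [|i s IH].
  by under eq_fun do rewrite big_nil; exact: sqint_cst.
under eq_fun do rewrite big_cons; case: (boolP (p i)) => // pi.
by apply: sqintD => //; exact: Fi.
Qed.

Lemma sqintM_bdd B f : measurable_fun setT B -> bdd B -> sqint f ->
  sqint (fun x => B x * f x).
Proof.
move=> mB [M BM] fi; apply: (sqint_le _ _ (sqintZ M fi)).
  by apply: measurable_funM => //; case: fi.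
by move=> x; rewrite !normrM ler_wpM2r// (le_trans (BM x))// ler_norm.
Qed.

(** Testing the truncations of [condexp f] against [f] bounds their second
    moments by that of [f]. *)
Lemma sqint_condexp (G : set (set T)) f : sub_sigma_field G -> sqint f ->
  sqint (condexp P G f).
Proof.
move=> hG sf; have [mf fi2] := sf; have sG := hG.1.
have fi := sqint_integ sf.
set g := condexp P G f.
have mgG : measurable_wrt G g by exact: measurable_wrt_condexp.
have mg := measurable_wrt_fun hG.2 mgG.
have gi : integ g by exact: integ_condexp.
split=> //.
pose b n x : R := \1_[set y | `|g y| <= n%:R] x.
have Gb n : G [set y | `|g y| <= n%:R].
  apply: measurable_wrt_le => //; last exact: measurable_wrt_cst.
  by apply: measurable_wrt_comp => //; exact: normr_measurable.
have mbG n : measurable_wrt G (b n) by exact: measurable_wrt_indic.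
have mb n : measurable_fun setT (b n) := measurable_wrt_fun hG.2 (mbG n).
have b0 n x : 0 <= b n x by rewrite /b indicE.
have bb n x : b n x * b n x = b n x.
  by rewrite /b indicE; case: (_ \in _); rewrite ?mulr1 ?mulr0.
have bgb n : bdd (fun x => b n x * g x).
  exists n%:R => x; rewrite /b indicE; case: (boolP (x \in _)) => [|_].
    by rewrite inE/= mul1r.
  by rewrite mul0r normr0.
have mbg n : measurable_fun setT (fun x => b n x * g x) by exact: measurable_funM.
have ib n : integ (fun x => b n x * g x ^+ 2).
  under eq_fun do rewrite expr2 mulrA.
  by apply: integM_bdd.
have Eb n : Ex (fun x => b n x * g x ^+ 2) <= Ex (fun x => f x ^+ 2).
  have E1 : Ex (fun x => b n x * g x ^+ 2) = Ex (fun x => b n x * g x * f x).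
    under eq_fun do rewrite expr2 mulrA.
    apply: condexp_mul => //; exact: measurable_wrtM.
  have i1 : integ (fun x => b n x * g x * f x) by exact: integM_bdd.
  have : Ex (fun x => 2 * (b n x * g x * f x)) <=
         Ex (fun x => b n x * g x ^+ 2 + f x ^+ 2).
    apply: Ex_le; [exact: integZ|exact: integD|] => x.
    rewrite -(bb n x).
    have := sqr_ge0 (b n x * g x - f x).
    move: (bb n x) (b0 n x); rewrite /b indicE.
    by case: (_ \in _); rewrite ?mulr1 ?mul1r ?mulr0 ?mul0r => _ _; nra.
  rewrite ExD// ExZ// -E1; lra.
have mg2 : measurable_fun setT (fun x => g x ^+ 2) by exact: measurable_funX.
apply/integrableP; split; first exact/measurable_EFinP.
under eq_integral do rewrite abse_EFin ger0_norm ?sqr_ge0//.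
have cvb x : (b n x * g x ^+ 2)%:E @[n --> \oo] --> (g x ^+ 2)%:E.
  apply: cvg_near_cst; near=> n; congr EFin.
  rewrite /b indicE mem_set ?mul1r//=.
  by near: n; exact: nbhs_infty_ger.
rewrite (_ : (fun x => (g x ^+ 2)%:E) =
    fun x => limn (fun n => (b n x * g x ^+ 2)%:E)); last first.
  by apply/funext => x; apply/esym/cvg_lim.
rewrite monotone_convergence//; last 3 first.
- move=> n; apply/measurable_EFinP; exact: measurable_funM.
- by move=> n x _; rewrite lee_fin mulr_ge0 ?sqr_ge0.
- move=> x _ m n mn; rewrite lee_fin ler_wpM2r ?sqr_ge0//.
  rewrite /b !indicE; case: (boolP (x \in _)) => //.
  rewrite inE /= => xm; rewrite mem_set//= (le_trans xm)//.
  by rewrite ler_nat.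
apply: (@le_lt_trans _ _ (Ex (fun x => f x ^+ 2))%:E); last exact: ltry.
apply: lime_le; last first.
  by apply: nearW => n; rewrite Ex_EFin// lee_fin.
apply: ereal_nondecreasing_is_cvgn => m n mn.
rewrite !Ex_EFin// lee_fin; apply: Ex_le => // x.
rewrite ler_wpM2r ?sqr_ge0//.
rewrite /b !indicE; case: (boolP (x \in _)) => //.
rewrite inE /= => xm; rewrite mem_set//= (le_trans xm)//.
by rewrite ler_nat.
Unshelve. all: by end_near. Qed.

End square_integrable_functions.

Section condexp_more.
Context {disp : measure_display} {T : measurableType disp} {R : realType}.
Variable P : probability T R.
Implicit Types (f g h B : T -> R) (A : set T).
Local Notation Ex := (Rintegral P setT).
Local Notation integ := (integ P).

Lemma condexp_self (G : set (set T)) f : sub_sigma_field G -> integ f ->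
  measurable_wrt G f -> {ae P, forall x, condexp P G f x = f x}.
Proof.
move=> hG fi mf; apply: is_condexp_uniq => //; split=> //; exact/integP.
Qed.

Lemma condexp_tower (G H : set (set T)) f : sub_sigma_field G ->
  sub_sigma_field H -> G `<=` H -> integ f ->
  {ae P, forall x, condexp P G (condexp P H f) x = condexp P G f x}.
Proof.
move=> hG hH GH fi; have [mH iH eH] := condexpP hH fi.
have [mG iG eG] := condexpP hG fi.
apply: is_condexp_uniq => //; last exact: integ_condexp.
by split=> // A GA; rewrite eG// eH//; exact: GH.
Qed.

Lemma condexp_ae0 (G : set (set T)) f : sub_sigma_field G -> integ f ->
  {ae P, forall x, f x = 0} -> {ae P, forall x, condexp P G f x = 0}.
Proof.
move=> hG fi f0; apply: (is_condexp_uniq hG _ fi); split.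
- exact: measurable_wrt_cst hG.1 _.
- by apply/integP; exact: integ_cst.
- move=> A GA; have mA : measurable A by exact: hG.2.
  apply: ae_eq_integral => //.
    by apply: measurable_funTS; exact: measurable_int fi.
  by apply: filterS f0 => x /= -> _.
Qed.

(** The lag condition concerns one field only; the tower property carries it
    to all the smaller ones. *)
Lemma condexp_sub0 (G H : set (set T)) f : sub_sigma_field G ->
  sub_sigma_field H -> G `<=` H -> integ f ->
  {ae P, forall x, condexp P H f x = 0} -> {ae P, forall x, condexp P G f x = 0}.
Proof.
move=> hG hH GH fi h0; have h1 := condexp_tower hG hH GH fi.
have h2 := condexp_ae0 hG (integ_condexp P H f) h0.
by apply: filterS2 h1 h2 => x <-.
Qed.

Lemma condexp_ge0 (G : set (set T)) f : sub_sigma_field G -> integ f ->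
  (forall x, 0 <= f x) -> {ae P, forall x, 0 <= condexp P G f x}.
Proof.
move=> hG fi f0; have [mG /integP iG eG] := condexpP hG fi.
have m0 : measurable_wrt G (cst 0 : T -> R) by exact: measurable_wrt_cst hG.1 _.
have := Ex_le_ae hG (integ_cst P 0) iG m0 mG; apply.
move=> A GA; have mA : measurable A by exact: hG.2.
rewrite condexp_mul//; [|exact: measurable_wrt_indic hG.1 _ GA|exact: bdd_indic].
apply: Ex_le; [exact: (integM_indic mA (integ_cst P 0))|exact: integM_indic|] => x.
by rewrite ler_wpM2l// indicE.
Qed.

End condexp_more.

(** * Taylor bounds for the cosine and the exponential *)

Section elementary_inequalities.
Context {R : realType}.
Implicit Types (x t phi : R) (f df : R -> R).

(** Mean value inequality from which the Taylor bounds follow by repeated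
    integration: the bound on each remainder is the bound on the derivative
    of the next one. *)
Lemma increment_le f df (M : R) x : (forall t, is_derive t 1 f (df t)) ->
  f 0 = 0 -> (forall t, `|t| <= `|x| -> `|df t| <= M) -> `|f x| <= M * `|x|.
Proof.
move=> fd f0 dfM.
have cf : continuous f by move=> t; apply/differentiable_continuous/derivable1_diffP.
have cw A : {within A, continuous f} by exact: continuous_subspaceT.
have [x0|x0] := leP 0 x.
  have [c] := MVT_segment x0 (fun t _ => fd t) (cw _).
  rewrite in_itv/= f0 !subr0 => /andP[c0 cx] ->.
  rewrite normrM ler_wpM2r//; apply: dfM.
  by rewrite !ger0_norm.
have [c] := MVT_segment (ltW x0) (fun t _ => fd t) (cw _).
rewrite in_itv/= f0 !sub0r => /andP[c0 cx] /(congr1 Num.norm).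
rewrite normrN normrM normrN => ->; rewrite ler_wpM2r//; apply: dfM.
by rewrite !ler0_norm ?lerN2// ltW.
Qed.

Lemma cos_increment phi x : `|cos (phi + x) - cos phi| <= `|x|.
Proof.
rewrite -[leRHS]mul1r.
apply: (@increment_le (fun t => cos (phi + t) - cos phi) (fun t => - sin (phi + t))).
- by move=> t; apply: is_derive_eq; rewrite /GRing.scale/=; ring.
- by rewrite addr0 subrr.
- by move=> t _; rewrite normrN sin_max.
Qed.

Lemma sin_increment phi x : `|sin (phi + x) - sin phi| <= `|x|.
Proof.
rewrite -[leRHS]mul1r.
apply: (@increment_le (fun t => sin (phi + t) - sin phi) (fun t => cos (phi + t))).
- by move=> t; apply: is_derive_eq; rewrite /GRing.scale/=; ring.
- by rewrite addr0 subrr.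
- by move=> t _; rewrite cos_max.
Qed.

Lemma sin_taylor1 phi x : `|sin (phi + x) - sin phi - x * cos phi| <= `|x| * `|x|.
Proof.
apply: (@increment_le (fun t => sin (phi + t) - sin phi - t * cos phi)
   (fun t => cos (phi + t) - cos phi)).
- by move=> t; apply: is_derive_eq; rewrite /GRing.scale/=; ring.
- by rewrite addr0 subrr mul0r subrr.
- by move=> t; apply: le_trans; exact: cos_increment.
Qed.

Lemma cos_taylor1 phi x : `|cos (phi + x) - cos phi + x * sin phi| <= `|x| * `|x|.
Proof.
apply: (@increment_le (fun t => cos (phi + t) - cos phi + t * sin phi)
   (fun t => - (sin (phi + t) - sin phi))).
- by move=> t; apply: is_derive_eq; rewrite /GRing.scale/=; ring.
- by rewrite addr0 subrr mul0r addr0.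
- by move=> t; apply: le_trans; rewrite normrN; exact: sin_increment.
Qed.

Lemma cos_taylor2 phi x :
  `|cos (phi + x) - (cos phi - x * sin phi - x ^+ 2 / 2 * cos phi)|
    <= `|x| * `|x| * `|x|.
Proof.
apply: (@increment_le
   (fun t => cos (phi + t) - (cos phi - t * sin phi - t ^+ 2 / 2 * cos phi))
   (fun t => - (sin (phi + t) - sin phi - t * cos phi))).
- by move=> t; apply: is_derive_eq; rewrite /GRing.scale/=; field.
- by rewrite addr0 !mul0r expr0n/= !mul0r !subr0 subrr.
- move=> t tx; rewrite normrN (le_trans (sin_taylor1 _ _))//.
  by rewrite ler_pM.
Qed.

(** The cubic remainder is used for small increments and the quadratic one
    for large increments, which a Lindeberg condition controls. *)
Lemma cos_taylor2_lindeberg phi x (eps : R) : 0 < eps ->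
  `|cos (phi + x) - (cos phi - x * sin phi - x ^+ 2 / 2 * cos phi)|
    <= eps * x ^+ 2 + 2 * (x ^+ 2 * (eps <= `|x|)%R%:R).
Proof.
move=> e0; have e2 : x ^+ 2 = `|x| ^+ 2 by rewrite real_normK ?num_real.
rewrite [in leRHS]e2.
have x0 : 0 <= `|x| by [].
have [ex|xe] := leP eps `|x|; last first.
  apply: (le_trans (cos_taylor2 _ _)); rewrite mulr0 mulr0 addr0; nra.
have := cos_taylor1 phi x.
have : `|x ^+ 2 / 2 * cos phi| <= `|x| ^+ 2.
  rewrite normrM ger0_norm; last by rewrite divr_ge0// sqr_ge0.
  by rewrite real_normK ?num_real//; have := cos_max phi; have := sqr_ge0 x; nra.
rewrite mulr1; set a := x ^+ 2 / 2 * _; set b := _ + x * _ => ha hb.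
have -> : cos (phi + x) - (cos phi - x * sin phi - a) = b + a by rewrite /b; ring.
have := ler_normD b a; nra.
Qed.

Lemma expRN_taylor1 (y : R) : 0 <= y -> `|1 - y - expR (- y)| <= y ^+ 2.
Proof.
move=> y0; have h1 := expR_ge1Dx (- y).
have h2 : expR (- y) <= 1 - y + y ^+ 2.
  rewrite expRN; apply: (@le_trans _ _ (1 + y)^-1).
    by rewrite lef_pV2 ?posrE ?expR_gt0 ?expR_ge1Dx//; lra.
  rewrite -[leLHS]mul1r ler_pdivrMr; nra.
by rewrite ler0_norm; lra.
Qed.

Lemma expR_increment (a b : R) : a <= b -> `|expR b - expR a| <= expR b * (b - a).
Proof.
move=> ab; rewrite ger0_norm ?subr_ge0 ?ler_expR//.
have := expR_ge1Dx (a - b).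
have -> : expR a = expR b * expR (a - b) by rewrite -expRD addrC subrK.
have := expR_gt0 b; nra.
Qed.

End elementary_inequalities.

(** * The damped cosine of a stopped martingale row *)

(** The steps up to time [r] are those at which an event of the field of time
    [r] may still be undecided. *)
Lemma count_upto (s n r : nat) : (0 < s)%N ->
  (\sum_(s <= i < n) (i <= r) <= minn r n.-1)%N.
Proof.
move=> s0; elim: n => [|n IH]; first by rewrite big_geq.
have [sn|ns] := leqP s n; last by rewrite big_geq.
rewrite big_nat_recr//=; move: IH; set S := (\sum_(_ <= _ < _) _)%N.
by case: leqP => /=; lia.
Qed.

Section martingale_row.
Context {disp : measure_display} {T : measurableType disp} {R : realType}.
Variable P : probability T R.
Variables (F : nat -> set (set T)) (s K : nat).
Implicit Types (xi v l : nat -> T -> R).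
Local Notation Ex := (Rintegral P setT).
Local Notation integ := (integ P).
Local Notation sqint := (sqint P).

(** Martingale differences [xi] with conditional variances [v]. Conditional
    moments are expressed by testing against multipliers, so that no version
    has to be chosen. The multipliers in the orthogonality clause may be
    unbounded because they include the partial sums of the row. *)
Definition mart_row xi v : Prop := forall k, (s <= k <= K)%N ->
  [/\ measurable_wrt (F k) (xi k), sqint (xi k),
      (forall B, measurable_wrt (F k.-1) B -> integ (fun x => B x * xi k x) ->
         Ex (fun x => B x * xi k x) = 0),
      [/\ measurable_wrt (F k.-1) (v k), (forall x, 0 <= v k x) & integ (v k)] &
      (forall B, measurable_wrt (F k.-1) B -> bdd B ->
         Ex (fun x => B x * xi k x ^+ 2) = Ex (fun x => B x * v k x))].

(** The variables [l k] are upper bounds for the conditional expectations of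
    the truncated squares. *)
Definition lindeberg_row xi (eps : R) l : Prop := forall k, (s <= k <= K)%N ->
  [/\ measurable_wrt (F k.-1) (l k), (forall x, 0 <= l k x), integ (l k) &
      (forall B, measurable_wrt (F k.-1) B -> bdd B -> (forall x, 0 <= B x) ->
         Ex (fun x => B x * (xi k x ^+ 2 * (eps <= `|xi k x|)%R%:R)) <=
         Ex (fun x => B x * l k x))].

Lemma integ_tail (f : T -> R) (eps : R) : sqint f ->
  integ (fun x => f x ^+ 2 * (eps <= `|f x|)%R%:R).
Proof.
move=> [mf fi]; apply: integ_le fi.
  apply: measurable_funM; first exact: measurable_funX.
  rewrite (_ : (fun x => _) = \1_[set x | eps <= `|f x|]); last first.
    apply/funext => x; rewrite indicE; congr (_%:R); congr nat_of_bool.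
    by apply/idP/idP => [h|/set_mem//]; apply/mem_set.
  apply: measurable_indic; rewrite -[X in measurable X]setTI.
  by apply: measurable_fun_le => //; exact: measurableT_comp.
by move=> x; rewrite normrM ler_piMr// ger0_norm ?boolr_le1.
Qed.

Hypothesis hF : filtration K F.
Hypothesis hs : (1 <= s <= K)%N.

Lemma row_field k : (k <= K)%N -> sub_sigma_field (F k).
Proof. exact: hF.1. Qed.

Lemma row_field_pred k : (k <= K)%N -> sub_sigma_field (F k.-1).
Proof. by move=> kK; apply: hF.1; rewrite (leq_trans (leq_pred _)). Qed.

Lemma row_field_sub i j : (i <= j <= K)%N -> F i `<=` F j.
Proof. exact: hF.2. Qed.

(** Truncated squares are also bounded by squares, so [v] may serve as a second
    bound; on stopped rows this makes the sum of the bounds bounded, whence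
    convergence in probability implies convergence of expectations. *)
Lemma lindeberg_row_min xi v eps l : mart_row xi v -> lindeberg_row xi eps l ->
  lindeberg_row xi eps (fun k x => Num.min (l k x) (v k x)).
Proof.
move=> hx hl k kK; have [mx sx _ [mv v0 vi] xv] := hx k kK.
have [ml l0 li hB] := hl k kK.
have /andP[_ kK'] := kK; have hG := row_field_pred kK'; have sG := hG.1.
have mm : measurable_wrt (F k.-1) (fun x => Num.min (l k x) (v k x)).
  exact: measurable_wrt_min.
have m0 x : 0 <= Num.min (l k x) (v k x) by rewrite le_min l0 v0.
have mi : integ (fun x => Num.min (l k x) (v k x)).
  apply: integ_le li; first exact: measurable_wrt_fun hG.2 mm.
  by move=> x; rewrite !ger0_norm// ge_min lexx.
split=> // B mB bB B0.
pose D := [set x | l k x <= v k x].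
have GD : F k.-1 D by exact: measurable_wrt_le.
have GDc : F k.-1 (~` D) by rewrite -setTD; case: sG => _ + _; apply.
have mBD : measurable_wrt (F k.-1) (fun x => B x * \1_D x).
  by apply: measurable_wrtM => //; exact: measurable_wrt_indic.
have mBDc : measurable_wrt (F k.-1) (fun x => B x * \1_(~` D) x).
  by apply: measurable_wrtM => //; exact: measurable_wrt_indic.
have bBD : bdd (fun x => B x * \1_D x) by apply: bddM => //; exact: bdd_indic.
have bBDc : bdd (fun x => B x * \1_(~` D) x) by apply: bddM => //; exact: bdd_indic.
have ti := integ_tail eps sx; have [_ xi2] := sx.
have mul B' f : measurable_wrt (F k.-1) B' -> bdd B' -> integ f ->
    integ (fun x => B' x * f x).
  by move=> mB' bB'; apply: integM_bdd => //; exact: measurable_wrt_fun hG.2 mB'.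
have DE x : \1_D x = (l k x <= v k x)%R%:R :> R.
  rewrite indicE; congr (_%:R); congr nat_of_bool.
  by apply/idP/idP => [/set_mem//|h]; apply/mem_set.
have DcE x : \1_(~` D) x = 1 - (l k x <= v k x)%R%:R :> R.
  rewrite indicE in_setC; have := DE x; rewrite indicE.
  by case: (x \in D) => /= <-; rewrite ?subrr ?subr0.
have -> : (fun x => B x * (xi k x ^+ 2 * (eps <= `|xi k x|)%R%:R)) =
  (fun x => B x * \1_D x * (xi k x ^+ 2 * (eps <= `|xi k x|)%R%:R) +
   B x * \1_(~` D) x * (xi k x ^+ 2 * (eps <= `|xi k x|)%R%:R)).
  by apply/funext => x; rewrite DE DcE; ring.
have -> : (fun x => B x * Num.min (l k x) (v k x)) =
  (fun x => B x * \1_D x * l k x + B x * \1_(~` D) x * v k x).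
  apply/funext => x; rewrite DE DcE; have [_|_] := leP; rewrite ?mulr1n ?mulr0n; ring.
rewrite !ExD; try exact: mul.
apply: lerD.
  by apply: hB => // x; rewrite mulr_ge0// DE.
rewrite -xv//; apply: Ex_le; [exact: mul|exact: mul|] => x.
rewrite ler_wpM2l// ?mulr_ge0// ?indicE// ler_piMr ?sqr_ge0//.
exact: boolr_le1.
Qed.

End martingale_row.

Section row_estimate.
Context {disp : measure_display} {T : measurableType disp} {R : realType}.
Variable P : probability T R.
Variables (F : nat -> set (set T)) (s K : nat).
Variables (xi v l : nat -> T -> R) (eps C theta : R).
Local Notation Ex := (Rintegral P setT).
Local Notation integ := (integ P).
Local Notation sqint := (sqint P).

Hypothesis hF : filtration K F.
Hypothesis hs : (1 <= s <= K)%N.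
Hypothesis hx : mart_row P F s K xi v.
Hypothesis hl : lindeberg_row P F s K xi eps l.
Hypothesis hlv : forall k x, l k x <= v k x.
Hypothesis eps0 : 0 < eps.
Hypothesis C0 : 0 <= C.

(** The row is stopped before its conditional variance exceeds [C]. Since that
    variance is predictable, so is the stopping factor. *)
Definition var_upto k x : R := \sum_(s <= j < k.+1) v j x.
Definition stop k x : R := \1_[set y | var_upto k y <= C] x.
Definition stopped_sum (f : nat -> T -> R) k x : R :=
  \sum_(s <= j < k.+1) stop j x * f j x.
(** If [S] is a martingale with conditional variance [V], the second order
    terms of the two factors cancel, and this process is nearly a martingale. *)
Definition exp_mart k x : R :=
  expR (stopped_sum v k x / 2) * cos (stopped_sum xi k x + theta).

Local Notation V' := (stopped_sum v).
Local Notation S' := (stopped_sum xi).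
Local Notation M := exp_mart.

Let inK k : (s <= k <= K)%N -> (k <= K)%N. Proof. by case/andP. Qed.

Lemma stopE k x : stop k x = (var_upto k x <= C)%R%:R.
Proof.
rewrite /stop indicE; congr (_%:R); congr nat_of_bool.
by apply/idP/idP => [/set_mem//|h]; apply/mem_set.
Qed.

Lemma stop_ge0 k x : 0 <= stop k x.
Proof. by rewrite stopE. Qed.

Lemma stop_idem k x : stop k x * stop k x = stop k x.
Proof. by rewrite stopE; case: (_ <= _); rewrite ?mulr1 ?mulr0. Qed.

Lemma stop_le1 k x : stop k x <= 1.
Proof. by rewrite stopE boolr_le1. Qed.

Lemma stopped_sum_small f k : (k < s)%N -> stopped_sum f k = cst 0.
Proof. by move=> ks; apply/funext => x; rewrite /stopped_sum big_geq. Qed.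

Lemma stopped_sum_rec f k x : (s <= k)%N ->
  stopped_sum f k x = stopped_sum f k.-1 x + stop k x * f k x.
Proof.
move=> sk; have k0 : (0 < k)%N by case/andP: hs => s0 _; exact: leq_trans s0 sk.
by rewrite /stopped_sum prednK// big_nat_recr.
Qed.

Let v_ge0 k x : (s <= k <= K)%N -> 0 <= v k x.
Proof. by move=> /hx[_ _ _ [_ + _] _]. Qed.

Lemma stopped_var_le k x : (k <= K)%N -> V' k x <= var_upto k x.
Proof.
move=> kK; rewrite /V' /var_upto !big_nat; apply: ler_sum => j /andP[sj jk].
rewrite -[leRHS]mul1r ler_wpM2r ?stop_le1//.
by apply: v_ge0; rewrite sj (leq_trans _ kK).
Qed.

Lemma stopped_var_leC k x : (k <= K)%N -> V' k x <= C.
Proof.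
elim: k => [|k IH] kK.
  by rewrite stopped_sum_small//; case/andP: hs.
have [sk|ks] := leqP s k.+1; last by rewrite stopped_sum_small.
have [VC|VC] := leP (var_upto k.+1 x) C.
  by rewrite (le_trans (stopped_var_le _ kK)).
have st0 : stop k.+1 x = 0 by rewrite stopE leNgt VC.
by rewrite stopped_sum_rec// st0 mul0r addr0; apply: IH; exact: ltnW.
Qed.

Lemma stopped_var_ge0 k x : (k <= K)%N -> 0 <= V' k x.
Proof.
move=> kK; rewrite /V' big_nat sumr_ge0// => j /andP[sj jk].
by rewrite mulr_ge0 ?stop_ge0 ?v_ge0// sj (leq_trans _ kK).
Qed.

Lemma stopped_incr_le k x : (s <= k <= K)%N -> stop k x * v k x <= C.
Proof.
move=> kK; have /andP[sk kK'] := kK; apply: le_trans (stopped_var_leC x kK').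
rewrite (stopped_sum_rec _ _ sk) lerDr; apply: stopped_var_ge0.
by rewrite (leq_trans (leq_pred _)).
Qed.

Let fieldP k : (k <= K)%N -> sub_sigma_field (F k) := row_field hF (k := k).
Let fieldP1 k : (k <= K)%N -> sub_sigma_field (F k.-1) := row_field_pred hF (k := k).

Let wrt_le i j (f : T -> R) : (i <= j <= K)%N -> measurable_wrt (F i) f ->
  measurable_wrt (F j) f.
Proof. by move=> ij; apply: measurable_wrt_sub; exact: row_field_sub hF _ _ ij. Qed.

Lemma measurable_var_upto k : (k <= K)%N -> measurable_wrt (F k.-1) (var_upto k).
Proof.
move=> kK; have [sG _] := fieldP1 kK.
rewrite /var_upto; under eq_fun do rewrite big_nat.
apply: measurable_wrt_sum => // j /andP[sj jk].
have jK : (s <= j <= K)%N by rewrite sj (leq_trans _ kK).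
have [_ _ _ [mv _ _] _] := hx jK; apply: wrt_le mv; apply/andP; split.
  by move: jk; rewrite ltnS; case: (j) (k) => [|j'] [|k'].
by rewrite (leq_trans (leq_pred _)).
Qed.

Lemma measurable_stop k : (k <= K)%N -> measurable_wrt (F k.-1) (stop k).
Proof.
move=> kK; have [sG _] := fieldP1 kK; apply: measurable_wrt_indic => //.
by apply: measurable_wrt_le => //; [exact: measurable_var_upto|exact: measurable_wrt_cst].
Qed.

Lemma measurable_stopped_sum f k : (k <= K)%N ->
  (forall j, (s <= j <= k)%N -> measurable_wrt (F k) (f j)) ->
  measurable_wrt (F k) (stopped_sum f k).
Proof.
move=> kK mf; have [sG _] := fieldP kK.
rewrite /stopped_sum; under eq_fun do rewrite big_nat.
apply: measurable_wrt_sum => // j /andP[sj jk].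
apply: measurable_wrtM => //; last by apply: mf; rewrite sj -ltnS.
apply: (wrt_le (i := j.-1)); last by apply: measurable_stop; rewrite -ltnS (leq_trans jk).
by rewrite kK andbT (leq_trans (leq_pred j)).
Qed.

Lemma measurable_S' k : (k <= K)%N -> measurable_wrt (F k) (S' k).
Proof.
move=> kK; apply: measurable_stopped_sum => // j /andP[sj jk].
have jK : (s <= j <= K)%N by rewrite sj (leq_trans jk).
by have [mx _ _ _ _] := hx jK; apply: wrt_le mx; rewrite jk.
Qed.

Lemma measurable_V' k : (s <= k <= K)%N -> measurable_wrt (F k.-1) (V' k).
Proof.
move=> /[dup] kk /andP[sk kK]; have [sG _] := fieldP1 kK.
have mst := measurable_stop kK.
have [_ _ _ [mv _ _] _] := hx kk.
rewrite (_ : V' k = fun x => V' k.-1 x + stop k x * v k x); last first.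
  by apply/funext => x; rewrite stopped_sum_rec.
apply: measurable_wrtD => //; last exact: measurable_wrtM.
apply: measurable_stopped_sum => [|j /andP[sj jk]].
  by rewrite (leq_trans (leq_pred _)).
have jK : (s <= j <= K)%N.
  by rewrite sj (leq_trans jk)// (leq_trans (leq_pred _)).
have [_ _ _ [mvj _ _] _] := hx jK; apply: wrt_le mvj.
by rewrite (leq_trans (leq_pred _) jk) (leq_trans (leq_pred _)).
Qed.

Local Notation e := (expR (C / 2)).

Lemma expV_le k x : (k <= K)%N -> expR (V' k x / 2) <= e.
Proof. by move=> kK; rewrite ler_expR ler_pM2r ?stopped_var_leC. Qed.

Lemma exp_mart_le k x : (k <= K)%N -> `|M k x| <= e.
Proof.
move=> kK; rewrite /M normrM -[leRHS]mulr1 ler_pM ?cos_max//.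
by rewrite ger0_norm ?expR_ge0// expV_le.
Qed.

Lemma measurable_exp_mart k : (s.-1 <= k <= K)%N -> measurable_wrt (F k) (M k).
Proof.
move=> /andP[sk kK]; have [sG sm] := fieldP kK.
have mc : measurable_fun setT (@cos R).
  by apply: continuous_measurable_fun; exact: continuous_cos.
apply: measurable_wrtM => //.
  apply: (measurable_wrt_comp sG (k := expR)); first exact: measurable_expR.
  apply: measurable_wrtM => //; last exact: measurable_wrt_cst.
  have [ks|sk'] := ltnP k s.
    by rewrite stopped_sum_small//; exact: measurable_wrt_cst.
  apply: (wrt_le (i := k.-1)); first by rewrite leq_pred.
  by apply: measurable_V'; rewrite sk'.
apply: (measurable_wrt_comp sG (k := cos)) => //.
apply: measurable_wrtD => //; first exact: measurable_S'.
exact: measurable_wrt_cst.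
Qed.

Let predK k : (s <= k <= K)%N -> (s.-1 <= k.-1 <= K)%N.
Proof.
move=> /andP[sk kK]; rewrite (leq_trans (leq_pred _) kK) andbT.
by move: sk; case: (s) (k) => [|s'] [|k'].
Qed.

Let mF k (f : T -> R) : (k <= K)%N -> measurable_wrt (F k) f -> measurable_fun setT f.
Proof. by move=> kK; apply: measurable_wrt_fun; exact: (fieldP kK).2. Qed.

Let mF1 k (f : T -> R) : (k <= K)%N -> measurable_wrt (F k.-1) f -> measurable_fun setT f.
Proof. by move=> kK; apply: measurable_wrt_fun; exact: (fieldP1 kK).2. Qed.

Let bstop k : bdd (stop k). Proof. exact: bdd_indic. Qed.

Let mulst k f : (k <= K)%N -> integ f -> integ (fun x => stop k x * f x).
Proof.
by move=> kK; apply: integM_bdd => //; apply: (mF1 kK); exact: measurable_stop.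
Qed.

Local Notation El := (fun k => Ex (fun x => stop k x * l k x)).
Local Notation Ev := (fun k => Ex (fun x => stop k x * v k x)).

Lemma Ex_tail_le k (B : T -> R) : (s <= k <= K)%N -> measurable_wrt (F k.-1) B ->
  bdd B -> (forall x, 0 <= B x) ->
  Ex (fun x => B x * v k x) <= eps ^+ 2 * Ex B + Ex (fun x => B x * l k x).
Proof.
move=> kk mB bB B0; have kK := inK kk; have [mx sx _ _ xv] := hx kk.
have [_ _ li lB] := hl kk; have [_ x2i] := sx.
have mB' := mF1 kK mB; have Bi := integ_bdd P mB' bB.
have ti := integ_tail eps sx.
have mul f : integ f -> integ (fun x => B x * f x) by exact: integM_bdd.
rewrite -xv//; apply: le_trans (lerD (lexx _) (lB B mB bB B0)).
rewrite -ExZ// -ExD//; [|exact: integZ|exact: mul].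
apply: Ex_le; [exact: mul|by apply: integD; [exact: integZ|exact: mul]|] => x.
rewrite (mulrC _ (B x)) -mulrDr ler_wpM2l//.
rewrite -(real_normK (num_real (xi k x))).
by have [_|xe] := leP eps; rewrite ?mulr1 ?mulr0 ?addr0; have := normr_ge0 (xi k x); nra.
Qed.

Lemma Ev_le k : (s <= k <= K)%N -> Ev k <= eps ^+ 2 + El k.
Proof.
move=> kk; have kK := inK kk; have mst := measurable_stop kK.
apply: (le_trans (Ex_tail_le kk mst (bstop k) (stop_ge0 k))).
rewrite lerD2r -[leRHS]mulr1 ler_wpM2l ?sqr_ge0//.
rewrite -[leRHS](Ex_cst P 1); apply: Ex_le => [||x]; last exact: stop_le1.
  by apply: integ_bdd => //; exact: mF1 mst.
exact: integ_cst.
Qed.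

Lemma Exi_le k : (s <= k <= K)%N ->
  Ex (fun x => `|stop k x * xi k x|) <= eps + El k / eps.
Proof.
move=> kk; have kK := inK kk; have mst := measurable_stop kK.
have [mx sx _ _ xv] := hx kk; have [_ _ li lB] := hl kk.
have ti := integ_tail eps sx; have xi1 := sqint_integ sx.
rewrite mulrC; apply: (@le_trans _ _ (eps + eps^-1 * Ex (fun x =>
    stop k x * (xi k x ^+ 2 * (eps <= `|xi k x|)%R%:R)))); last first.
  by rewrite lerD2l ler_wpM2l ?invr_ge0 ?(ltW eps0)// lB// => x; exact: stop_ge0.
rewrite -{1}(Ex_cst P eps) -ExZ ?mulst// -ExD; [|exact: integ_cst|]; last first.
  by apply: integZ; exact: mulst.
apply: Ex_le.
- by apply: integ_abs; exact: mulst.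
- by apply: integD; [exact: integ_cst|apply: integZ; exact: mulst].
move=> x; rewrite normrM (ger0_norm (stop_ge0 _ _)) /cst.
rewrite -(real_normK (num_real (xi k x))).
have n0 := normr_ge0 (xi k x); set y := `|xi k x| in n0 *.
have h : y <= eps + eps^-1 * (y ^+ 2 * (eps <= y)%R%:R).
  have [ey|ye] := leP eps y; last by rewrite mulr0 mulr0 addr0 ltW.
  rewrite mulr1 ler_wpDl ?(ltW eps0)// mulrC ler_pdivlMr// expr2.
  by rewrite ler_wpM2l.
rewrite stopE; case: (_ <= C); rewrite ?mul1r// !mul0r ?mulr0 addr0; exact: ltW.
Qed.

(** For the steps before time [r] the crude first order bound suffices, since
    there are at most [r] of them. *)
Lemma exp_mart_early k : (s <= k <= K)%N ->
  Ex (fun x => `|M k x - M k.-1 x|) <=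
    e * (eps + eps ^+ 2 + (1 + eps^-1) * El k).
Proof.
move=> kk; have kK := inK kk; have mst := measurable_stop kK.
have /andP[sk _] := kk.
have [mx sx _ [mv v0 vi] xv] := hx kk; have [_ _ li lB] := hl kk.
have xi1 := sqint_integ sx.
have i1 : integ (fun x => `|stop k x * xi k x|) by apply: integ_abs; exact: mulst.
have i2 := mulst kK vi.
have kK1 : (k.-1 <= K)%N by rewrite (leq_trans (leq_pred _)).
apply: (@le_trans _ _ (e * (Ex (fun x => `|stop k x * xi k x|) + Ev k))); last first.
  rewrite ler_wpM2l ?expR_ge0//.
  by have := Exi_le kk; have := Ev_le kk; rewrite /=; nra.
rewrite -ExD// -ExZ; last exact: integD.
have iM j : (s.-1 <= j <= K)%N -> integ (M j).
  move=> jj; have jK : (j <= K)%N by case/andP: jj.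
  apply: integ_bdd; first by apply: (mF jK); exact: measurable_exp_mart.
  by exists e => x; exact: exp_mart_le.
apply: Ex_le.
- apply: integ_abs; apply: integB; apply: iM; last exact: predK.
  by rewrite kK andbT (leq_trans (leq_pred _)).
- by apply: integZ; exact: integD.
move=> x; rewrite /M.
have h1 : V' k x = V' k.-1 x + stop k x * v k x by exact: stopped_sum_rec.
have h2 : S' k x = S' k.-1 x + stop k x * xi k x by exact: stopped_sum_rec.
have eV := expV_le x kK.
have eV1 := expV_le x kK1.
have a0 : 0 <= stop k x * v k x by rewrite mulr_ge0 ?stop_ge0.
have h3 := @expR_increment R (V' k.-1 x / 2) (V' k x / 2).
have h3' : `|expR (V' k x / 2) - expR (V' k.-1 x / 2)| <= e * (stop k x * v k x).
  apply: (le_trans (h3 _)); first by rewrite ler_pM2r// h1 lerDl.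
  have -> : V' k x / 2 - V' k.-1 x / 2 = (stop k x * v k x) / 2.
    by rewrite h1 mulrDl addrAC subrr add0r.
  have := expR_ge0 (V' k x / 2).
  by move: eV a0; set E := expR (V' k x / 2); set a := _ * v k x; nra.
have h4 : `|cos (S' k x + theta) - cos (S' k.-1 x + theta)| <= `|stop k x * xi k x|.
  by rewrite h2 addrAC; exact: cos_increment.
have -> : expR (V' k x / 2) * cos (S' k x + theta) -
    expR (V' k.-1 x / 2) * cos (S' k.-1 x + theta) =
  (expR (V' k x / 2) - expR (V' k.-1 x / 2)) * cos (S' k x + theta) +
  expR (V' k.-1 x / 2) * (cos (S' k x + theta) - cos (S' k.-1 x + theta)) by ring.
rewrite [leRHS]mulrDr [leRHS]addrC (le_trans (ler_normD _ _))// lerD//; last first.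
  rewrite normrM (ger0_norm (expR_ge0 _)) ler_pM ?expR_ge0//.
by rewrite normrM -[leRHS]mulr1 ler_pM// cos_max.
Qed.


(** For the steps after time [r] the event [A] is known at time [k.-1], so that
    the terms of first order vanish and those of second order cancel; what
    is left are the Taylor remainders. *)
Lemma exp_mart_late k A : (s <= k <= K)%N -> F k.-1 A ->
  `|Ex (fun x => \1_A x * (M k x - M k.-1 x))| <=
    e * ((eps + eps ^+ 2) * Ev k + (C + 2) * El k).
Proof.
move=> kk GA; have kK := inK kk; have mst := measurable_stop kK.
have /andP[sk _] := kk; have [sG sm] := fieldP1 kK.
have [mx sx x0 [mv v0 vi] xv] := hx kk; have [ml l0 li lB] := hl kk.
have xi1 := sqint_integ sx; have [_ xi2] := sx.
have ti := integ_tail eps sx.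
have kK1 : (k.-1 <= K)%N by rewrite (leq_trans (leq_pred _)).
pose B0 x := \1_A x * expR (V' k x / 2).
pose phi x := S' k.-1 x + theta.
pose w x := stop k x * v k x.
have mS : measurable_wrt (F k.-1) (S' k.-1) by exact: measurable_S'.
have mphi : measurable_wrt (F k.-1) phi.
  by apply: measurable_wrtD => //; exact: measurable_wrt_cst.
have mc : measurable_wrt (F k.-1) (fun x => cos (phi x)).
  apply: (measurable_wrt_comp sG (k := cos)) => //.
  by apply: continuous_measurable_fun; exact: continuous_cos.
have msn : measurable_wrt (F k.-1) (fun x => sin (phi x)).
  apply: (measurable_wrt_comp sG (k := sin)) => //.
  by apply: continuous_measurable_fun; exact: continuous_sin.
have mw : measurable_wrt (F k.-1) w by exact: measurable_wrtM.
have mB0 : measurable_wrt (F k.-1) B0.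
  apply: measurable_wrtM => //; first exact: measurable_wrt_indic.
  apply: (measurable_wrt_comp sG (k := expR)); first exact: measurable_expR.
  apply: measurable_wrtM => //; last exact: measurable_wrt_cst.
  exact: measurable_V'.
have B00 x : 0 <= B0 x by rewrite mulr_ge0 ?expR_ge0// indicE.
have B0e x : B0 x <= e.
  rewrite -[leRHS]mul1r ler_pM ?expR_ge0//; last exact: expV_le.
have bB0 : bdd B0 by exists e => x; rewrite ger0_norm.
have bc : bdd (fun x => cos (phi x)) by exists 1 => x; exact: cos_max.
have bs : bdd (fun x => sin (phi x)) by exists 1 => x; exact: sin_max.
have w0 x : 0 <= w x by rewrite mulr_ge0 ?stop_ge0.
have wC x : w x <= C by exact: stopped_incr_le.
have bw : bdd w by exists C => x; rewrite ger0_norm.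
have m1 : measurable_wrt (F k.-1) (fun x => B0 x * sin (phi x) * stop k x).
  by apply: measurable_wrtM => //; exact: measurable_wrtM.
have m2 : measurable_wrt (F k.-1) (fun x => B0 x * cos (phi x) * stop k x).
  by apply: measurable_wrtM => //; exact: measurable_wrtM.
have b1 : bdd (fun x => B0 x * sin (phi x) * stop k x) by apply: bddM => //; exact: bddM.
have b2 : bdd (fun x => B0 x * cos (phi x) * stop k x) by apply: bddM => //; exact: bddM.
have mul f h : measurable_wrt (F k.-1) h -> bdd h -> integ f ->
    integ (fun x => h x * f x).
  by move=> mh bh; apply: integM_bdd => //; exact: (mF1 kK).
pose G1 x := \1_A x * (M k x - M k.-1 x).
pose G2 x := B0 x * sin (phi x) * stop k x * xi k x.
pose G3 x := B0 x * cos (phi x) * stop k x * xi k x ^+ 2.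
pose G4 x := B0 x * cos (phi x) * stop k x * v k x.
have iM j : (s.-1 <= j <= K)%N -> integ (M j).
  move=> jj; have jK : (j <= K)%N by case/andP: jj.
  apply: integ_bdd; first by apply: (mF jK); exact: measurable_exp_mart.
  by exists e => x; exact: exp_mart_le.
have iG1 : integ G1.
  apply: integM_indic; first exact: sm.
  apply: integB; apply: iM; last exact: predK.
  by rewrite kK andbT (leq_trans (leq_pred _)).
have iG2 : integ G2 by exact: mul.
have iG3 : integ G3 by exact: mul.
have iG4 : integ G4 by exact: mul.
have E2 : Ex G2 = 0 by apply: x0.
have E3 : Ex G3 = Ex G4 by apply: xv.
(* [G2] has expectation 0 and [G3], [G4] have the same one: adding them
   completes the increment into Taylor remainders. *)
pose G5 x := (G1 x + G2 x) + 2^-1 * (G3 x - G4 x).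
have i34 : integ (fun x => 2^-1 * (G3 x - G4 x)) by apply: integZ; exact: integB.
have iG5 : integ G5 by apply: integD => //; exact: integD.
have -> : Ex G1 = Ex G5.
  rewrite /G5 ExD//; last exact: integD.
  by rewrite ExD// ExZ ?integB// ExB// E2 E3 subrr mulr0 !addr0.
pose Bd x := e * (eps * (stop k x * xi k x ^+ 2) +
  2 * (stop k x * (xi k x ^+ 2 * (eps <= `|xi k x|)%R%:R)) + w x * v k x).
have iy := mul _ _ mst (bstop k) xi2.
have iyt := mul _ _ mst (bstop k) ti.
have iwv := mul _ _ mw bw vi.
have iBd0 : integ (fun x => eps * (stop k x * xi k x ^+ 2) +
  2 * (stop k x * (xi k x ^+ 2 * (eps <= `|xi k x|)%R%:R))).
  by apply: integD; exact: integZ.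
have iBd : integ Bd by apply: integZ; exact: integD.
apply: (@le_trans _ _ (Ex Bd)); last first.
  rewrite /Bd ExZ; last exact: integD.
  rewrite ler_wpM2l ?expR_ge0// ExD// ExD ?integZ// !ExZ//.
  rewrite xv//.
  have h1 := lB _ mst (bstop k) (stop_ge0 k).
  have h2 := Ex_tail_le kk mw bw w0.
  have h3 : Ex (fun x => w x * l k x) <= C * El k.
    rewrite -ExZ; last exact: mul.
    apply: Ex_le; [exact: mul|by apply: integZ; exact: mul|] => x.
    have st0 := stop_ge0 k x; have lx := l0 x.
    have := wC x; rewrite /w; have := stop_idem k x.
    move=> h4 h5; have : stop k x * v k x * l k x <= C * l k x by rewrite ler_wpM2r.
    rewrite stopE in h4 *; case: (_ <= _) h4 => //= _; rewrite ?mul1r ?mul0r ?mulr0//.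
  move: h1 h2 h3; rewrite /= -/(w) => h1 h2 h3.
  have -> : Ex w = Ev k by [].
  by move: h1 h2 h3; set a := Ex _; lra.
apply: Ex_abs_le => // x; rewrite /G5 /G1 /G2 /G3 /G4 /Bd.
have hV : V' k x = V' k.-1 x + w x by exact: stopped_sum_rec.
have hS : S' k x = S' k.-1 x + stop k x * xi k x by exact: stopped_sum_rec.
set y := stop k x * xi k x in hS.
have y2 : stop k x * xi k x ^+ 2 = y ^+ 2 by rewrite /y exprMn [stop k x ^+ 2]expr2 stop_idem.
have yt : y ^+ 2 * (eps <= `|y|)%R%:R <=
    stop k x * (xi k x ^+ 2 * (eps <= `|xi k x|)%R%:R).
  rewrite /y stopE; case: (_ <= C); rewrite ?mul1r// !mul0r.
  by rewrite expr0n/= mul0r.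
have M1 : M k.-1 x = expR (V' k x / 2) * expR (- (w x / 2)) * cos (phi x).
  by rewrite /M -expRD hV mulrDl addrK.
have Mk : M k x = expR (V' k x / 2) * cos (phi x + y) by rewrite /M hS addrAC.
have hR := cos_taylor2_lindeberg (phi x) y eps0.
have hE := @expRN_taylor1 R (w x / 2) (divr_ge0 (w0 x) (ler0n _ 2)).
have w2 : w x ^+ 2 = w x * v k x.
  by rewrite expr2 {2}/w mulrA [_ * stop _ _]mulrC /w mulrA stop_idem.
set c := cos (phi x) in hR M1 *; set sn := sin (phi x) in hR *.
have -> : \1_A x * (M k x - M k.-1 x) + B0 x * sn * stop k x * xi k x +
   2^-1 * (B0 x * c * stop k x * xi k x ^+ 2 - B0 x * c * stop k x * v k x) =
   B0 x * ((cos (phi x + y) - (c - y * sn - y ^+ 2 / 2 * c)) +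
           c * (1 - w x / 2 - expR (- (w x / 2)))).
  by rewrite -y2 Mk M1 /B0 /y /w; field.
rewrite normrM ger0_norm// ler_pM// (le_trans (ler_normD _ _))// lerD//.
  by apply: (le_trans hR); rewrite y2 lerD2l ler_wpM2l.
rewrite normrM -[leRHS]mul1r ler_pM//; first exact: cos_max.
apply: (le_trans hE); rewrite -w2; have := sqr_ge0 (w x); nra.
Qed.

Lemma exp_mart_step k r A : (s <= k <= K)%N -> F r A -> (r <= K)%N ->
  `|Ex (fun x => \1_A x * (M k x - M k.-1 x))| <=
    e * ((eps + eps ^+ 2) * ((k <= r)%N%:R + Ev k) + (C + 3 + eps^-1) * El k).
Proof.
move=> kk GA rK; have kK := inK kk.
have [_ _ _ [_ v0 _] _] := hx kk; have [_ l0 _ _] := hl kk.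
have Ev0 : 0 <= Ev k by apply: Ex_ge0 => x; rewrite mulr_ge0 ?stop_ge0.
have El0 : 0 <= El k by apply: Ex_ge0 => x; rewrite mulr_ge0 ?stop_ge0.
have ei : 0 < eps^-1 by rewrite invr_gt0.
have iM j : (s.-1 <= j <= K)%N -> integ (M j).
  move=> jj; have jK : (j <= K)%N by case/andP: jj.
  apply: integ_bdd; first by apply: (mF jK); exact: measurable_exp_mart.
  by exists e => x; exact: exp_mart_le.
have iG : integ (fun x => M k x - M k.-1 x).
  apply: integB; apply: iM; last exact: predK.
  by case/andP: kk => sk ?; rewrite kK andbT (leq_trans (leq_pred _)).
have [kr|rk] := leqP k r.
  apply: (le_trans (Ex_abs_le _ (integ_abs iG) _)).
  - by apply: integM_indic => //; exact: (fieldP rK).2.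
  - by move=> x; rewrite normrM ler_piMl// indicE ger0_norm ?boolr_le1.
  apply: (le_trans (exp_mart_early kk)); rewrite ler_wpM2l ?expR_ge0//= mulr1n.
  have e2 := sqr_ge0 eps.
  have h1 : 0 <= (eps + eps ^+ 2) * Ev k by rewrite mulr_ge0// addr_ge0// ltW.
  have h2 : 0 <= (C + 2) * El k by rewrite mulr_ge0// addr_ge0.
  by move: h1 h2; rewrite /=; set a := Ex _; set b := Ex _; nra.
apply: (le_trans (exp_mart_late kk _)).
  apply: (row_field_sub hF) GA.
  by rewrite (leq_trans (leq_pred _) kK) andbT; case: (k) rk.
rewrite ler_wpM2l ?expR_ge0//= add0r lerD2l ler_wpM2r//.
by move: ei; lra.
Qed.

Definition stopped_lindeberg x : R := stopped_sum l K x.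

(** The sum of the one-step errors. It does not involve the number of steps of
    the row: early steps are counted by [r], and the variances of the late
    ones add up to at most [C]. *)
Lemma exp_mart_row r A : F r A -> (r <= K)%N ->
  `|Ex (fun x => \1_A x * (M K x - cos theta))| <=
    e * ((eps + eps ^+ 2) * (r%:R + C) + (C + 3 + eps^-1) * Ex stopped_lindeberg).
Proof.
move=> GA rK; have /andP[s1 sK] := hs.
have mA : measurable A by exact: (fieldP rK).2.
have iM j : (s.-1 <= j <= K)%N -> integ (M j).
  move=> jj; have jK : (j <= K)%N by case/andP: jj.
  apply: integ_bdd; first by apply: (mF jK); exact: measurable_exp_mart.
  by exists e => x; exact: exp_mart_le.
have Ms : M s.-1 = cst (cos theta).
  by apply/funext => x; rewrite /M !stopped_sum_small ?prednK//= mul0r expR0 mul1r add0r.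
pose b k := e * ((eps + eps ^+ 2) * ((k <= r)%N%:R + Ev k) + (C + 3 + eps^-1) * El k).
have step n : (s.-1 + n <= K)%N ->
    `|Ex (fun x => \1_A x * (M (s.-1 + n)%N x - cos theta))| <=
    \sum_(s <= k < (s.-1 + n).+1) b k.
  elim: n => [|n IH] nK.
    rewrite addn0 Ms prednK// big_geq//.
    rewrite (_ : (fun x => _) = cst 0) ?Ex_cst ?normr0//.
    by apply/funext => x; rewrite subrr mulr0.
  have nK' : (s.-1 + n <= K)%N by rewrite (leq_trans _ nK)// leq_add2l.
  have kk : (s <= s.-1 + n.+1 <= K)%N by rewrite nK andbT addnS -addSn prednK// leq_addr.
  rewrite addnS big_nat_recr/=; last by rewrite -addSn prednK// leq_addr.
  have -> : (fun x => \1_A x * (M (s.-1 + n).+1 x - cos theta)) =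
    (fun x => \1_A x * (M (s.-1 + n)%N x - cos theta) +
              \1_A x * (M (s.-1 + n).+1 x - M (s.-1 + n)%N x)).
    by apply/funext => x; ring.
  have i0 : integ (M (s.-1 + n)%N) by apply: iM; rewrite leq_addr.
  have i1 : integ (M (s.-1 + n).+1) by apply: iM; rewrite -addnS leq_addr.
  rewrite ExD; last 2 first.
  - by apply: integM_indic => //; apply: integB => //; exact: integ_cst.
  - by apply: integM_indic => //; exact: integB.
  rewrite (le_trans (ler_normD _ _))// lerD ?IH//.
  by rewrite -addnS in kk *; have := exp_mart_step kk GA rK; rewrite addnS.
have := step (K - s.-1)%N; rewrite subnKC ?(leq_trans (leq_pred s))//.
move/(_ (leqnn K))/le_trans; apply.
rewrite /b -mulr_sumr ler_wpM2l ?expR_ge0// big_split/= -!mulr_sumr.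
have iv k : (s <= k <= K)%N -> integ (fun x => stop k x * v k x).
  by move=> kk; apply: mulst; [exact: inK|have [_ _ _ [_ _ +] _] := hx kk].
have il k : (s <= k <= K)%N -> integ (fun x => stop k x * l k x).
  by move=> kk; apply: mulst; [exact: inK|have [_ _ + _] := hl kk].
have Esum f : (forall k, (s <= k <= K)%N -> integ (fun x => stop k x * f k x)) ->
    \sum_(s <= k < K.+1) Ex (fun x => stop k x * f k x) = Ex (stopped_sum f K).
  move=> fi; rewrite /stopped_sum big_nat -Ex_sum; last first.
    by move=> k /andP[sk kK]; apply: fi; rewrite sk.
  by congr (Rintegral _ _ _); apply/funext => x; rewrite [RHS]big_nat.
have C3 : 0 <= C + 3 + eps^-1 by rewrite !addr_ge0// invr_ge0 ltW.
apply: lerD; last by rewrite Esum.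
rewrite ler_wpM2l ?addr_ge0 ?sqr_ge0 ?(ltW eps0)// big_split/= lerD//.
  rewrite -natr_sum ler_nat.
  by have := count_upto K.+1 r s1; rewrite leq_min => /andP[].
rewrite Esum// -[leRHS](Ex_cst P C); apply: Ex_le => [||x].
- have := fun i => @integ_sum _ _ _ P _ (index_iota s K.+1) (fun k => (s <= k < K.+1)%N) (fun j x => stop j x * v j x) i.
  rewrite /stopped_sum; under eq_fun do rewrite -big_nat.
  by apply => k /andP[sk kK]; apply: iv; rewrite sk.
- exact: integ_cst.
- exact: stopped_var_leC.
Qed.

(** Orthogonality of the increments. *)
Lemma Ex_stopped_sum_sqr k : (s.-1 <= k <= K)%N ->
  sqint (S' k) /\ Ex (fun x => S' k x ^+ 2) = Ex (V' k).
Proof.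
have small j : (j < s)%N -> sqint (S' j) /\ Ex (fun x => S' j x ^+ 2) = Ex (V' j).
  move=> js; rewrite !stopped_sum_small//; split; first exact: sqint_cst.
  by rewrite (Ex_cst P (0 ^+ 2)) (Ex_cst P 0) expr0n.
elim: k => [|k IH] kk; first by apply: small; case/andP: hs.
have [ks|sk] := ltnP k.+1 s; first exact: small.
have /andP[_ kK] := kk; have kk1 : (s <= k.+1 <= K)%N by rewrite sk.
have mst := measurable_stop kK.
have [mx sx x0 [mv v0 vi] xv] := hx kk1.
have kk' : (s.-1 <= k <= K)%N.
  by rewrite (ltnW kK) andbT; case: (s) sk.
have [sS ES] := IH kk'.
have sy : sqint (fun x => stop k.+1 x * xi k.+1 x).
  by apply: sqintM_bdd => //; exact: mF1 mst.
have mS : measurable_wrt (F k) (S' k) by apply: measurable_S'; exact: ltnW.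
have sG := (fieldP (ltnW kK)).1.
have iz : integ (fun x => S' k x * stop k.+1 x * xi k.+1 x).
  by under eq_fun do rewrite -mulrA; exact: sqintM.
have z0 : Ex (fun x => S' k x * stop k.+1 x * xi k.+1 x) = 0.
  by apply: x0 => //; exact: measurable_wrtM.
have SE : S' k.+1 = fun x => S' k x + stop k.+1 x * xi k.+1 x.
  by apply/funext => x; rewrite stopped_sum_rec.
have VE : V' k.+1 = fun x => V' k x + stop k.+1 x * v k.+1 x.
  by apply/funext => x; rewrite stopped_sum_rec.
have iV : integ (V' k).
  apply: integ_bdd; last first.
    by exists C => x; rewrite ger0_norm ?stopped_var_leC ?stopped_var_ge0// ltnW.
  have [ks|sk'] := ltnP k s.
    by rewrite stopped_sum_small.
  by apply: (mF1 (ltnW kK)); apply: measurable_V'; rewrite sk' ltnW.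
rewrite SE VE; split; first exact: sqintD.
rewrite ExD ?mulst// -ES -xv//.
have -> : (fun x => (S' k x + stop k.+1 x * xi k.+1 x) ^+ 2) =
  (fun x => (S' k x ^+ 2 + 2 * (S' k x * stop k.+1 x * xi k.+1 x)) +
            stop k.+1 x * xi k.+1 x ^+ 2).
  apply/funext => x.
  transitivity (S' k x ^+ 2 + 2 * (S' k x * stop k.+1 x * xi k.+1 x) +
    (stop k.+1 x * stop k.+1 x) * xi k.+1 x ^+ 2); first by ring.
  by rewrite stop_idem.
have [_ iS2] := sS.
rewrite ExD; last 2 first.
- by apply: integD => //; exact: integZ.
- by apply: mulst => //; case: sx.
by rewrite ExD// ?ExZ// ?z0 ?mulr0 ?addr0//; exact: integZ.
Qed.

Lemma Ex_stopped_sum_sqr_le : Ex (fun x => S' K x ^+ 2) <= C.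
Proof.
have /andP[s1 sK] := hs.
have KK : (s.-1 <= K <= K)%N by rewrite leqnn (leq_trans (leq_pred s)).
have [_ ->] := Ex_stopped_sum_sqr KK.
rewrite -[leRHS](Ex_cst P C); apply: Ex_le => [||x].
- apply: integ_bdd; last first.
    by exists C => x; rewrite ger0_norm ?stopped_var_leC ?stopped_var_ge0.
  by apply: (mF1 (leqnn K)); apply: measurable_V'; rewrite sK leqnn.
- exact: integ_cst.
- exact: stopped_var_leC.
Qed.

Lemma stopped_sum_unstopped f x : var_upto K x <= C ->
  stopped_sum f K x = \sum_(s <= j < K.+1) f j x.
Proof.
move=> VC; rewrite /stopped_sum !big_nat; apply: eq_bigr => j /andP[sj jK].
rewrite stopE (le_trans _ VC) ?mul1r//.
rewrite /var_upto [leRHS](big_cat_nat (n := j.+1))//=; last exact: leqW.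
rewrite lerDl big_nat sumr_ge0// => i /andP[ji iK].
by apply: v_ge0; rewrite (leq_trans sj (ltnW ji)).
Qed.

End row_estimate.

(** * Convergence in probability and weak convergence of bounded sequences *)

Section in_probability.
Context {disp : measure_display} {T : measurableType disp} {R : realType}.
Variable P : probability T R.
Local Notation Ex := (Rintegral P setT).
Local Notation integ := (integ P).
Implicit Types Z W : nat -> T -> R.

(** Rows are numbered from 1, so both clauses concern late rows only. *)
Definition cvgp0 Z := (\forall n \near \oo, measurable_fun setT (Z n)) /\
  forall eps : R, 0 < eps -> forall delta : R, 0 < delta -> \forall n \near \oo,
    (P [set w | (eps <= `|Z n w|)%R] <= delta%:E)%E.

Lemma measurable_abs_ge (eps : R) (f : T -> R) : measurable_fun setT f ->
  measurable [set w | eps <= `|f w|].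
Proof.
move=> mf; rewrite -[X in measurable X]setTI.
by apply: measurable_fun_le => //; exact: measurableT_comp.
Qed.

Lemma prob_le_ae (A B : set T) : measurable A -> measurable B ->
  {ae P, forall x, A x -> B x} -> (P A <= P B)%E.
Proof.
move=> mA mB [N [mN PN sub]]; rewrite -[leRHS]adde0 -[in leRHS]PN.
apply: le_trans (measureU2 _ mB mN) => //.
apply: le_measure; rewrite ?inE//; first exact: measurableU.
move=> x Ax; have [Bx|nBx] := pselect (B x); [by left|right].
by apply: sub => /= /(_ Ax).
Qed.

Lemma cvgp0_le_ae Z W : (\forall n \near \oo, measurable_fun setT (Z n)) ->
  (\forall n \near \oo, {ae P, forall w, `|Z n w| <= `|W n w|}) ->
  cvgp0 W -> cvgp0 Z.
Proof.
move=> mZ ZW [mW hW]; split=> // eps e0 delta d0; near=> n.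
have mZn : measurable_fun setT (Z n) by near: n.
have mWn : measurable_fun setT (W n) by near: n.
apply: (@le_trans _ _ (P [set w | (eps <= `|W n w|)%R])); last by near: n; exact: hW.
apply: prob_le_ae; try exact: measurable_abs_ge.
have : {ae P, forall w, `|Z n w| <= `|W n w|} by near: n.
by apply: filterS => w h /le_trans; exact.
Unshelve. all: by end_near. Qed.

Lemma cvgp0_le Z W : (\forall n \near \oo, measurable_fun setT (Z n)) ->
  (\forall n \near \oo, forall w, `|Z n w| <= `|W n w|) -> cvgp0 W -> cvgp0 Z.
Proof.
move=> mZ ZW; apply: cvgp0_le_ae => //.
by apply: filterS ZW => n h; exact: aeW.
Qed.

Lemma cvgp0D Z W : cvgp0 Z -> cvgp0 W -> cvgp0 (fun n w => Z n w + W n w).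
Proof.
move=> [mZ hZ] [mW hW]; split=> [|eps e0 delta d0].
  by apply: filterS2 mZ mW => n; exact: measurable_funD.
have e2 : 0 < eps / 2 by rewrite divr_gt0.
have d2 : 0 < delta / 2 by rewrite divr_gt0.
near=> n.
have mZn : measurable_fun setT (Z n) by near: n.
have mWn : measurable_fun setT (W n) by near: n.
have PZ : (P [set w | (eps / 2 <= `|Z n w|)%R] <= (delta / 2)%:E)%E by near: n; exact: hZ.
have PW : (P [set w | (eps / 2 <= `|W n w|)%R] <= (delta / 2)%:E)%E by near: n; exact: hW.
rewrite [delta]splitr EFinD; apply: le_trans (leeD PZ PW).
apply: le_trans (measureU2 _ _ _); try exact: measurable_abs_ge.
apply: le_measure; rewrite ?inE.
- by apply: measurable_abs_ge; exact: measurable_funD.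
- by apply: measurableU; exact: measurable_abs_ge.
move=> w /= h; have [hz|hz] := leP (eps / 2) `|Z n w|; [by left|right].
by have := ler_normD (Z n w) (W n w) => /=; lra.
Unshelve. all: by end_near. Qed.

Lemma cvgp0Z (c : R) Z : cvgp0 Z -> cvgp0 (fun n w => c * Z n w).
Proof.
move=> [mZ hZ]; split=> [|eps e0 delta d0].
  by apply: filterS mZ => n; exact: measurable_funM.
have [->|c0] := eqVneq c 0.
  apply: nearW => n; rewrite (_ : [set _ | _] = set0) ?measure0 ?lee_fin ?ltW//.
  by apply/seteqP; split=> // w /=; rewrite mul0r normr0 leNgt e0.
have := hZ (eps / `|c|); rewrite divr_gt0 ?normr_gt0// => /(_ isT _ d0).
apply: filterS => n; congr (P _ <= _)%E; apply/seteqP; split=> w /=;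
by rewrite normrM ler_pdivrMr ?normr_gt0// mulrC.
Qed.

Lemma cvgp0_cst0 : cvgp0 (fun _ => cst 0).
Proof.
split=> [|eps e0 delta d0]; apply: nearW => n //.
rewrite (_ : [set _ | _] = set0) ?measure0 ?lee_fin ?ltW//.
by apply/seteqP; split=> // w /=; rewrite normr0 leNgt e0.
Qed.

Lemma cvgp0_sum (I : Type) (r : seq I) (p : pred I) (Z : I -> nat -> T -> R) :
  (forall i, p i -> cvgp0 (Z i)) -> cvgp0 (fun n w => \sum_(i <- r | p i) Z i n w).
Proof.
move=> h; elim: r => [|i r IH].
  rewrite (_ : (fun n w => _) = fun _ => cst 0); first exact: cvgp0_cst0.
  by apply/funext => n; apply/funext => w; rewrite big_nil.
rewrite (_ : (fun n w => _) = fun n w => (if p i then Z i n w else 0) +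
    \sum_(i <- r | p i) Z i n w); last first.
  apply/funext => n; apply/funext => w; rewrite big_cons.
  by case: (p i) => //; rewrite add0r.
case: (boolP (p i)) => pi; first by apply: cvgp0D => //; exact: h.
by apply: cvgp0D => //; exact: cvgp0_cst0.
Qed.

Lemma near0P (a : nat -> R) : (forall delta, 0 < delta ->
  \forall n \near \oo, `|a n| <= delta) <-> a n @[n --> \oo] --> (0 : R).
Proof.
split=> [h|/cvgrPdist_le h delta d0].
  apply/cvgrPdist_le => delta d0; apply: filterS (h _ d0) => n.
  by rewrite sub0r normrN.
by apply: filterS (h _ d0) => n; rewrite sub0r normrN.
Qed.

Lemma Ex_cvgp0 Z (B : R) : (\forall n \near \oo, forall w, `|Z n w| <= B) ->
  cvgp0 Z -> Ex (fun w => `|Z n w|) @[n --> \oo] --> (0 : R).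
Proof.
move=> ZB [mZ hZ]; apply/near0P => delta d0.
have d2 : 0 < delta / 2 by rewrite divr_gt0.
have B1 : 0 < `|B| + 1 by rewrite ltr_pwDr.
have d3 : 0 < delta / 2 / (`|B| + 1) by rewrite divr_gt0.
near=> n.
have mZn : measurable_fun setT (Z n) by near: n.
have ZBn : forall w, `|Z n w| <= B by near: n.
have PZ : (P [set w | (delta / 2 <= `|Z n w|)%R] <= (delta / 2 / (`|B| + 1))%:E)%E.
  by near: n; exact: hZ.
have mA := measurable_abs_ge (delta / 2) mZn.
rewrite ger0_norm; last exact: Ex_ge0.
have iZ : integ (fun w => `|Z n w|).
  by apply: integ_abs; apply: integ_bdd => //; exists B.
have iA : integ (fun w => (`|B| + 1) * \1_[set w | delta / 2 <= `|Z n w|] w).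
  by apply: integZ; exact: integ_indic.
apply: (@le_trans _ _ (Ex (fun w => cst (delta / 2) w +
    (`|B| + 1) * \1_[set w | delta / 2 <= `|Z n w|] w))).
  apply: Ex_le => // [|w]; first by apply: integD => //; exact: integ_cst.
  rewrite /= indicE; have [h|h] := leP (delta / 2) `|Z n w|.
    rewrite mem_set//= mulr1 (le_trans (ZBn w))//.
    by have := ler_norm B; lra.
  have -> : (w \in [set w | delta / 2 <= `|Z n w|]) = false.
    by apply/memNset => /=; rewrite leNgt h.
  by rewrite mulr0 addr0 ltW.
rewrite ExD//; last exact: integ_cst.
rewrite Ex_cst ExZ ?Ex_indic//; last exact: integ_indic.
rewrite [leRHS]splitr lerD2l mulrC -ler_pdivlMr//.
by rewrite -lee_fin fineK// fin_num_measure.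
Unshelve. all: by end_near. Qed.

End in_probability.

Section weak_L1.
Context {disp : measure_display} {T : measurableType disp} {R : realType}.
Variable P : probability T R.
Local Notation Ex := (Rintegral P setT).
Local Notation integ := (integ P).

Variables (W : nat -> T -> R) (b : R).
Hypothesis mW : forall n, (0 < n)%N -> measurable_fun setT (W n).
Hypothesis Wb : forall n x, (0 < n)%N -> `|W n x| <= b.

Let iW n (f : T -> R) : (0 < n)%N -> integ f -> integ (fun x => f x * W n x).
Proof.
move=> n0 fi; under eq_fun do rewrite mulrC.
by apply: integM_bdd => //; [exact: mW|exists b => x; exact: Wb].
Qed.

Let b0 : 0 <= b.
Proof. by apply: le_trans (Wb point (ltn0Sn 0)). Qed.

Let approx (f : T -> R) : integ f ->
  (forall delta : R, 0 < delta -> exists g, [/\ integ g,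
     Ex (fun x => `|f x - g x|) <= delta &
     Ex (fun x => g x * W n x) @[n --> \oo] --> (0 : R)]) ->
  Ex (fun x => f x * W n x) @[n --> \oo] --> (0 : R).
Proof.
move=> fi h; apply/near0P => delta d0.
have d2 : 0 < delta / 2 by rewrite divr_gt0.
have b1 : 0 < b + 1 by rewrite ltr_pwDr.
have [g [gi fg /near0P/(_ _ d2) gW]] := h (delta / 2 / (b + 1)) (divr_gt0 d2 b1).
near=> n.
have n0 : (0 < n)%N by near: n; exact: nbhs_infty_gt.
have gWn : `|Ex (fun x => g x * W n x)| <= delta / 2 by near: n.
have ifg : integ (fun x => f x - g x) by exact: integB.
have -> : (fun x => f x * W n x) = fun x => g x * W n x + (f x - g x) * W n x.
  by apply/funext => x; ring.
rewrite ExD; [|exact: iW|exact: iW].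
rewrite (le_trans (ler_normD _ _))// [leRHS]splitr lerD//.
apply: (@le_trans _ _ (Ex (fun x => (b + 1) * `|f x - g x|))).
  apply: Ex_abs_le; [exact: iW|by apply: integZ; exact: integ_abs|] => x.
  rewrite normrM mulrC ler_wpM2r// (le_trans (Wb _ n0))//.
  by rewrite lerDl.
by rewrite ExZ ?integ_abs// mulrC -ler_pdivlMr.
Unshelve. all: by end_near. Qed.

Let test (A : set T) := measurable A /\
  Ex (fun x => \1_A x * W n x) @[n --> \oo] --> (0 : R).

(** The events that pass the test form a lambda-system: an increasing union is
    approximated in mean, with an error that is uniform in [n] because the
    sequence is bounded. *)
Lemma weak_cvg_generated (G : set (set T)) : setI_closed G ->
  G `<=` measurable -> G setT ->
  (forall A, G A -> Ex (fun x => \1_A x * W n x) @[n --> \oo] --> (0 : R)) ->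
  forall A, <<s G >> A -> Ex (fun x => \1_A x * W n x) @[n --> \oo] --> (0 : R).
Proof.
move=> IG Gm GT hG A GA; suff : test A by case.
apply: (@lambda_system_subset _ G IG setT test) GA => //; last first.
  by move=> B GB; split; [exact: Gm|exact: hG].
split=> //.
- by split=> //; exact: hG.
- move=> B D DB [mB cB] [mD cD]; split; first exact: measurableD.
  have : Ex (fun x => \1_B x * W n x) - Ex (fun x => \1_D x * W n x)
     @[n --> \oo] --> (0 : R).
    by rewrite -[X in _ --> X]subr0; exact: cvgB.
  apply: cvg_trans; apply: near_eq_cvg; near=> n.
  have n0 : (0 < n)%N by near: n; exact: nbhs_infty_gt.
  rewrite -ExB; [|by apply: iW => //; exact: integ_indic..].
  congr (Rintegral _ _ _); apply/funext => x; rewrite -mulrBl; congr (_ * _).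
  rewrite !indicE in_setD; have : x \in D -> x \in B.
    by rewrite !inE; exact: DB.
  by case: (x \in D) => [->//|_]; rewrite ?subrr//= andbT subr0.
- move=> E ndE tE; have mE i : measurable (E i) by case: (tE i).
  have mU : measurable (\bigcup_i E i) by exact: bigcupT_measurable.
  split=> //; apply: approx => [|delta d0]; first exact: integ_indic.
  have [||||_ cE] := @Ex_dom _ _ _ P (fun n x => `|\1_(\bigcup_i E i) x - \1_(E n) x|)
     (cst 0) (cst 1).
  - move=> n; apply: measurableT_comp => //.
    by apply: measurable_funB; exact: measurable_indic.
  - exact: integ_cst.
  - move=> x; apply: cvg_near_cst.
    have [[j _ Ejx]|nE] := pselect ((\bigcup_i E i) x).
      near=> n; rewrite !indicE !mem_set ?subrr ?normr0//; last by exists j.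
      have jn : (j <= n)%N by near: n; exact: nbhs_infty_ge.
      by have /subsetPset := ndE _ _ jn; exact.
    apply: nearW => n; rewrite !indicE !memNset ?subrr ?normr0// => Enx.
    by apply: nE; exists n.
  - move=> n x; rewrite normr_id !indicE /cst.
    case: (x \in _); case: (x \in _); rewrite ?subrr ?subr0 ?sub0r ?normrN ?normr0 ?normr1//.
  rewrite Ex_cst in cE; move/near0P: cE => /(_ _ d0)[n _ /(_ n (leqnn n)) h].
  exists (\1_(E n)); split; first exact: integ_indic.
    by apply: le_trans h; exact: ler_norm.
  by case: (tE n).
Unshelve. all: by end_near. Qed.

(** Simple functions are dense in mean among the bounded multipliers. *)
Lemma weak_cvg_bounded (G : set (set T)) : sub_sigma_field G ->
  (forall A, G A -> Ex (fun x => \1_A x * W n x) @[n --> \oo] --> (0 : R)) ->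
  forall zeta : T -> R, measurable_wrt G zeta -> bdd zeta ->
  Ex (fun x => zeta x * W n x) @[n --> \oo] --> (0 : R).
Proof.
move=> hG hA.
have pos zeta : measurable_wrt G zeta -> (forall x, 0 <= zeta x) -> bdd zeta ->
    Ex (fun x => zeta x * W n x) @[n --> \oo] --> (0 : R).
  move=> mz z0 bz; have mz' := measurable_wrt_fun hG.2 mz.
  have iz := integ_bdd P mz' bz.
  apply: approx => // delta d0.
  have [g [gr g0 gle gz]] := simple_approx hG mz z0.
  have mg m : measurable_fun setT (g m).
    have [r [A [GA gE]]] := gr m.
    rewrite (_ : g m = fun x => \sum_(y <- r) y * \1_(A y) x); last first.
      by apply/funext => x; exact: (gE x).2.
    apply: measurable_sum => y; apply: measurable_funM => //.
    by apply: measurable_indic; exact: hG.2.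
  have [||||_ cg] := @Ex_dom _ _ _ P (fun n x => `|zeta x - g n x|) (cst 0) zeta.
  - by move=> n; apply: measurableT_comp => //; exact: measurable_funB.
  - by [].
  - move=> x; rewrite /cst -(normr0 R) -(subrr (zeta x)).
    by apply: cvg_norm; apply: cvgB; [exact: cvg_cst|exact: gz].
  - move=> n x; rewrite normr_id ger0_norm ?subr_ge0 ?gle//.
    by rewrite lerBlDr lerDl g0.
  rewrite Ex_cst in cg; move/near0P: cg => /(_ _ d0)[m _ /(_ m (leqnn m)) h].
  exists (g m); split.
  - apply: integ_le iz => // x; rewrite !ger0_norm//.
  - by apply: le_trans h; exact: ler_norm.
  have [r [A [GA gE]]] := gr m.
  rewrite (_ : g m = fun x => \sum_(y <- r) y * \1_(A y) x); last first.
    by apply/funext => x; exact: (gE x).2.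
  have : \sum_(y <- r) y * Ex (fun x => \1_(A y) x * W n x) @[n --> \oo] -->
      \sum_(y <- r) (y * 0 : R).
    elim: (r) => [|y r' IH].
      by under eq_fun do rewrite big_nil; rewrite big_nil; exact: cvg_cst.
    under eq_fun do rewrite big_cons; rewrite big_cons.
    by apply: cvgD => //; apply: cvgM; [exact: cvg_cst|exact: hA].
  rewrite [X in _ --> X]big1; last by move=> y _; rewrite mulr0.
  apply: cvg_trans; apply: near_eq_cvg; near=> n.
  have n0 : (0 < n)%N by near: n; exact: nbhs_infty_gt.
  have iA y : integ (fun x => \1_(A y) x * W n x).
    by apply: iW => //; apply: integ_indic; exact: hG.2.
  under [in RHS]eq_fun do rewrite big_distrl/=.
  under [in RHS]eq_fun do under eq_bigr do rewrite -mulrA.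
  rewrite Ex_sum; last by move=> y _; exact: integZ.
  by apply: eq_bigr => y _; rewrite ExZ.
move=> zeta mz [B zB].
have sG := hG.1.
have mB : measurable_wrt G (cst `|B| : T -> R) by exact: measurable_wrt_cst.
have h1 : Ex (fun x => (zeta x + `|B|) * W n x) @[n --> \oo] --> (0 : R).
  apply: (pos (fun x => zeta x + `|B|)).
  - exact: measurable_wrtD.
  - move=> x; have := zB x; have := ler_norm B; rewrite ler_norml; lra.
  - by apply: bddD; [exists B|exact: bdd_cst].
have h2 : Ex (fun x => cst `|B| x * W n x) @[n --> \oo] --> (0 : R).
  by apply: pos => //; exact: bdd_cst.
have : Ex (fun x => (zeta x + `|B|) * W n x) - Ex (fun x => cst `|B| x * W n x)
     @[n --> \oo] --> (0 : R).
  by rewrite -[X in _ --> X]subr0; exact: cvgB.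
apply: cvg_trans; apply: near_eq_cvg; near=> n.
have n0 : (0 < n)%N by near: n; exact: nbhs_infty_gt.
have iz : integ zeta by apply: integ_bdd; [exact: measurable_wrt_fun hG.2 mz|exists B].
rewrite -ExB; [| |]; last 2 first.
- by apply: iW => //; apply: integD => //; exact: integ_cst.
- by apply: iW => //; exact: integ_cst.
by congr (Rintegral _ _ _); apply/funext => x /=; ring.
Unshelve. all: by end_near. Qed.

End weak_L1.

(** * Stable limit of scalar martingale rows *)

Section scalar_limit.
Context {disp : measure_display} {T : measurableType disp} {R : realType}.
Variable P : probability T R.
Variables (K s : nat -> nat) (F : nat -> nat -> set (set T)).
Variables (xi v : nat -> nat -> T -> R) (eta2 : T -> R).
Local Notation Ex := (Rintegral P setT).
Local Notation integ := (integ P).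

Hypothesis hK : forall m n, (1 <= m <= n)%N -> (K m <= K n)%N.
Hypothesis hF : forall n, (1 <= n)%N -> filtration (K n) (F n).
Hypothesis hs : forall n, (1 <= n)%N -> (1 <= s n <= K n)%N.

(** The rows [m] and [n] share the fields up to time [K m], because [K] is
    nondecreasing; hence the generating sets form a pi-system. *)
Lemma tail_field_mono m n : (1 <= m <= n)%N ->
  tail_field K F m `<=` tail_field K F n.
Proof.
move=> /andP[m1 mn] A hA j /= nj.
have n1 : (1 <= n)%N := leq_trans m1 mn.
have j1 : (1 <= j)%N := leq_trans n1 nj.
apply: ((hF j1).2 (K m)); last by apply: hA => /=; exact: leq_trans nj.
by rewrite !hK// ?m1 ?n1.
Qed.

Lemma tail_field_row m n : (1 <= m <= n)%N -> tail_field K F m `<=` F n (K m).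
Proof. by move=> /andP[m1 mn] A; apply. Qed.

Definition tail_union : set (set T) :=
  \bigcup_(n in [set n | (1 <= n)%N]) tail_field K F n.

Lemma tail_union_measurable : tail_union `<=` measurable.
Proof.
move=> A [n /= n1 hA]; have := hA n (leqnn n).
by apply: ((hF n1).1 (K n) (leqnn _)).2.
Qed.

Lemma tail_unionT : tail_union setT.
Proof.
exists 1%N => //= j /= j1; apply: measurable_wrt_setT.
by apply: ((hF j1).1 (K 1%N) _).1; apply: hK; rewrite j1.
Qed.

Lemma tail_unionI : setI_closed tail_union.
Proof.
move=> A B [m /= m1 hA] [n /= n1 hB].
have N1 : (1 <= maxn m n)%N by rewrite leq_max m1.
exists (maxn m n) => //= j /= Nj.
have j1 : (1 <= j)%N := leq_trans N1 Nj.
have sub k (C : set T) : (1 <= k <= maxn m n)%N -> tail_field K F k C ->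
    F j (K (maxn m n)) C.
  by move=> kN hC; apply: (tail_field_mono kN) hC _ Nj.
have [sG _] := (hF j1).1 (K (maxn m n)) (hK (introT andP (conj N1 Nj))).
have GA := sub m A (introT andP (conj m1 (leq_maxl _ _))) hA.
have GB := sub n B (introT andP (conj n1 (leq_maxr _ _))) hB.
have <- : <<s F j (K (maxn m n)) >> = F j (K (maxn m n)) by exact: sigma_algebra_id.
rewrite -(sigma_algebra_id sG) in GA GB.
exact: (@measurableI _ (g_sigma_algebraType (F j (K (maxn m n)))) _ _ GA GB).
Qed.

Lemma limit_field_sub : sub_sigma_field (limit_field K F).
Proof.
split; first exact: smallest_sigma_algebra.
apply: smallest_sub; last exact: tail_union_measurable.
exact: sigma_algebra_measurable.
Qed.

Hypothesis hx : forall n, (1 <= n)%N -> mart_row P (F n) (s n) (K n) (xi n) (v n).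
Hypothesis hL : forall eps : R, 0 < eps -> exists l : nat -> nat -> T -> R,
  (forall n, (1 <= n)%N -> lindeberg_row P (F n) (s n) (K n) (xi n) eps (l n)) /\
  cvgp0 P (fun n x => \sum_(s n <= k < (K n).+1) l n k x).
Hypothesis eta0 : forall x, 0 <= eta2 x.
Hypothesis meta : measurable_wrt (limit_field K F) eta2.
Hypothesis hV : cvgp0 P (fun n x => \sum_(s n <= k < (K n).+1) v n k x - eta2 x).

Local Notation Sn n := (fun x => \sum_(s n <= k < (K n).+1) xi n k x).
Local Notation Vn n := (fun x => \sum_(s n <= k < (K n).+1) v n k x).
Local Notation M C theta n := (exp_mart (s n) (xi n) (v n) C theta (K n)).

Let KK n : (1 <= n)%N -> ((s n).-1 <= K n <= K n)%N.
Proof. by move=> /hs/andP[_ sK]; rewrite leqnn (leq_trans (leq_pred _)). Qed.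

(** A set [A] in the tail field of index [m] belongs to the field at time [K m]
    of every later row, and [K m] does not depend on [n]. *)
Lemma exp_mart_tail (C theta : R) (m : nat) A : 0 <= C -> (1 <= m)%N ->
  tail_field K F m A ->
  Ex (fun x => \1_A x * (M C theta n x - cos theta)) @[n --> \oo] --> (0 : R).
Proof.
move=> C0 m1 hA; apply/near0P => delta d0.
set e := expR (C / 2); have e0 : 0 < e by exact: expR_gt0.
set r : R := (K m)%:R; have r0 : 0 <= r by [].
(* Chosen so that the part of the error that is not due to the Lindeberg
   term is at most half of [delta]. *)
pose eps := Num.min 1 (delta / (4 * (e * (r + C + 1)))).
have rC : 0 < r + C + 1 by rewrite ltr_pwDr// addr_ge0.
have eps0 : 0 < eps by rewrite lt_min ltr01 divr_gt0// mulr_gt0// mulr_gt0.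
have eps1 : eps <= 1 by rewrite ge_min lexx.
have epsd : eps * (e * (r + C + 1)) <= delta / 4.
  have : eps <= delta / (4 * (e * (r + C + 1))) by rewrite ge_min lexx orbT.
  rewrite invfM mulrA ler_pdivlMr// ?mulr_gt0//.
have [l [ll lc]] := hL eps0.
pose ml n k x := Num.min (l n k x) (v n k x).
have hml n : (1 <= n)%N -> lindeberg_row P (F n) (s n) (K n) (xi n) eps (ml n).
  move=> n1; exact: (lindeberg_row_min (hF n1) (hx n1) (ll n n1)).
have mlv n k x : ml n k x <= v n k x by rewrite ge_min lexx orbT.
pose W n := stopped_lindeberg (s n) (K n) (v n) (ml n) C.
have W0 n x : (1 <= n)%N -> 0 <= W n x.
  move=> n1; rewrite /W /stopped_lindeberg /stopped_sum big_nat sumr_ge0// => k kK.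
  by rewrite mulr_ge0 ?stop_ge0//; have [_ + _ _] := hml n n1 k kK; apply.
have WC n x : (1 <= n)%N -> W n x <= C.
  move=> n1; apply: (@le_trans _ _ (stopped_sum (s n) (v n) C (v n) (K n) x)).
    by rewrite /W /stopped_lindeberg /stopped_sum ler_sum// => k _; rewrite ler_wpM2l ?stop_ge0.
  exact: (stopped_var_leC (hs n1) (hx n1) C0).
have Wl n x : (1 <= n)%N -> W n x <= \sum_(s n <= k < (K n).+1) l n k x.
  move=> n1; rewrite /W /stopped_lindeberg /stopped_sum !big_nat ler_sum// => k kK.
  rewrite -[leRHS]mul1r ler_pM ?stop_ge0 ?stop_le1//.
    by have [_ + _ _] := hml n n1 k kK; apply.
  by rewrite ge_min lexx.
have mW n : (1 <= n)%N -> measurable_fun setT (W n).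
  move=> n1; rewrite /W /stopped_lindeberg /stopped_sum.
  under eq_fun do rewrite big_nat big_mkcond/=.
  apply: measurable_sum => k; case: (boolP (s n <= k < (K n).+1)%N) => // kK.
  have kK' : (k <= K n)%N by case/andP: kK.
  have sm := (row_field_pred (hF n1) kK').2.
  apply: measurable_funM; apply: (measurable_wrt_fun sm).
    exact: (measurable_stop (hF n1) (hx n1) kK').
  by have [+ _ _ _] := hml n n1 k kK.
have EW : Ex (fun x => `|W n x|) @[n --> \oo] --> (0 : R).
  apply: (@Ex_cvgp0 _ _ _ P W C).
    near=> n; move=> x; have n1 : (1 <= n)%N by near: n; exact: nbhs_infty_gt.
    by rewrite ger0_norm ?W0 ?WC.
  apply: (cvgp0_le _ _ lc).
    by near=> n; apply: mW; near: n; exact: nbhs_infty_gt.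
  near=> n; move=> x; have n1 : (1 <= n)%N by near: n; exact: nbhs_infty_gt.
  rewrite ger0_norm ?W0// (le_trans (Wl n x n1))//; exact: ler_norm.
pose c := C + 3 + eps^-1.
have c0 : 0 < c by rewrite ltr_pwDr ?invr_gt0// addr_ge0.
have d2 : 0 < delta / 2 / (e * c) by rewrite !divr_gt0// mulr_gt0.
move/near0P: EW => /(_ _ d2) EW.
near=> n.
have n1 : (1 <= n)%N by near: n; exact: nbhs_infty_gt.
have mn : (m <= n)%N by near: n; exact: nbhs_infty_ge.
have EWn : `|Ex (fun x => `|W n x|)| <= delta / 2 / (e * c) by near: n.
have FA : F n (K m) A by apply: (tail_field_row _ hA); rewrite m1.
have Kmn : (K m <= K n)%N by apply: hK; rewrite m1.
apply: (le_trans (exp_mart_row theta (hF n1) (hs n1) (hx n1) (hml n n1) eps0 C0 FA Kmn)).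
have EW' : Ex (W n) <= delta / 2 / (e * c).
  apply: le_trans EWn; rewrite ger0_norm; last exact: Ex_ge0.
  by rewrite (_ : (fun x => `|W n x|) = W n)//; apply/funext => x; rewrite ger0_norm ?W0.
rewrite mulrDr [leRHS]splitr; apply: lerD.
  apply: (@le_trans _ _ (2 * (eps * (e * (r + C + 1))))); last by move: epsd; lra.
  have h1 : eps + eps ^+ 2 <= 2 * eps by have := eps0; nra.
  have h2 : 0 <= e * (r + C) by rewrite mulr_ge0 ?addr_ge0// ltW.
  rewrite mulrCA; apply: (@le_trans _ _ (2 * eps * (e * (r + C)))).
    by rewrite ler_wpM2r.
  by have := mulr_gt0 eps0 e0; nra.
by rewrite mulrA mulrC -ler_pdivlMr ?mulr_gt0.
Unshelve. all: by end_near. Qed.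

Let mM C theta n : (1 <= n)%N -> measurable_fun setT (M C theta n).
Proof.
move=> n1; apply: (measurable_wrt_fun (row_field (hF n1) (leqnn _)).2).
exact: (measurable_exp_mart (hF n1) (hs n1) (hx n1) (KK n1)).
Qed.

Let Mle C theta n x : 0 <= C -> (1 <= n)%N -> `|M C theta n x| <= expR (C / 2).
Proof. by move=> C0 n1; exact: (exp_mart_le _ (hs n1) (hx n1) C0). Qed.

(** From the pi-system of the tail fields to the bounded functions that are
    measurable with respect to the field generated by them. *)
Lemma exp_mart_weak (C theta : R) (zeta : T -> R) : 0 <= C ->
  measurable_wrt (limit_field K F) zeta -> bdd zeta ->
  Ex (fun x => zeta x * (M C theta n x - cos theta)) @[n --> \oo] --> (0 : R).
Proof.
move=> C0 mz bz.
have mW n : (0 < n)%N -> measurable_fun setT (fun x => M C theta n x - cos theta).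
  by move=> n1; apply: measurable_funB => //; exact: mM.
have Wb n x : (0 < n)%N -> `|M C theta n x - cos theta| <= expR (C / 2) + 1.
  by move=> n1; rewrite (le_trans (ler_normB _ _))// lerD ?Mle ?cos_max.
apply: (weak_cvg_bounded mW Wb limit_field_sub) => // A.
apply: (weak_cvg_generated mW Wb) => //.
- exact: tail_unionI.
- exact: tail_union_measurable.
- exact: tail_unionT.
- by move=> B [m /= m1 hB]; exact: exp_mart_tail hB.
Qed.

Let meta' : measurable_fun setT eta2.
Proof. exact: measurable_wrt_fun limit_field_sub.2 meta. Qed.

Let big m : set T := [set x | m%:R < eta2 x].

Let mbig m : measurable (big m).
Proof.
apply: limit_field_sub.2; apply: measurable_wrt_lt => //; first exact: limit_field_sub.1.
exact: measurable_wrt_cst limit_field_sub.1 _.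
Qed.

Let big_small : Ex (\1_(big m) : T -> R) @[m --> \oo] --> (0 : R).
Proof.
have [||||_ c] := @Ex_dom _ _ _ P (fun m => \1_(big m)) (cst 0) (cst 1).
- by move=> m; exact: measurable_indic.
- exact: integ_cst.
- move=> x; apply: cvg_near_cst; near=> m; rewrite indicE memNset// /big/=.
  apply/negP; rewrite -leNgt; near: m; exact: nbhs_infty_ger.
- by move=> m x; rewrite indicE ger0_norm ?boolr_le1.
by rewrite Ex_cst in c.
Unshelve. all: by end_near. Qed.

Let mSn n : (1 <= n)%N -> measurable_fun setT (Sn n).
Proof.
move=> n1; under eq_fun do rewrite big_nat big_mkcond/=.
apply: measurable_sum => k; case: (boolP (s n <= k < (K n).+1)%N) => // kK.
have kK' : (k <= K n)%N by case/andP: kK.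
by have [_ [mx _] _ _ _] := hx n1 kK.
Qed.

Lemma expR_near0 (x : R) : `|x| <= 2^-1 -> `|expR x - 1| <= 2 * `|x|.
Proof.
move=> hx'; have h1 := expR_ge1Dx x; have h2 := expR_ge1Dx (- x).
have h3 : expR x * expR (- x) = 1 by rewrite -expRD subrr expR0.
have h4 := expR_gt0 x.
have [x0|x0] := leP 0 x.
  rewrite ger0_norm in hx' *; last by []; rewrite ger0_norm; last by lra.
  have : expR x * (1 - x) <= 1 by rewrite -[leRHS]h3 ler_wpM2l// ltW.
  nra.
have : expR x <= 1 by rewrite -[leRHS]expR0 ler_expR ltW.
move=> h5; rewrite ler0_norm; last by lra.
rewrite (ltr0_norm x0); lra.
Qed.

(** The multiplier [exp (- eta2 / 2)] is measurable with respect to the limit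
    field, so it can be absorbed in the test function [zeta]; it cancels the
    damping factor of [exp_mart] up to the error of the conditional variances. *)
Lemma scalar_stable_limit (theta : R) (zeta : T -> R) :
  measurable_wrt (limit_field K F) zeta -> bdd zeta ->
  Ex (fun x => zeta x * cos (Sn n x + theta)) @[n --> \oo] -->
  cos theta * Ex (fun x => zeta x * expR (- (eta2 x / 2))).
Proof.
move=> mz [b zb].
have [sG sm] := limit_field_sub.
have b0 : 0 <= b by exact: le_trans (zb point).
have mz' := measurable_wrt_fun sm mz.
have iz : integ zeta by apply: integ_bdd => //; exists b.
pose g x := expR (- (eta2 x / 2)).
have g1 x : `|g x| <= 1.
  rewrite ger0_norm ?expR_ge0// -expR0 ler_expR oppr_le0 divr_ge0//.
have mg : measurable_wrt (limit_field K F) g.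
  apply: (measurable_wrt_comp sG (k := fun y => expR (- (y / 2)))) => //.
  apply: measurableT_comp; first exact: measurable_expR.
  apply: measurableT_comp; first exact: oppr_measurable.
  exact: mulrr_measurable.
have mg' := measurable_wrt_fun sm mg.
apply/cvgrPdist_le => delta d0.
have d4 : 0 < delta / 4 by rewrite divr_gt0.
have b1 : 0 < b + 1 by rewrite ltr_pwDr.
have d5 : 0 < delta / 4 / (b + 1) by rewrite divr_gt0.
move/near0P: big_small => /(_ _ d5)[m _ /(_ m (leqnn m)) hm].
rewrite ger0_norm in hm; last by apply: Ex_ge0 => x; rewrite indicE.
pose C : R := m.+1%:R; have C0 : 0 <= C by [].
set e := expR (C / 2); have e0 : 0 < e by exact: expR_gt0.
pose D := ~` big m.
have GD : limit_field K F D.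
  rewrite /D -setTD; have [_ GDc _] := sG; apply: GDc; apply: measurable_wrt_lt => //.
  exact: measurable_wrt_cst.
have mD : measurable D by exact: sm.
have mind : measurable_wrt (limit_field K F) (\1_D : T -> R).
  exact: measurable_wrt_indic.
have DE x : \1_D x = 1 - \1_(big m) x :> R.
  by rewrite !indicE in_setC; case: (_ \in _); rewrite ?subrr ?subr0.
pose zeta' x := zeta x * g x * \1_D x.
have mz1 : measurable_wrt (limit_field K F) zeta'.
  by apply: measurable_wrtM => //; exact: measurable_wrtM.
have bg : bdd g by exists 1.
have bzz : bdd zeta by exists b.
have bz1 : bdd zeta' by apply: bddM; [exact: bddM|exact: bdd_indic].
have ha := exp_mart_weak theta C0 mz1 bz1.
pose Zn n x := zeta' x * M C theta n x - zeta x * \1_D x * cos (Sn n x + theta).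
have mcos n : (1 <= n)%N -> measurable_fun setT (fun x => cos (Sn n x + theta)).
  move=> n1; apply: measurableT_comp.
    by apply: continuous_measurable_fun; exact: continuous_cos.
  by apply: measurable_funD => //; exact: mSn.
have mZ n : (1 <= n)%N -> measurable_fun setT (Zn n).
  move=> n1; apply: measurable_funB; apply: measurable_funM.
  - exact: measurable_wrt_fun sm mz1.
  - exact: mM.
  - by apply: measurable_funM => //; exact: measurable_indic.
  - exact: mcos.
have ind1 x : `|\1_D x : R| <= 1 by rewrite indicE ger0_norm ?boolr_le1.
have z1b x : `|zeta' x| <= b.
  by rewrite !normrM -[leRHS]mulr1 ler_pM ?mulr_ge0// -[leRHS]mulr1 ler_pM.
have Zb n x : (1 <= n)%N -> `|Zn n x| <= b * (e + 1).
  move=> n1; rewrite (le_trans (ler_normB _ _))// mulrDr mulr1 lerD// normrM.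
    by rewrite ler_pM// Mle.
  by rewrite -[leRHS]mulr1 ler_pM ?cos_max// normrM -[leRHS]mulr1 ler_pM.
have ZV n x : (1 <= n)%N -> `|Zn n x| <= b * (e + 2) * `|Vn n x - eta2 x|.
  move=> n1; have [hge|hlt] := leP 1 `|Vn n x - eta2 x|.
    apply: (le_trans (Zb n x n1)).
    have : 0 <= b * (e + 2) by rewrite mulr_ge0// addr_ge0// ltW.
    by move: hge; set y := `|_|; nra.
  have [xD|xD] := boolP (x \in D); last first.
    rewrite /Zn /zeta' indicE (negbTE xD)/= !mulr0 !mul0r subrr normr0.
    by rewrite !mulr_ge0// addr_ge0// ltW.
  have etam : eta2 x <= m%:R.
    by move: xD; rewrite inE /D /big /= => /negP; rewrite -leNgt.
  have VC : var_upto (s n) (v n) (K n) x <= C.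
    rewrite /var_upto /C -natr1; move: hlt; rewrite ltr_norml => /andP[_].
    by set y := \sum_(_ <= _ < _) _; move: etam; lra.
  have hZ : Zn n x = zeta x * cos (Sn n x + theta) * (expR ((Vn n x - eta2 x) / 2) - 1).
    rewrite /Zn /zeta' indicE xD/= !mulr1 /exp_mart.
    rewrite !(stopped_sum_unstopped (hx n1) _ VC).
    have -> : expR ((Vn n x - eta2 x) / 2) = expR (Vn n x / 2) * g x.
      by rewrite /g -expRD -mulNr -mulrDl.
    by ring.
  rewrite hZ normrM.
  have h1 : `|zeta x * cos (Sn n x + theta)| <= b.
    by rewrite normrM -[leRHS]mulr1 ler_pM ?cos_max.
  have h2 : `|(Vn n x - eta2 x) / 2| <= 2^-1.
    by rewrite normrM (ger0_norm (_ : 0 <= 2^-1))// ler_piMl// ltW.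
  have h3 := expR_near0 h2.
  apply: (@le_trans _ _ (b * (2 * `|(Vn n x - eta2 x) / 2|))); first by rewrite ler_pM.
  rewrite normrM (ger0_norm (_ : 0 <= 2^-1))//.
  set y := `|_ - _|; have -> : 2 * (y / 2) = y by field.
  rewrite ler_wpM2r ?normr_ge0// ler_peMr// ler_wpDl ?(ltW e0)// ler1n//.
have hb : Ex (fun x => `|Zn n x|) @[n --> \oo] --> (0 : R).
  apply: (@Ex_cvgp0 _ _ _ P Zn (b * (e + 1))).
    near=> n; move=> x; apply: Zb; near: n; exact: nbhs_infty_gt.
  apply: (cvgp0_le _ _ (cvgp0Z (b * (e + 2)) hV)).
    near=> n; apply: mZ; near: n; exact: nbhs_infty_gt.
  near=> n; move=> x; rewrite normrM ger0_norm; last by rewrite mulr_ge0// addr_ge0// ltW.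
  apply: ZV; near: n; exact: nbhs_infty_gt.
move/near0P: hb => /(_ _ d4) hb; move/near0P: ha => /(_ _ d4) ha.
near=> n.
have n1 : (1 <= n)%N by near: n; exact: nbhs_infty_gt.
have han : `|Ex (fun x => zeta' x * (M C theta n x - cos theta))| <= delta / 4 by near: n.
have hbn : `|Ex (fun x => `|Zn n x|)| <= delta / 4 by near: n.
have iMn : integ (M C theta n).
  by apply: integ_bdd; [exact: mM|exists e => x; exact: Mle].
have iz1 : integ zeta' by apply: integ_bdd => //; exact: measurable_wrt_fun sm mz1.
have mulb (f h : T -> R) : measurable_fun setT f -> bdd f -> integ h ->
  integ (fun x => f x * h x) by exact: integM_bdd.
have mz1' := measurable_wrt_fun sm mz1.
have icos : integ (fun x => zeta x * cos (Sn n x + theta)).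
  apply: mulb => //; apply: integ_bdd; first exact: mcos.
  by exists 1 => x; exact: cos_max.
have izg : integ (fun x => zeta x * g x) by apply: mulb => //; exact: integ_bdd.
have ia : integ (fun x => zeta' x * (M C theta n x - cos theta)).
  by apply: mulb => //; apply: integB => //; exact: integ_cst.
have iZ : integ (Zn n) by apply: integ_bdd; [exact: mZ|exists (b * (e + 1)) => x; exact: Zb].
have ibig : integ (\1_(big m) : T -> R) by exact: integ_indic.
have bigb (f : T -> R) : (forall x, `|f x| <= b) -> integ f ->
    `|Ex (fun x => f x * \1_(big m) x)| <= delta / 4.
  move=> fb fi.
  apply: (@le_trans _ _ (Ex (fun x => (b + 1) * \1_(big m) x))).
    apply: Ex_abs_le; last first.
    - move=> x; rewrite normrM ler_pM//; first by rewrite (le_trans (fb x)) ?lerDl.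
      by rewrite indicE ger0_norm.
    - exact: integZ.
    - by under eq_fun do rewrite mulrC; exact: integM_indic.
  by rewrite ExZ// mulrC -ler_pdivlMr.
have ibm (f : T -> R) : integ f -> integ (fun x => f x * \1_(big m) x).
  by move=> fi; under eq_fun do rewrite mulrC; exact: integM_indic.
(* The difference splits into the part cut off by the event that the limit
   variance is large, the stopping error and the martingale error. *)
have -> : cos theta * Ex (fun x => zeta x * g x) - Ex (fun x => zeta x * cos (Sn n x + theta)) =
  cos theta * Ex (fun x => zeta x * g x * \1_(big m) x) -
  Ex (fun x => zeta x * cos (Sn n x + theta) * \1_(big m) x) +
  (Ex (Zn n) - Ex (fun x => zeta' x * (M C theta n x - cos theta))).
  have -> : Zn n = fun x => (zeta' x * (M C theta n x - cos theta) +
      cos theta * (zeta x * g x)) - (cos theta * (zeta x * g x * \1_(big m) x) +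
      (zeta x * cos (Sn n x + theta) - zeta x * cos (Sn n x + theta) * \1_(big m) x)).
    apply/funext => x; rewrite /Zn /zeta' DE; ring.
  have i1 := integZ (cos theta) izg.
  have i2 := integZ (cos theta) (ibm _ izg).
  have i3 := ibm _ icos.
  rewrite ExB; [|exact: integD|apply: integD => //; exact: integB].
  rewrite ExD// ExD//; last exact: integB.
  rewrite ExB// !ExZ//; last exact: ibm.
  by ring.
have B1 : `|cos theta * Ex (fun x => zeta x * g x * \1_(big m) x)| <= delta / 4.
  rewrite normrM -[leRHS]mul1r ler_pM ?cos_max//.
  by apply: bigb => // x; rewrite normrM -[leRHS]mulr1 ler_pM.
have B2 : `|Ex (fun x => zeta x * cos (Sn n x + theta) * \1_(big m) x)| <= delta / 4.
  by apply: bigb => // x; rewrite normrM -[leRHS]mulr1 ler_pM ?cos_max.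
have B3 : `|Ex (Zn n)| <= delta / 4.
  by apply: le_trans (Ex_abs iZ) _; apply: le_trans hbn; exact: ler_norm.
rewrite (le_trans (ler_normD _ _))//.
apply: (le_trans (lerD (ler_normB _ _) (ler_normB _ _))); move: B1 B2 B3 han; lra.
Unshelve. all: by end_near. Qed.

(** The second moment of the stopped sum is at most [C], and stopping has no
    effect outside an event of small probability. *)
Lemma scalar_tight (delta : R) : 0 < delta -> exists2 A : R, 0 < A &
  \forall n \near \oo, (P [set x | (A <= `|Sn n x|)%R] <= delta%:E)%E.
Proof.
move=> d0; have d3 : 0 < delta / 3 by rewrite divr_gt0.
move/near0P: big_small => /(_ _ d3)[m _ /(_ m (leqnn m)) hm].
rewrite ger0_norm in hm; last by apply: Ex_ge0 => x; rewrite indicE.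
rewrite Ex_indic// in hm.
have {}hm : (P (big m) <= (delta / 3)%:E)%E.
  by rewrite -(fineK (fin_num_measure P _ (mbig m))) lee_fin.
pose C : R := m.+1%:R; have C0 : 0 <= C by [].
pose A := Num.max 1 (C / (delta / 3)).
have A1 : 1 <= A by rewrite le_max lexx.
have A0 : 0 < A by apply: lt_le_trans A1.
have AC : C <= A ^+ 2 * (delta / 3).
  have : C / (delta / 3) <= A by rewrite le_max lexx orbT.
  rewrite ler_pdivrMr// => h; apply: (le_trans h).
  by rewrite ler_wpM2r// ?(ltW d3)// expr2 ler_peMl// ltW.
exists A => //.
have [mV hVp] := hV.
near=> n.
have n1 : (1 <= n)%N by near: n; exact: nbhs_infty_gt.
have hVn : (P [set x | (1 <= `|Vn n x - eta2 x|)%R] <= (delta / 3)%:E)%E.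
  by near: n; exact: hVp.
have mVn : measurable_fun setT (fun x => Vn n x - eta2 x) by near: n.
pose S' := stopped_sum (s n) (v n) C (xi n) (K n).
have [[mS' iS'] _] := Ex_stopped_sum_sqr (hF n1) (hs n1) (hx n1) C0 (KK n1).
have PS : (P [set x | (A <= `|S' x|)%R] <= (delta / 3)%:E)%E.
  have mA := measurable_abs_ge A mS'.
  rewrite -(fineK (fin_num_measure P _ mA)) lee_fin -Ex_indic//.
  have h1 := Ex_stopped_sum_sqr_le (hF n1) (hs n1) (hx n1) C0.
  rewrite -(ler_pM2l (_ : 0 < A ^+ 2)) ?exprn_gt0//.
  apply: le_trans AC; apply: le_trans h1; rewrite -ExZ; last exact: integ_indic.
  apply: Ex_le => // [|x]; first by apply: integZ; exact: integ_indic.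
  rewrite indicE; case: (boolP (x \in _)) => [|_]; last by rewrite mulr0 sqr_ge0.
  rewrite inE/= mulr1 => h; rewrite -(real_normK (num_real (S' x))).
  by rewrite lerXn2r// ?nnegrE// ltW.
have d3E : delta = delta / 3 + (delta / 3 + delta / 3) by field.
rewrite d3E !EFinD; apply: (le_trans _ (leeD PS (leeD hVn hm))).
have mA := measurable_abs_ge A mS'.
have m1 := measurable_abs_ge 1 mVn.
apply: (@le_trans _ _ (P ([set x | (A <= `|S' x|)%R] `|`
   ([set x | (1 <= `|Vn n x - eta2 x|)%R] `|` big m)))); last first.
  apply: le_trans (measureU2 _ _ _) _ => //; first exact: measurableU.
  by rewrite leeD2l// measureU2.
apply: le_measure; rewrite ?inE.
- exact: measurable_abs_ge (mSn n1).
- by apply: measurableU => //; exact: measurableU.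
move=> x /= hA.
have [h1|h1] := leP 1 `|Vn n x - eta2 x|; first by right; left.
have [h2|h2] := ltP m%:R (eta2 x); first by right; right.
left; rewrite /S' (stopped_sum_unstopped (hx n1))//.
rewrite /var_upto /C -natr1; move: h1; rewrite ltr_norml => /andP[_].
by set y := \sum_(_ <= _ < _) _; move: h2; lra.
Unshelve. all: by end_near. Qed.

End scalar_limit.

(** * The characteristic function of the Gaussian law *)

Section gaussian_characteristic_function.
Context {R : realType}.
Local Notation mu := (@lebesgue_measure R).
Local Notation phi := (@normal_pdf R 0 1).
Implicit Types (c theta z : R).

Let s1 : (1 : R) != 0. Proof. exact: oner_neq0. Qed.

Let phiE z : phi z = normal_peak 1 * expR (- (z ^+ 2 / 2)).
Proof. by rewrite normal_pdfE// /normal_fun subr0 expr1n mulNr. Qed.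

Let phi_ge0 z : 0 <= phi z. Proof. exact: normal_pdf_ge0. Qed.

Let is_derive_phi z : is_derive z 1 phi (- z * phi z).
Proof.
have -> : phi = fun y => normal_peak 1 * expR (- (y ^+ 2 / 2)).
  by apply/funext => y; exact: phiE.
by apply: is_derive_eq; rewrite /GRing.scale/=; field.
Qed.

Let iphi : mu.-integrable [set: R] (EFin \o phi).
Proof. exact: integrable_normal_pdf. Qed.

Let mphi : measurable_fun [set: R] phi. Proof. exact: measurable_normal_pdf. Qed.

(* A Gaussian density of larger variance absorbs the factor. *)
Let izphi : mu.-integrable [set: R] (EFin \o (fun z => `|z| * phi z)).
Proof.
pose s : R := Num.sqrt 2.
have s0 : s != 0 by rewrite gt_eqF// sqrtr_gt0.
have s2 : s ^+ 2 = 2 by rewrite sqr_sqrtr.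
have ps0 : 0 < normal_peak s by exact: normal_peak_gt0.
pose k : R := normal_peak 1 / normal_peak s.
have ik : mu.-integrable [set: R] (EFin \o (fun z => k * normal_pdf 0 s z)).
  by apply: (integrableZl measurableT k (integrable_normal_pdf 0 s)).
apply: le_integrable ik => //.
  apply/measurable_EFinP; apply: measurable_funM => //; exact: normr_measurable.
move=> z _; rewrite /= lee_fin.
rewrite [leLHS]ger0_norm ?mulr_ge0//.
have k0 : 0 <= k by rewrite divr_ge0// normal_peak_ge0.
rewrite [leRHS]ger0_norm; last by rewrite mulr_ge0// normal_pdf_ge0.
rewrite phiE normal_pdfE// /normal_fun subr0 s2 /k.
have -> : normal_peak 1 / normal_peak s * (normal_peak s * expR (- z ^+ 2 / (2 *+ 2)))
   = normal_peak 1 * expR (- z ^+ 2 / (2 *+ 2)).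
  by rewrite mulrA divfK// gt_eqF.
rewrite mulrCA ler_wpM2l ?normal_peak_ge0//.
have -> : - z ^+ 2 / (2 *+ 2) = z ^+ 2 / 4 + - (z ^+ 2 / 2) by rewrite mulr2n; field.
rewrite expRD ler_wpM2r ?expR_ge0//; apply: le_trans (expR_ge1Dx _).
rewrite -(real_normK (num_real z)).
have := sqr_ge0 (`|z| / 2 - 1); nra.
Qed.

Let ibdd (g : R -> R) (h : R -> R) : measurable_fun setT g -> (forall z, `|g z| <= 1) ->
  mu.-integrable [set: R] (EFin \o h) -> mu.-integrable [set: R] (EFin \o (fun z => g z * h z)).
Proof.
move=> mg g1 ih; apply: le_integrable (ih) => //.
  apply/measurable_EFinP; apply: measurable_funM => //.
  by apply/measurable_EFinP; exact: measurable_int ih.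
by move=> z _; rewrite /= lee_fin normrM ler_piMl.
Qed.

Let mlin c theta : measurable_fun [set: R] (fun z => c * z + theta).
Proof. by apply: measurable_funD => //; exact: mulrl_measurable. Qed.

Let mcos c theta : measurable_fun [set: R] (fun z => cos (c * z + theta)).
Proof.
apply: measurableT_comp => //.
by apply: continuous_measurable_fun; exact: continuous_cos.
Qed.

Let msin c theta : measurable_fun [set: R] (fun z => sin (c * z + theta)).
Proof.
apply: measurableT_comp => //.
by apply: continuous_measurable_fun; exact: continuous_sin.
Qed.

Let icos c theta : mu.-integrable [set: R] (EFin \o (fun z => cos (c * z + theta) * phi z)).
Proof. by apply: ibdd => // z; exact: cos_max. Qed.

Let iz : mu.-integrable [set: R] (EFin \o (fun z => z * phi z)).
Proof.
apply: le_integrable izphi => //.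
  by apply/measurable_EFinP; exact: measurable_funM.
by move=> z _; rewrite /= lee_fin !normrM normr_id.
Qed.

Let isin c theta : mu.-integrable [set: R]
  (EFin \o (fun z => sin (c * z + theta) * (z * phi z))).
Proof. by apply: ibdd => // z; exact: sin_max. Qed.

(** Reduces integrals over the line to segments, where the fundamental theorem
    of calculus applies. *)
Lemma cvg_Rintegral_window (f : R -> R) : mu.-integrable [set: R] (EFin \o f) ->
  \int[mu]_(z in `[- n%:R, n%:R]) f z @[n --> \oo] --> \int[mu]_z f z.
Proof.
move=> fi; have mf : measurable_fun [set: R] f.
  by apply/measurable_EFinP; exact: measurable_int fi.
have [|||||_ _ c] := @dominated_convergence _ _ R mu setT measurableT
  (fun n z => ((f \_ `[- n%:R, n%:R]) z)%:E) (EFin \o f) (abse \o (EFin \o f)).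
- move=> n; apply/measurable_EFinP; apply/(measurable_restrictT _ _).1 => //.
  exact: measurable_funTS.
- exact/measurable_EFinP.
- apply: aeW => z _; apply: cvg_near_cst; near=> n; rewrite patchE ifT//.
  rewrite inE/= in_itv/= -ler_norml; near: n; exact: nbhs_infty_ger.
- exact: integrable_abse.
- apply: aeW => z n _; rewrite /= lee_fin patchE; case: ifPn => // _.
  by rewrite normr0.
rewrite /Rintegral; apply: fine_cvg; rewrite fineK; last exact: integrable_fin_num.
move: c; apply: cvg_trans; apply: near_eq_cvg; apply: nearW => n.
rewrite [RHS]integral_mkcond; apply: eq_integral => z _.
by rewrite !patchE; case: ifPn.
Unshelve. all: by end_near. Qed.

(** Stein's identity, from the derivative of [sin (c * z + theta) * phi z]. *)
Lemma gaussian_by_parts c theta :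
  \int[mu]_z (sin (c * z + theta) * (z * phi z)) =
  c * \int[mu]_z (cos (c * z + theta) * phi z).
Proof.
pose H z := sin (c * z + theta) * phi z.
pose h z := c * (cos (c * z + theta) * phi z) - sin (c * z + theta) * (z * phi z).
have dH z : is_derive z 1 H (h z).
  have dphi := is_derive_phi z.
  by rewrite /H; apply: is_derive_eq; rewrite /GRing.scale/= /h; ring.
have cont_of (g dg : R -> R) : (forall z, is_derive z 1 g (dg z)) -> continuous g.
  by move=> dg' z; apply/differentiable_continuous/derivable1_diffP; have [] := dg' z.
have cH : continuous H by exact: cont_of dH.
have cphi : continuous phi by exact: cont_of is_derive_phi.
have ccos : continuous (fun z => cos (c * z + theta)).
  apply: (cont_of _ (fun z => - c * sin (c * z + theta))) => z.
  by apply: is_derive_eq; rewrite /GRing.scale/=; ring.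
have csin : continuous (fun z => sin (c * z + theta)).
  apply: (cont_of _ (fun z => c * cos (c * z + theta))) => z.
  by apply: is_derive_eq; rewrite /GRing.scale/=; ring.
have ch : continuous h.
  move=> z; apply: cvgB; apply: cvgM.
  - exact: cvg_cst.
  - by apply: cvgM; [exact: ccos|exact: cphi].
  - exact: csin.
  - by apply: cvgM; [exact: cvg_id|exact: cphi].
have ih : mu.-integrable [set: R] (EFin \o h).
  by apply: (integrableB _ (integrableZl measurableT c (icos c theta)) (isin c theta)).
have win n : \int[mu]_(z in `[- n.+1%:R, n.+1%:R]) h z = H n.+1%:R - H (- n.+1%:R).
  rewrite /Rintegral (@continuous_FTC2 R h H)//.
  - by rewrite -subr_gt0 opprK -natrD ltr0n.
  - exact: continuous_subspaceT.
  - split.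
    + by move=> z _; have [] := dH z.
    + by apply: cvg_at_right_filter; exact: cH.
    + by apply: cvg_at_left_filter; exact: cH.
  - by move=> z _; rewrite derive1E; have [_ ->] := dH z.
have cH0 : H n.+1%:R - H (- n.+1%:R) @[n --> \oo] --> (0 : R).
  apply/cvgrPdist_le => delta d0.
  have pk := normal_peak_ge0 (1 : R).
  near=> n; rewrite sub0r normrN.
  have N0 : 0 < n.+1%:R :> R by [].
  have Hb y : y ^+ 2 = n.+1%:R ^+ 2 -> `|H y| <= normal_peak 1 * (2 / n.+1%:R).
    move=> yn; rewrite normrM (ger0_norm (phi_ge0 _)) phiE yn.
    apply: (@le_trans _ _ (1 * (normal_peak 1 * expR (- (n.+1%:R ^+ 2 / 2))))).
      by rewrite ler_wpM2r ?sin_max// mulr_ge0 ?expR_ge0.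
    rewrite mul1r ler_wpM2l// expRN -[leRHS]invrK lef_pV2 ?posrE ?invr_gt0 ?expR_gt0 ?divr_gt0//.
    apply: le_trans (expR_ge1Dx _); rewrite invf_div.
    have N1 : 1 <= n.+1%:R :> R by rewrite ler1n.
    by nra.
  apply: (@le_trans _ _ (normal_peak 1 * (2 / n.+1%:R) + normal_peak 1 * (2 / n.+1%:R))).
    by rewrite (le_trans (ler_normB _ _))// lerD// Hb// sqrrN.
  have : (normal_peak 1 * 4 / delta) <= n.+1%:R.
    near: n; have := nbhs_infty_ger (normal_peak 1 * 4 / delta).
    by apply: filterS => n /le_trans; apply; rewrite ler_nat.
  rewrite ler_pdivrMr// => h1.
  set N : R := n.+1%:R.
  have -> : normal_peak 1 * (2 / N) + normal_peak 1 * (2 / N) =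
    normal_peak 1 * 4 / N by ring.
  by rewrite ler_pdivrMr// [leRHS]mulrC.
have c1 := cvg_Rintegral_window ih.
have {}c1 : \int[mu]_(z in `[- n.+1%:R, n.+1%:R]) h z @[n --> \oo] --> \int[mu]_z h z.
  by have := c1; rewrite -(cvg_shiftS).
have h0 : \int[mu]_z h z = 0.
  rewrite (_ : (fun n => _) = fun n => H n.+1%:R - H (- n.+1%:R)) in c1; last first.
    by apply/funext => n; exact: win.
  exact: (cvg_unique _ c1 cH0).
move: h0; rewrite RintegralB//; last first.
  by apply: (integrableZl measurableT c (icos c theta)).
by rewrite RintegralZl// => /eqP; rewrite subr_eq0 => /eqP/esym.
Unshelve. all: by end_near. Qed.

Let Fc theta c := \int[mu]_z (cos (c * z + theta) * phi z).

(** By Stein's identity, differentiation under the integral gives a linear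
    differential equation. *)
Let is_derive_Fc theta c : is_derive c 1 (Fc theta) (- c * Fc theta c).
Proof.
pose f (x z : R) := cos (x * z + theta) * phi z.
have df (x z : R) : is_derive x 1 (f^~ z) (- sin (x * z + theta) * (z * phi z)).
  by rewrite /f; apply: is_derive_eq; rewrite /GRing.scale/=; ring.
have p1 x z : partial1of2 f x z = - sin (x * z + theta) * (z * phi z).
  by rewrite partial1of2E; have [_ ->] := df x z.
have Ia : `](c - 1), (c + 1)[%classic c by rewrite /= in_itv/=; apply/andP; split; lra.
have if_ (x : R) : `](c - 1), (c + 1)[%classic x -> mu.-integrable setT (EFin \o f x).
  by move=> _; exact: icos.
have der x z : `](c - 1), (c + 1)[%classic x -> [set: R] z -> derivable (f^~ z) x 1.
  by move=> _ _; have [] := df x z.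
have Gb x z : `](c - 1), (c + 1)[%classic x -> [set: R] z ->
    `|partial1of2 f x z| <= `|z| * phi z.
  move=> _ _; rewrite p1 !normrM normrN (ger0_norm (phi_ge0 _)).
  by rewrite ler_piMl ?mulr_ge0// sin_max.
have G0 z : 0 <= `|z| * phi z by rewrite mulr_ge0.
apply: DeriveDef.
  exact: (derivable_under_integral measurableT Ia if_ der G0 izphi Gb).
have := differentiation_under_integral measurableT Ia if_ der G0 izphi Gb.
rewrite derive1E => ->.
rewrite /Fc mulNr -gaussian_by_parts -mulN1r -RintegralZl//.
by apply: eq_Rintegral => z _; rewrite p1 mulN1r mulNr.
Qed.

Lemma gaussian_cos_lebesgue theta c :
  \int[mu]_z (cos (c * z + theta) * phi z) = expR (- (c ^+ 2 / 2)) * cos theta.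
Proof.
pose H x := Fc theta x * expR (x ^+ 2 / 2).
have dH (x : R) : is_derive x 1 H 0.
  have dF := is_derive_Fc theta x.
  by rewrite /H; apply: is_derive_eq; rewrite /GRing.scale/=; field.
have := is_derive_0_is_cst c 0 dH.
rewrite /H expr0n/= mul0r expR0 mulr1.
have -> : Fc theta 0 = cos theta.
  rewrite /Fc (_ : (fun z => _) = fun z => cos theta * phi z); last first.
    by apply/funext => z; rewrite mul0r add0r.
  by rewrite RintegralZl// /Rintegral integral_normal_pdf mulr1.
by move=> <-; rewrite -[LHS]/(Fc theta c) mulrCA -expRD addNr expR0 mulr1.
Qed.

Lemma gaussian_cos theta c :
  \int[normal_prob (0 : R) 1]_z cos (c * z + theta) =
  expR (- (c ^+ 2 / 2)) * cos theta.
Proof.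
rewrite -gaussian_cos_lebesgue /Rintegral; congr fine.
have dom : normal_prob (0 : R) 1 `<< mu by exact: normal_prob_dominates.
have ic : (normal_prob (0 : R) 1).-integrable setT (EFin \o (fun z => cos (c * z + theta))).
  apply: measurable_bounded_integrable => //.
    by rewrite (le_lt_trans (probability_le1 _ _))// ltry.
  exact: mcos.
  exists 1; split=> // x x1 z _; apply: le_trans (ltW x1); exact: cos_max.
rewrite -(Radon_Nikodym_change_of_variables dom measurableT ic).
have ae : ae_eq mu setT (Radon_Nikodym (charge_of_finite_measure (normal_prob (0 : R) 1)) mu)
    (EFin \o phi).
  apply: integral_ae_eq => //.
  - exact: Radon_Nikodym_integrable.
  - exact/measurable_EFinP.
  - by move=> E _ mE; rewrite -Radon_Nikodym_integral.
apply: ae_eq_integral => //.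
- have m1 : measurable_fun setT (EFin \o (fun z => cos (c * z + theta))).
    by apply/measurable_EFinP; apply: mcos.
  apply: emeasurable_funM m1 _; apply: (measurable_int mu); exact: Radon_Nikodym_integrable.
- by apply/measurable_EFinP; apply: measurable_funM; [apply: mcos|apply: mphi].
- by apply: filterS ae => z /= h /h ->; rewrite EFinM.
Qed.

End gaussian_characteristic_function.

(** * Positive semidefinite square roots *)

Section positive_square_root.
Context {R : realType}.

Lemma cvg_bigsum (U : Type) (Phi : set_system U) {PhiF : Filter Phi} (I : Type) (r : seq I)
    (p : pred I) (f : I -> U -> R) (l : I -> R) :
  (forall i, p i -> f i n @[n --> Phi] --> l i) ->
  \sum_(i <- r | p i) f i n @[n --> Phi] --> \sum_(i <- r | p i) l i.
Proof.
move=> h; elim: r => [|i r IH].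
  by under eq_fun do rewrite big_nil; rewrite big_nil; exact: cvg_cst.
under eq_fun do rewrite big_cons; rewrite big_cons.
by case: (boolP (p i)) => // pi; apply: cvgD => //; exact: h.
Qed.

Variable d : nat.
Implicit Types (A B Q S Y Z : 'M[R]_d) (u v : 'cV[R]_d).

(** Square matrices of possibly null size are not an algebra, hence these two
    lemmas. *)
Lemma mxscaleAl (c : R) A B : (c *: A) * B = c *: (A * B).
Proof. by rewrite -!mulmxE scalemxAl. Qed.

Lemma mxscaleAr (c : R) A B : A * (c *: B) = c *: (A * B).
Proof. by rewrite -!mulmxE scalemxAr. Qed.

Definition qf A v : R := (v^T *m A *m v) 0 0.

Lemma qfD A B v : qf (A + B) v = qf A v + qf B v.
Proof. by rewrite /qf mulmxDr mulmxDl mxE. Qed.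

Lemma qfZ (c : R) A v : qf (c *: A) v = c * qf A v.
Proof. by rewrite /qf -scalemxAr -scalemxAl mxE. Qed.

Lemma qfN A v : qf (- A) v = - qf A v.
Proof. by rewrite -scaleN1r qfZ mulN1r. Qed.

Lemma qf_sqr B v : B^T = B -> qf (B * B) v = \sum_i (B *m v) i 0 ^+ 2.
Proof.
move=> BT; rewrite /qf -mulmxE !mulmxA -{1}BT -trmx_mul -mulmxA mxE.
by apply: eq_bigr => i _; rewrite mxE expr2.
Qed.

Lemma qf1 v : qf 1 v = \sum_i v i 0 ^+ 2.
Proof. by have := @qf_sqr 1 v; rewrite mulr1 mul1mx; apply; rewrite trmx1. Qed.

Lemma psdD A B : psd A -> psd B -> psd (A + B).
Proof.
move=> [sA pA] [sB pB]; split; first by rewrite linearD/= sA sB.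
by move=> v; rewrite -/(qf _ _) qfD addr_ge0//; [exact: pA|exact: pB].
Qed.

Lemma psdZ (c : R) A : 0 <= c -> psd A -> psd (c *: A).
Proof.
move=> c0 [sA pA]; split; first by rewrite linearZ/= sA.
by move=> v; rewrite -/(qf _ _) qfZ mulr_ge0//; exact: pA.
Qed.

Lemma psd1 : psd (1 : 'M[R]_d).
Proof.
by split; [rewrite trmx1|move=> v; rewrite -/(qf _ _) qf1 sumr_ge0// => i _; rewrite sqr_ge0].
Qed.

Lemma psd_congr B A : B^T = B -> psd A -> psd (B * A * B).
Proof.
move=> sB [sA pA]; split.
  by rewrite -!mulmxE !trmx_mul sA sB mulmxA.
move=> v; have := pA (B *m v); rewrite trmx_mul sB.
by rewrite -!mulmxE !mulmxA.
Qed.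

Lemma psdX A n : psd A -> psd (A ^+ n).
Proof.
move=> pA; have sA := pA.1.
have [k] := ubnP n; elim: k n => // k IH [|[|n]] nk; rewrite ?expr0 ?expr1//.
  exact: psd1.
have -> : A ^+ n.+2 = A * A ^+ n * A by rewrite exprS exprSr mulrA.
by apply: psd_congr => //; apply: IH; rewrite -ltnS (leq_trans _ nk)// ltnW.
Qed.

(** [1 - A^2] is a sum of congruences [B * C * B] of positive matrices, since [A]
    and [1 - A] commute. *)
Lemma psd_sqr_le1 A : psd A -> psd (1 - A) -> psd (1 - A * A).
Proof.
move=> pA pA1; have sA := pA.1; have s1A := pA1.1.
have -> : 1 - A * A = (1 - A) + ((1 - A) * A * (1 - A) + A * (1 - A) * A).
  have c : A * (1 - A) = (1 - A) * A by rewrite mulrBr mulrBl mulr1 mul1r.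
  by rewrite -c -mulrDr subrK mulr1 mulrBr mulr1 addrA subrK.
by apply: psdD => //; apply: psdD; exact: psd_congr.
Qed.

(** Polynomials in [A] with nonnegative coefficients. They commute and are
    positive with [A], and the increments of the iteration below are among
    them, which is why the iteration is monotone. *)
Inductive npoly A : 'M[R]_d -> Prop :=
| npoly_mono (c : R) i : 0 <= c -> npoly A (c *: A ^+ i)
| npoly_add Y Z : npoly A Y -> npoly A Z -> npoly A (Y + Z).

Lemma npolyM A Y Z : npoly A Y -> npoly A Z -> npoly A (Y * Z).
Proof.
move=> hY hZ; elim: hY => [c i c0|Y1 Y2 _ h1 _ h2]; last first.
  by rewrite mulrDl; exact: npoly_add.
elim: hZ => [e j e0|Z1 Z2 _ h1 _ h2]; last by rewrite mulrDr; exact: npoly_add.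
rewrite mxscaleAl mxscaleAr scalerA -exprD.
by apply: npoly_mono; exact: mulr_ge0.
Qed.

Lemma npolyZ A Y (c : R) : 0 <= c -> npoly A Y -> npoly A (c *: Y).
Proof.
move=> c0; elim => [e i e0|Y1 Y2 _ h1 _ h2]; last by rewrite scalerDr; exact: npoly_add.
by rewrite scalerA; apply: npoly_mono; exact: mulr_ge0.
Qed.

Lemma npoly_psd A Y : psd A -> npoly A Y -> psd Y.
Proof.
by move=> pA; elim => [c i c0|Y1 Y2 _ h1 _ h2]; [apply: psdZ => //; exact: psdX|exact: psdD].
Qed.

Lemma npoly_comm A Y Z : Z * A = A * Z -> npoly A Y -> Z * Y = Y * Z.
Proof.
move=> ZA; elim => [c i c0|Y1 Y2 _ h1 _ h2]; last by rewrite mulrDr mulrDl h1 h2.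
by rewrite mxscaleAl mxscaleAr; congr (_ *: _); exact: commrX.
Qed.

(** Visser's iteration: [1 - sqrt_iter A m] decreases to the positive square
    root of [1 - A], as suggested by the equation [(1 - Y)^2 = 1 - A]. It only
    uses sums and products, which makes the root a measurable function of
    the matrix. *)
Fixpoint sqrt_iter A m : 'M[R]_d :=
  if m is m'.+1 then 2^-1 *: (A + sqrt_iter A m' * sqrt_iter A m') else 0.

Lemma npoly_self A : npoly A A.
Proof. by rewrite -[X in npoly _ X]expr1 -[X in npoly _ X]scale1r; exact: npoly_mono. Qed.

Lemma npoly_sqrt_iter A m : npoly A (sqrt_iter A m).
Proof.
elim: m => [|m IH] /=.
  by rewrite -(scale0r (A ^+ 0)); exact: npoly_mono.
by apply: npolyZ => //; apply: npoly_add; [exact: npoly_self|exact: npolyM].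
Qed.

Lemma npoly_sqrt_iterB A m : npoly A (sqrt_iter A m.+1 - sqrt_iter A m).
Proof.
elim: m => [|m IH].
  by rewrite /= mul0r addr0 subr0; apply: npolyZ => //; exact: npoly_self.
set Y := sqrt_iter A m in IH; set Z := sqrt_iter A m.+1 in IH.
have c : Z * Y = Y * Z.
  apply: (npoly_comm (A := A)); last exact: npoly_sqrt_iter.
  by apply/esym/(npoly_comm (A := A)) => //; exact: npoly_sqrt_iter.
have -> : sqrt_iter A m.+2 - Z = 2^-1 *: ((Z - Y) * (Z + Y)).
  rewrite [sqrt_iter A m.+2]/= -/Z {2}/Z /= -/Y -scalerBr; congr (_ *: _).
  rewrite mulrDr !mulrBl c opprD addrACA subrr add0r.
  by rewrite addrA subrK.
apply: npolyZ => //; apply: npolyM => //.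
by apply: npoly_add; exact: npoly_sqrt_iter.
Qed.

Lemma sqrt_iter_le1 A m : psd A -> psd (1 - A) -> psd (1 - sqrt_iter A m).
Proof.
move=> pA p1A; elim: m => [|m IH]; first by rewrite /= subr0; exact: psd1.
have -> : 1 - sqrt_iter A m.+1 =
    2^-1 *: ((1 - A) + (1 - sqrt_iter A m * sqrt_iter A m)).
  rewrite /= addrACA -opprD scalerBr; congr (_ - _).
  by apply/matrixP => a b; rewrite !mxE; field.
apply: psdZ => //; apply: psdD => //.
by apply: psd_sqr_le1 => //; apply: (npoly_psd pA); exact: npoly_sqrt_iter.
Qed.

Definition mx_cvg (Y_ : nat -> 'M[R]_d) Y := forall i j, Y_ n i j @[n --> \oo] --> Y i j.

Lemma mx_cvgM (Y_ Z_ : nat -> 'M[R]_d) Y Z : mx_cvg Y_ Y -> mx_cvg Z_ Z ->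
  mx_cvg (fun n => Y_ n * Z_ n) (Y * Z).
Proof.
move=> hY hZ i j; rewrite -mulmxE mxE.
rewrite (_ : (fun n => (Y_ n * Z_ n) i j) = fun n => \sum_k Y_ n i k * Z_ n k j); last first.
  by apply/funext => n; rewrite -mulmxE mxE.
by apply: cvg_bigsum => k _; apply: cvgM; [exact: hY|exact: hZ].
Qed.

Lemma mx_cvg_qf (Y_ : nat -> 'M[R]_d) Y v : mx_cvg Y_ Y -> qf (Y_ n) v @[n --> \oo] --> qf Y v.
Proof.
move=> hY; rewrite /qf mxE; under eq_fun do rewrite mxE.
apply: cvg_bigsum => k _; apply: cvgM; last exact: cvg_cst.
rewrite mxE; under eq_fun do rewrite mxE.
by apply: cvg_bigsum => l _; apply: cvgM; [exact: cvg_cst|exact: hY].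
Qed.

Lemma mx_cvg_uniq (Y_ : nat -> 'M[R]_d) Y Z : mx_cvg Y_ Y -> mx_cvg Y_ Z -> Y = Z.
Proof. by move=> hY hZ; apply/matrixP => i j; exact: (cvg_unique _ (hY i j) (hZ i j)). Qed.

Lemma qf_delta A i : qf A (delta_mx i 0) = A i i.
Proof. by rewrite /qf trmx_delta -rowE -colE !mxE. Qed.

Lemma qf_deltaD A (i j : 'I_d) :
  qf A ((delta_mx i 0 : 'cV[R]_d) + (delta_mx j 0 : 'cV[R]_d)) =
  A i i + A i j + (A j i + A j j).
Proof.
have -> : qf A ((delta_mx i 0 : 'cV[R]_d) + (delta_mx j 0 : 'cV[R]_d)) =
    (((delta_mx 0 i : 'rV[R]_d) + (delta_mx 0 j : 'rV[R]_d)) *m A *m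
     ((delta_mx i 0 : 'cV[R]_d) + (delta_mx j 0 : 'cV[R]_d))) 0 0.
  rewrite /qf; congr ((_ *m _ *m _) 0 0).
  by apply/matrixP => a b; rewrite !mxE [in X in X + _]andbC [in X in _ + X]andbC.
by rewrite mulmxDl !mulmxDr !mulmxDl -!rowE -!colE !mxE addrACA.
Qed.

(** Quadratic forms of the iterates are monotone and bounded, and polarization
    recovers the entries. *)
Lemma sqrt_iter_cvg A : psd A -> psd (1 - A) ->
  exists Y, mx_cvg (sqrt_iter A) Y.
Proof.
move=> pA p1A.
have cq v : cvgn (fun n => qf (sqrt_iter A n) v).
  apply: nondecreasing_is_cvgn.
    apply/nondecreasing_seqP => n; rewrite -subr_ge0 -qfN -qfD.
    by have [_] := npoly_psd pA (npoly_sqrt_iterB A n); exact.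
  exists (qf 1 v) => _ [n _ <-]; rewrite -subr_ge0 -qfN -qfD.
  by have [_] := sqrt_iter_le1 n pA p1A; exact.
exists (\matrix_(i, j) limn (fun n => sqrt_iter A n i j)) => i j; rewrite mxE.
suff : cvgn (fun n => sqrt_iter A n i j) by [].
have -> : (fun n => sqrt_iter A n i j) = fun n => 2^-1 *
    (qf (sqrt_iter A n) (delta_mx i 0 + delta_mx j 0) -
     qf (sqrt_iter A n) (delta_mx i 0) - qf (sqrt_iter A n) (delta_mx j 0)).
  apply/funext => n; rewrite qf_deltaD !qf_delta.
  have [sY _] := npoly_psd pA (npoly_sqrt_iter A n).
  have -> : sqrt_iter A n j i = sqrt_iter A n i j by rewrite -{1}sY mxE.
  by field.
apply: is_cvgM; first exact: is_cvg_cst.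
by apply: is_cvgB => //; apply: is_cvgB.
Qed.

(** An upper bound for the quadratic form on the unit sphere, by which [Q] is
    divided to come below the identity. *)
Definition mx_scale Q : R := 1 + \sum_i \sum_j `|Q i j|.

Lemma mx_scale_gt0 Q : 0 < mx_scale Q.
Proof. by rewrite ltr_pwDl// sumr_ge0// => i _; rewrite sumr_ge0. Qed.

Lemma qf_le_scale Q v : qf Q v <= mx_scale Q * qf 1 v.
Proof.
pose N := qf 1 v; have vN i : v i 0 ^+ 2 <= N.
  by rewrite /N qf1 (bigD1 i)//= lerDl sumr_ge0// => k _; rewrite sqr_ge0.
have N0 : 0 <= N by rewrite /N qf1 sumr_ge0// => k _; rewrite sqr_ge0.
have vv i j : `|v i 0 * v j 0| <= N.
  rewrite normrM; have := vN i; have := vN j.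
  rewrite -(real_normK (num_real (v i 0))) -(real_normK (num_real (v j 0))).
  by have := sqr_ge0 (`|v i 0| - `|v j 0|); nra.
rewrite /mx_scale mulrDl mul1r -/N; apply: (@le_trans _ _ ((\sum_i \sum_j `|Q i j|) * N)); last first.
  by rewrite lerDr.
have -> : qf Q v = \sum_i \sum_j v i 0 * Q i j * v j 0.
  rewrite /qf mxE; under eq_bigr do rewrite mxE mulr_suml.
  rewrite exchange_big; apply: eq_bigr => i _; apply: eq_bigr => j _.
  by rewrite mxE.
rewrite mulr_suml; apply: ler_sum => i _; rewrite mulr_suml; apply: ler_sum => j _.
by rewrite mulrAC (le_trans (ler_norm _))// normrM mulrC ler_wpM2l.
Qed.

Definition sqrt_base Q : 'M[R]_d := 1 - (mx_scale Q)^-1 *: Q.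

Lemma sqrt_baseP Q : psd Q -> psd (sqrt_base Q) /\ psd (1 - sqrt_base Q).
Proof.
move=> pQ; have [sQ qQ] := pQ; have c0 := mx_scale_gt0 Q.
rewrite /sqrt_base; split; last first.
  by rewrite opprB addrC subrK; apply: psdZ => //; rewrite invr_ge0 ltW.
split; first by rewrite linearB linearZ/= trmx1 sQ.
move=> v; rewrite -/(qf _ _) qfD qfN qfZ subr_ge0 ler_pdivrMl//.
exact: qf_le_scale.
Qed.

Lemma sqrt_exists Q : psd Q -> exists S, [/\ psd S, S * S = Q,
  (forall Z, Z * Q = Q * Z -> Z * S = S * Z) &
  mx_cvg (fun n => Num.sqrt (mx_scale Q) *: (1 - sqrt_iter (sqrt_base Q) n)) S].
Proof.
move=> pQ; have [pA p1A] := sqrt_baseP pQ; have c0 := mx_scale_gt0 Q.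
set A := sqrt_base Q in pA p1A *; set c := mx_scale Q in c0 *.
have [Y hY] := sqrt_iter_cvg pA p1A.
have YE : Y = 2^-1 *: (A + Y * Y).
  apply: (mx_cvg_uniq (Y_ := fun n => sqrt_iter A n.+1)).
    by move=> i j; have := hY i j; rewrite -(cvg_shiftS (fun n => sqrt_iter A n i j)).
  move=> i j; have h : (sqrt_iter A n * sqrt_iter A n) i j @[n --> \oo] --> (Y * Y) i j.
    exact: mx_cvgM.
  rewrite [X in _ --> X](_ : _ = 2^-1 * (A i j + (Y * Y) i j)); last first.
    by rewrite mxE; congr (_ * _); rewrite mxE.
  rewrite (_ : (fun n => _) = fun n =>
    2^-1 * (A i j + (sqrt_iter A n * sqrt_iter A n) i j)); last first.
    by apply/funext => n; rewrite /= mxE; congr (_ * _); rewrite mxE.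
  by apply: cvgM; [exact: cvg_cst|apply: cvgD => //; exact: cvg_cst].
have YY : Y * Y = Y + Y - A.
  have -> : Y + Y = A + Y * Y.
    by rewrite [in LHS]YE -scalerDl (_ : 2^-1 + 2^-1 = 1) ?scale1r//; field.
  by rewrite addrC addKr.
have sq : (1 - Y) * (1 - Y) = 1 - A.
  rewrite mulrBl !mulrBr !mul1r !mulr1 YY.
  by apply/matrixP => i j; rewrite !mxE; ring.
have hS : mx_cvg (fun n => Num.sqrt c *: (1 - sqrt_iter A n)) (Num.sqrt c *: (1 - Y)).
  move=> i j; rewrite !mxE; under eq_fun do rewrite !mxE.
  by apply: cvgM; [exact: cvg_cst|apply: cvgB; [exact: cvg_cst|exact: hY]].
exists (Num.sqrt c *: (1 - Y)); split=> //.
- have pn n : psd (Num.sqrt c *: (1 - sqrt_iter A n)).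
    by apply: psdZ => //; exact: sqrt_iter_le1.
  split.
    apply/matrixP => i j; rewrite mxE; apply: (cvg_unique _ _ (hS i j)) => //.
    rewrite (_ : (fun n => _) = fun n => (Num.sqrt c *: (1 - sqrt_iter A n)) j i).
      exact: hS.
    by apply/funext => n; have [sn _] := pn n; rewrite -{1}sn mxE.
  move=> v; rewrite -/(qf _ _) -(cvg_lim _ (mx_cvg_qf (v := v) hS))//.
  apply: limr_ge; first by apply/cvg_ex; exists (qf (Num.sqrt c *: (1 - Y)) v); exact: mx_cvg_qf.
  by apply: nearW => n; have [_] := pn n; apply.
- rewrite mxscaleAl mxscaleAr scalerA -expr2 sqr_sqrtr ?ltW// sq /A /sqrt_base.
  by rewrite opprB addrC subrK scalerA divff ?gt_eqF// scale1r.
- move=> Z ZQ; have ZA : Z * A = A * Z.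
    by rewrite /A /sqrt_base mulrBr mulrBl mulr1 mul1r mxscaleAr mxscaleAl ZQ.
  rewrite mxscaleAr mxscaleAl; congr (_ *: _); rewrite mulrBr mulrBl mulr1 mul1r.
  congr (_ - _).
  apply: (mx_cvg_uniq (Y_ := fun n => Z * sqrt_iter A n)).
    by apply: mx_cvgM => // i j; exact: cvg_cst.
  have -> : (fun n => Z * sqrt_iter A n) = fun n => sqrt_iter A n * Z.
    by apply/funext => n; apply: (npoly_comm ZA); exact: npoly_sqrt_iter.
  by apply: mx_cvgM => // i j; exact: cvg_cst.
Qed.


Lemma qf_eq0 A v : psd A -> qf A v = 0 -> A *m v = 0.
Proof.
move=> pA; have [S [pS SS _ _]] := sqrt_exists pA; rewrite -SS qf_sqr ?pS.1// => h.
have Sv : S *m v = 0.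
  apply/matrixP => i j; rewrite ord1 [RHS]mxE; apply/eqP.
  rewrite -sqrf_eq0; apply/eqP; apply: (psumr_eq0P _ h) => // k _; exact: sqr_ge0.
by rewrite -mulmxE -mulmxA Sv mulmx0.
Qed.

(** [(S + Z) (S - Z) = 0], so both [S] and [Z] vanish on the range of [S - Z],
    and the square of [S - Z] is 0. *)
Lemma psd_root_uniq S Z : psd S -> psd Z -> S * S = Z * Z -> S * Z = Z * S -> S = Z.
Proof.
move=> pS pZ SSZZ cSZ; apply/eqP; rewrite -subr_eq0; apply/eqP.
have k v : (S - Z) *m v = 0.
  pose y := (S - Z) *m v.
  have SZy : (S + Z) *m y = 0.
    rewrite /y mulmxA [_ *m (S - Z)](_ : _ = 0) ?mul0mx// mulmxE.
    by rewrite mulrBr !mulrDl SSZZ cSZ [Z * Z + _]addrC subrr.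
  have : qf S y + qf Z y = 0 by rewrite -qfD /qf -mulmxA SZy mulmx0 mxE.
  move/eqP; rewrite paddr_eq0; [|exact: pS.2|exact: pZ.2].
  move=> /andP[/eqP/(qf_eq0 pS) Sy /eqP/(qf_eq0 pZ) Zy].
  have DT : (S - Z)^T = S - Z by rewrite linearB/= pS.1 pZ.1.
  have h : qf 1 y = 0.
    have := qf_sqr v DT; rewrite -/y -qf1 => <-.
    by rewrite /qf -mulmxE mulmxA -mulmxA -/y -mulmxA mulmxBl Sy Zy subr0 mulmx0 mxE.
  by have := qf_eq0 psd1 h; rewrite mul1mx.
apply/matrixP => i j; have := k (delta_mx j 0).
by rewrite -colE => /matrixP/(_ i 0); rewrite !mxE.
Qed.

(** The root built by iteration commutes with every matrix that commutes with
    [Q], in particular with any other root; hence it is the only one. *)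
Lemma psd_sqrtP Q : psd Q -> [/\ psd (psd_sqrt Q), psd_sqrt Q *m psd_sqrt Q = Q &
  mx_cvg (fun n => Num.sqrt (mx_scale Q) *: (1 - sqrt_iter (sqrt_base Q) n)) (psd_sqrt Q)].
Proof.
move=> pQ; have [S [pS SS cS hS]] := sqrt_exists pQ.
have [pZ ZZ] : psd (psd_sqrt Q) /\ psd_sqrt Q *m psd_sqrt Q = Q.
  by rewrite /psd_sqrt; case: xgetP => [Z _ []//|/(_ S)]; case; rewrite mulmxE.
split=> //; suff -> : psd_sqrt Q = S by [].
apply: psd_root_uniq => //; first by rewrite SS -mulmxE.
by apply: cS; move: ZZ; rewrite mulmxE; move: (psd_sqrt Q) => Z <-; rewrite mulrA.
Qed.

End positive_square_root.

Section measurable_square_root.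
Context {disp : measure_display} {T : measurableType disp} {R : realType}.
Variables (G : set (set T)) (sG : sigma_algebra setT G) (d : nat).

Lemma measurable_wrt_cvg (f_ : nat -> T -> R) (f : T -> R) :
  (forall n, measurable_wrt G (f_ n)) ->
  (forall x, f_ n x @[n --> \oo] --> f x) -> measurable_wrt G f.
Proof.
move=> mf ff; apply/measurable_wrtE => //.
apply: (@measurable_fun_cvg _ (g_sigma_algebraType G) R setT f_) => // n.
exact/measurable_wrtE.
Qed.

(** The square root is a pointwise limit of polynomials in the entries. *)
Lemma measurable_psd_sqrt (Q : T -> 'M[R]_d) : measurable_wrt_mx G Q ->
  (forall w, psd (Q w)) -> measurable_wrt_mx G (fun w => psd_sqrt (Q w)).
Proof.
move=> mQ pQ i j.
have mc : measurable_wrt G (fun w => mx_scale (Q w)).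
  apply: measurable_wrtD => //; first exact: measurable_wrt_cst.
  apply: measurable_wrt_sum => // k _; apply: measurable_wrt_sum => // l _.
  apply: (measurable_wrt_comp sG (k := Num.norm)) (mQ k l); exact: normr_measurable.
have mA : measurable_wrt_mx G (fun w => sqrt_base (Q w)).
  move=> k l; rewrite /sqrt_base; under eq_fun do rewrite !mxE.
  apply: measurable_wrtB => //; first exact: measurable_wrt_cst.
  apply: measurable_wrtM => //.
  have minv : measurable_fun setT (fun x : R => (Num.max 1 x)^-1).
    apply: continuous_measurable_fun => x; apply: cvgV.
      by rewrite gt_eqF// lt_max ltr01.
    by apply: (@continuous_max _ _ (cst 1) id); [exact: cst_continuous|exact: cvg_id].
  have -> : (fun w => (mx_scale (Q w))^-1) = fun w => (Num.max 1 (mx_scale (Q w)))^-1.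
    apply/funext => w; rewrite max_r// /mx_scale lerDl sumr_ge0// => a _.
    by rewrite sumr_ge0.
  exact: (measurable_wrt_comp sG minv).
have mY n : measurable_wrt_mx G (fun w => sqrt_iter (sqrt_base (Q w)) n).
  elim: n => [|n IH] k l /=.
    by under eq_fun do rewrite mxE; exact: measurable_wrt_cst.
  rewrite (_ : (fun w => _) = fun w => 2^-1 * (sqrt_base (Q w) k l +
    \sum_a sqrt_iter (sqrt_base (Q w)) n k a * sqrt_iter (sqrt_base (Q w)) n a l)); last first.
    by apply/funext => w; rewrite mxE; congr (_ * _); rewrite mxE; congr (_ + _); rewrite mxE.
  apply: measurable_wrtZ => //; apply: measurable_wrtD => //.
  apply: measurable_wrt_sum => // a _; apply: measurable_wrtM => //; exact: IH.
apply: (measurable_wrt_cvg (f_ := fun n w =>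
  (Num.sqrt (mx_scale (Q w)) *: (1 - sqrt_iter (sqrt_base (Q w)) n)) i j)).
  move=> n; under eq_fun do rewrite !mxE.
  apply: measurable_wrtM => //.
    apply: (measurable_wrt_comp sG (k := Num.sqrt)) mc.
    by apply: continuous_measurable_fun => x; exact: sqrt_continuous.
  apply: measurable_wrtB => //; first exact: measurable_wrt_cst.
  exact: mY.
by move=> w; have [_ _ +] := psd_sqrtP (pQ w); apply.
Qed.

End measurable_square_root.

(** * Gaussian mixtures *)

Section finite_valued.
Context {disp : measure_display} {T : measurableType disp} {R : realType}.

Lemma finite_valued_approx (G : set (set T)) (B : T -> R) : sub_sigma_field G ->
  measurable_wrt G B ->
  exists g : nat -> T -> R,
    [/\ (forall m, measurable_wrt G (g m)),
        (forall m, exists r : seq R, forall x, g m x \in r) &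
        (forall x, g m x @[m --> \oo] --> B x)].
Proof.
move=> hG mB; have sG := hG.1.
have m0 : measurable_wrt G (cst 0 : T -> R) by exact: measurable_wrt_cst.
have mp : measurable_wrt G (fun x => Num.max (B x) 0) by exact: measurable_wrt_max.
have mn : measurable_wrt G (fun x => Num.max (- B x) 0).
  apply: measurable_wrt_max => //.
  by apply: (measurable_wrt_comp sG (k := -%R)) => //; exact: oppr_measurable.
have max0 (y : R) : 0 <= Num.max y 0 by rewrite le_max lexx orbT.
have [g [gr _ _ gB]] := simple_approx hG mp (fun x => max0 _).
have [h [hr _ _ hB]] := simple_approx hG mn (fun x => max0 _).
have mf (f : nat -> T -> R) : (forall m, exists (r : seq R) (A : R -> set T),
    (forall y, G (A y)) /\
    forall x, f m x \in r /\ f m x = \sum_(y <- r) y * \1_(A y) x) ->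
    forall m, measurable_wrt G (f m).
  move=> H m; have [r [A [GA E]]] := H m.
  rewrite (_ : f m = fun x => \sum_(y <- r) y * \1_(A y) x); last first.
    by apply/funext => x; exact: (E x).2.
  apply: measurable_wrt_sum => // y _; apply: measurable_wrtZ => //.
  exact: measurable_wrt_indic.
exists (fun m x => g m x - h m x); split=> [m|m|x].
- by apply: measurable_wrtB => //; exact: mf.
- have [r [A [_ E]]] := gr m; have [r' [A' [_ E']]] := hr m.
  exists [seq y - z | y <- r, z <- r'] => x.
  by apply: allpairs_f; [exact: (E x).1|exact: (E' x).1].
- rewrite (_ : B x = Num.max (B x) 0 - Num.max (- B x) 0); first exact: cvgB.
  by have [] := leP (B x) 0 => Bx; have [] := leP (- B x) 0 => Bx'; lra.
Qed.

End finite_valued.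

Section gaussian_mixture.
Context {disp : measure_display} {T : measurableType disp} {R : realType}.
Variable P : probability T R.
Implicit Types (f g h W phi : T -> R) (G H : set (set T)).
Local Notation Ex := (Rintegral P setT).
Local Notation integ := (integ P).
Local Notation N := (normal_prob (0 : R) 1).

(** From events to functions, one factor at a time. *)
Lemma Ex_indep G H f g : sub_sigma_field G -> sub_sigma_field H ->
  indep_fields P G H -> measurable_wrt G f -> bdd f -> measurable_wrt H g -> bdd g ->
  Ex (fun x => f x * g x) = Ex f * Ex g.
Proof.
move=> hG hH ind mf bf mg bg.
have mf' := measurable_wrt_fun hG.2 mf; have mg' := measurable_wrt_fun hH.2 mg.
have ig : integ g by exact: integ_bdd.
have iF : integ f by exact: integ_bdd.
have ifg : integ (fun x => f x * g x) by exact: integM_bdd.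
have ifc : integ (fun x => f x * (g x - Ex g)).
  by apply: integM_bdd => //; apply: integB => //; exact: integ_cst.
have h1 A : G A -> Ex (fun x => \1_A x * (g x - Ex g)) = 0.
  move=> GA; have mA := hG.2 _ GA; pose c := fine (P A).
  have iA : integ (\1_A : T -> R) by exact: integ_indic.
  have iAg : integ (fun x => \1_A x * g x) by exact: integM_indic.
  have : Ex (fun x => g x * (\1_A x - c)) = 0.
    apply: (Ex_mul0 hH) => //.
    - by apply: integB => //; exact: integ_cst.
    - move=> B HB; have mB := hH.2 _ HB.
      have iB : integ (\1_B : T -> R) by exact: integ_indic.
      rewrite (_ : (fun x => _) = fun x => \1_(A `&` B) x - c * \1_B x); last first.
        by apply/funext => x; rewrite indicI /=; ring.
      rewrite ExB; [|by apply: integ_indic; exact: measurableI|exact: integZ].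
      rewrite ExZ// !Ex_indic//; last exact: measurableI.
      by rewrite (ind A B GA HB) fineM ?fin_num_measure// subrr.
    - by apply: integM_bdd => //; apply: integB => //; exact: integ_cst.
  rewrite (_ : (fun x => _) = fun x => \1_A x * g x - c * g x); last first.
    by apply/funext => x; ring.
  rewrite ExB//; last exact: integZ.
  rewrite ExZ// => /eqP; rewrite subr_eq0 => /eqP E.
  rewrite (_ : (fun x => _) = fun x => \1_A x * g x - Ex g * \1_A x); last first.
    by apply/funext => x; ring.
  by rewrite ExB//; [rewrite E ExZ// Ex_indic// mulrC subrr|exact: integZ].
have := Ex_mul0 hG (integB ig (integ_cst P (Ex g))) h1 mf ifc.
rewrite (_ : (fun x => _) = fun x => f x * g x - Ex g * f x); last first.
  by apply/funext => x; rewrite mulrBr [f x * Ex g]mulrC.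
rewrite ExB//; last exact: integZ.
by rewrite ExZ// => /eqP; rewrite subr_eq0 => /eqP ->; rewrite mulrC.
Qed.

Variables (d : nat) (Z : T -> 'cV[R]_d).
Hypothesis hZ : standard_gaussian P Z.

Let mZ i : measurable_fun setT (fun w => Z w i 0).
Proof.
by move=> _ B mB; rewrite setTI; apply: (hZ.1 i 0); exists B => //; rewrite setTI.
Qed.

Let Zlaw i (B : set R) : measurable B -> P [set w | B (Z w i 0)] = N B.
Proof.
move=> mB; pose Bs j := if j == i then B else setT.
have := hZ.2 Bs; rewrite (_ : [set w | _] = [set w | B (Z w i 0)]); last first.
  apply/seteqP; split=> w /=; first by move/(_ i); rewrite /Bs eqxx.
  by move=> h j; rewrite /Bs; case: eqP => // ->.
move=> ->; last by move=> j; rewrite /Bs; case: ifP.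
rewrite (bigD1 i)//= {1}/Bs eqxx big1 ?mule1// => j ji.
by rewrite /Bs (negbTE ji) probability_setT.
Qed.

Let Ex_coord i (f : R -> R) : measurable_fun setT f -> bdd f ->
  Ex (fun w => f (Z w i 0)) = \int[N]_z f z.
Proof.
move=> mf bf; rewrite /Rintegral; congr fine.
pose Zi (w : T) : measurableTypeR R := Z w i 0.
have mZi : measurable_fun setT Zi by exact: mZ.
have iN : N.-integrable setT (EFin \o f) by exact: (integ_bdd N mf bf).
transitivity (\int[pushforward P Zi]_z (f z)%:E)%E.
  rewrite integral_pushforward//.
  - exact/measurable_EFinP.
  - rewrite preimage_setT; apply: (integ_bdd P (f := fun w => f (Zi w))).
      exact: measurableT_comp mf (mZ i).
    by have [M fM] := bf; exists M => w; exact: fM.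
have E := @eq_measure_integral _ (measurableTypeR R) R setT N (measure_function_pushforward__canonical__measure_function_Measure P mZi).
apply: E => A mA _; exact: Zlaw.
Qed.

Let bddc (f : R -> R) i : bdd f -> bdd (fun w => f (Z w i 0)).
Proof. by move=> [M fM]; exists M => w. Qed.

Let mbprod (p : pred 'I_d) (g : 'I_d -> R -> R) :
  (forall i, measurable_fun setT (g i)) -> (forall i, bdd (g i)) ->
  measurable_fun setT (fun w => \prod_(i | p i) g i (Z w i 0)) /\
  bdd (fun w => \prod_(i | p i) g i (Z w i 0)).
Proof.
move=> mg bg; elim: (index_enum _) => [|i r [IHm IHb]].
  under eq_fun do rewrite big_nil.
  by split; [exact: measurable_cst|exact: bdd_cst].
under eq_fun do rewrite big_cons.
case: (boolP (p i)) => // _; split; last by apply: bddM => //; exact: bddc.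
by apply: measurable_funM => //; exact: measurableT_comp (mg i) (mZ i).
Qed.

Let updE (A : Type) (a : 'I_d -> A) i b j : j != i -> (if j == i then b else a j) = a j.
Proof. by move/negbTE => ->. Qed.

(** Coordinates are freed one at a time from indicators to bounded functions. *)
Let Ex_prod_coords (r : seq 'I_d) (g : 'I_d -> R -> R) :
  (forall i, measurable_fun setT (g i)) -> (forall i, bdd (g i)) ->
  (forall i, i \notin r -> exists2 B, measurable B & g i = \1_B) ->
  Ex (fun w => \prod_i g i (Z w i 0)) = \prod_i \int[N]_z g i z.
Proof.
elim: r g => [|i r IH] g mg bg ind.
  have [B mB gB] : exists2 B : 'I_d -> set R, (forall i, measurable (B i)) &
      forall i, g i = \1_(B i).
    have /choice[B hB] : forall i, exists B, measurable B /\ g i = \1_B.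
      by move=> i; have [//|B mB gB] := ind i; exists B.
    by exists B => i; have [] := hB i.
  rewrite (_ : (fun w => _) = \1_[set w | forall i, B i (Z w i 0)]); last first.
    apply/funext => w; rewrite indicE; case: (boolP (w \in _)) => [|/negP h].
      rewrite inE/= => h; rewrite big1// => i _.
      by rewrite gB indicE mem_set//; exact: h.
    have [i ni] : exists i, ~ B i (Z w i 0).
      by apply/existsNP => h'; apply: h; rewrite inE.
    by rewrite (bigD1 i)//= gB indicE memNset// mul0r.
  rewrite Ex_indic; last first.
    rewrite (_ : [set w | _] = \bigcap_(i in [set: 'I_d]) [set w | B i (Z w i 0)]); last first.
      by apply/seteqP; split=> [w h i _|w h i]; [exact: h|exact: (h i I)].
    apply: fin_bigcap_measurable => // i _.
    by have := mZ i measurableT (mB i); rewrite setTI.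
  rewrite hZ.2// (eq_bigr (fun i => (\int[N]_z g i z)%:E)); last first.
    by move=> i _; rewrite gB (Ex_indic N (mB i)) fineK//; apply: fin_num_measure; exact: mB.
  by rewrite prodEFin.
pose h w := \prod_(j | j != i) g j (Z w j 0).
pose C := \prod_(j | j != i) \int[N]_z g j z.
have [mh bh] : measurable_fun setT h /\ bdd h by exact: mbprod.
have ih : integ h by exact: integ_bdd.
pose G := preimage_set_system setT (fun w => Z w i 0) measurable.
have hG : sub_sigma_field G.
  split; first by apply: sigma_algebra_preimage; exact: sigma_algebra_measurable.
  by move=> _ [B mB <-]; exact: mZ.
have mGg : measurable_wrt G (fun w => g i (Z w i 0)).
  move=> _ [B mB <-]; exists (g i @^-1` B); last by [].
  by have := mg i measurableT B mB; rewrite setTI.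
have ihC : integ (fun w => h w - C) by apply: integB => //; exact: integ_cst.
have h0 A : G A -> Ex (fun w => \1_A w * (h w - C)) = 0.
  move=> [B mB <-]; rewrite setTI; set A' := _ @^-1` B.
  have mA' : measurable A' by have := mZ i measurableT mB; rewrite setTI.
  have := IH (fun j => if j == i then \1_B else g j).
  rewrite (bigD1 i)//= eqxx (Ex_indic N mB) (eq_bigr (fun j => \int[N]_z g j z)); last first.
    by move=> j ji; rewrite updE.
  rewrite -/C (_ : (fun w => _) = fun w => \1_A' w * h w); last first.
    apply/funext => w; rewrite (bigD1 i)//= eqxx; congr (_ * _).
    by apply: eq_bigr => j ji; rewrite updE.
  move=> E; rewrite (_ : (fun w => _) = fun w => \1_A' w * h w - C * \1_A' w); last first.
    by apply/funext => w; ring.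
  rewrite ExB; [|exact: integM_indic|by apply: integZ; exact: integ_indic].
  rewrite E; last 3 first.
  - by move=> j; case: ifP.
  - by move=> j; case: ifP => // _; exact: bdd_indic.
  - move=> j jr; have [ji|ji] := eqVneq j i; first by exists B.
    by apply: ind; rewrite inE negb_or ji.
  rewrite ExZ; last exact: integ_indic.
  by rewrite Ex_indic// Zlaw// mulrC subrr.
have ig : integ (fun w => g i (Z w i 0)).
  by apply: integ_bdd; [exact: (measurable_wrt_fun hG.2 mGg)|exact: bddc].
have ighC : integ (fun w => g i (Z w i 0) * (h w - C)).
  by apply: integM_bdd => //; [exact: (measurable_wrt_fun hG.2 mGg)|exact: bddc].
have := Ex_mul0 hG ihC h0 mGg ighC.
rewrite (_ : (fun w => _) = fun w => \prod_i g i (Z w i 0) - C * g i (Z w i 0)); last first.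
  by apply/funext => w; rewrite (bigD1 i)//= -/(h w); ring.
rewrite ExB; last 2 first.
- by have [] := mbprod xpredT mg bg; exact: integ_bdd.
- exact: integZ.
rewrite ExZ// Ex_coord// => /eqP; rewrite subr_eq0 => /eqP ->.
by rewrite [RHS](bigD1 i)//= -/C mulrC.
Qed.

Let mcosl c (theta : R) : measurable_fun setT (fun z : R => cos (c * z + theta)).
Proof.
apply: (measurableT_comp (f := cos)).
  by apply: continuous_measurable_fun; exact: continuous_cos.
by apply: measurable_funD => //; exact: mulrl_measurable.
Qed.

Let sin_cos (x : R) : sin x = cos (x - pi / 2).
Proof. by rewrite cosB cos_pihalf sin_pihalf mulr0 add0r mulr1. Qed.

Let bcos {dX} {X : measurableType dX} (f : X -> R) : bdd (fun x => cos (f x)).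
Proof. by exists 1 => x; exact: cos_max. Qed.

(** The addition formula splits off one coordinate; the coordinates outside
    [r] carry arbitrary factors so that the split factor can join them. *)
Let Ex_cos_coords (r : seq 'I_d) (c : 'I_d -> R) (theta : R) (g : 'I_d -> R -> R) :
  uniq r -> (forall i, measurable_fun setT (g i)) -> (forall i, bdd (g i)) ->
  Ex (fun w => cos (\sum_(i <- r) c i * Z w i 0 + theta) *
       \prod_(i | i \notin r) g i (Z w i 0)) =
  expR (- ((\sum_(i <- r) c i ^+ 2) / 2)) * cos theta *
    \prod_(i | i \notin r) \int[N]_z g i z.
Proof.
elim: r theta g => [|i r IH] theta g.
  move=> _ mg bg; under eq_fun do rewrite big_nil add0r.
  rewrite ExZ; last by have [] := mbprod (fun i => i \notin [::]) mg bg; exact: integ_bdd.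
  rewrite big_nil mul0r oppr0 expR0 mul1r; congr (_ * _).
  by rewrite (Ex_prod_coords (r := enum 'I_d))// => j; rewrite mem_enum.
move=> /andP[ir ur] mg bg.
pose h w := \prod_(j | j \notin i :: r) g j (Z w j 0).
have spl (A : comRingType) (f : 'I_d -> A) (b : A) : \prod_(j | j \notin r) (if j == i then b else f j) =
    b * \prod_(j | j \notin i :: r) f j.
  rewrite (bigD1 i)//= eqxx; congr (_ * _); apply: eq_big => j.
    by rewrite inE negb_or andbC.
  by move=> /andP[_ ji]; rewrite updE.
have step th t2 : Ex (fun w => cos (\sum_(j <- r) c j * Z w j 0 + th) * (cos (c i * Z w i 0 + t2) * h w))
   = expR (- ((\sum_(j <- r) c j ^+ 2) / 2)) * cos th *
     (expR (- (c i ^+ 2 / 2)) * cos t2 * \prod_(j | j \notin i :: r) \int[N]_z g j z).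
  have := IH th (fun j => if j == i then (fun z => cos (c i * z + t2)) else g j) ur.
  rewrite [X in _ = _ * X](eq_bigr (fun j => if j == i then expR (- (c i ^+ 2 / 2)) * cos t2 else \int[N]_z g j z)); last first.
    by move=> j _; case: ifP => // _; rewrite gaussian_cos.
  rewrite spl => <-; [|by move=> j; case: ifP|by move=> j; case: ifP => // _; exact: bcos].
  apply: eq_Rintegral => w _; congr (_ * _); rewrite -spl; apply: eq_bigr => j _.
  by case: eqP => // ->.
have ii th t2 : integ (fun w => cos (\sum_(j <- r) c j * Z w j 0 + th) * (cos (c i * Z w i 0 + t2) * h w)).
  have [mh bh] : measurable_fun setT h /\ bdd h by exact: mbprod.
  apply: integM_bdd; last first.
  - apply: integM_bdd; last exact: integ_bdd.
    + exact: measurableT_comp (mcosl (c i) t2) (mZ i).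
    + exact: bcos.
  - exact: bcos.
  apply: (measurableT_comp (f := cos)).
    by apply: continuous_measurable_fun; exact: continuous_cos.
  apply: measurable_funD => //; apply: measurable_sum => j.
  by apply: measurable_funM => //; exact: mZ.
rewrite (_ : (fun w => _) = fun w =>
  cos (\sum_(j <- r) c j * Z w j 0 + theta) * (cos (c i * Z w i 0 + 0) * h w) -
  cos (\sum_(j <- r) c j * Z w j 0 + (theta - pi / 2)) * (cos (c i * Z w i 0 + - (pi / 2)) * h w)); last first.
  apply/funext => w; rewrite -/(h w) big_cons addr0 addrA -!sin_cos -addrA cosD; ring.
rewrite ExB// !step cosN cos_pihalf cos0 big_cons mulr0 mul0r mulr0 subr0 mulr1.
by rewrite mulrDl opprD expRD; ring.
Qed.

Lemma Ex_cos_gaussian (c : 'I_d -> R) (theta : R) :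
  Ex (fun w => cos (\sum_i c i * Z w i 0 + theta)) =
  expR (- ((\sum_i c i ^+ 2) / 2)) * cos theta.
Proof.
have := @Ex_cos_coords (index_enum 'I_d) c theta (fun _ _ => 1) (index_enum_uniq _) _ _.
rewrite [X in _ * X]big_pred0; last by move=> i; rewrite mem_index_enum.
rewrite mulr1 => <-; last 2 first.
- by move=> i; exact: measurable_cst.
- by move=> i; exact: bdd_cst.
apply: eq_Rintegral => w _; rewrite [X in _ = _ * X]big_pred0 ?mulr1// => i.
by rewrite mem_index_enum.
Qed.


Let Zc (a : 'I_d -> T -> R) w := \sum_i a i w * Z w i 0.

Let sigma_vecP : sub_sigma_field (sigma_vec Z).
Proof.
split; first exact: smallest_sigma_algebra.
apply: smallest_sub; first exact: sigma_algebra_measurable.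
by move=> _ [i _ [B mB <-]]; exact: mZ.
Qed.

Let mcosf (H : set (set T)) f : sigma_algebra setT H -> measurable_wrt H f ->
  measurable_wrt H (fun w => cos (f w)).
Proof.
move=> sH mf; apply: (measurable_wrt_comp sH (k := cos)) mf.
by apply: continuous_measurable_fun; exact: continuous_cos.
Qed.

Variable G : set (set T).
Hypothesis hG : sub_sigma_field G.
Hypothesis ind : indep_fields P (sigma_vec Z) G.

Let damp (a : 'I_d -> T -> R) w := expR (- ((\sum_i a i w ^+ 2) / 2)).

Let damp_le1 a w : 0 <= damp a w <= 1.
Proof.
rewrite /damp expR_ge0/= -expR0 ler_expR oppr_le0 divr_ge0// sumr_ge0// => i _.
exact: sqr_ge0.
Qed.

Let mcosZ a phi : (forall i, measurable_wrt G (a i)) -> measurable_wrt G phi ->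
  measurable_fun setT (fun w => cos (Zc a w + phi w)).
Proof.
move=> ma mphi; apply: (measurableT_comp (f := cos)).
  by apply: continuous_measurable_fun; exact: continuous_cos.
apply: measurable_funD; last exact: (measurable_wrt_fun hG.2 mphi).
apply: measurable_sum => i; apply: measurable_funM => //.
exact: (measurable_wrt_fun hG.2 (ma i)).
Qed.

Let mdamp a phi : (forall i, measurable_wrt G (a i)) -> measurable_wrt G phi ->
  measurable_wrt G (fun w => damp a w * cos (phi w)).
Proof.
move=> ma mphi; have sG := hG.1.
apply: measurable_wrtM => //; last exact: mcosf.
apply: (measurable_wrt_comp sG (k := fun x => expR (- (x / 2)))).
  apply: (measurableT_comp (f := expR)); first exact: measurable_expR.
  by apply: measurable_funN; exact: mulrr_measurable.
apply: measurable_wrt_sum => // i _; under eq_fun do rewrite expr2.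
exact: measurable_wrtM.
Qed.

Let bdamp a phi w : `|damp a w * cos (phi w)| <= 1.
Proof.
have /andP[d0 d1] := damp_le1 a w.
by rewrite normrM ger0_norm// mulr_ile1// cos_max.
Qed.

(** Given [G], the coefficients are constants; they are made random one at a
    time, through approximations with finitely many values. *)
Let Ex_cos_freeze (r : seq 'I_d) (a : 'I_d -> T -> R) W phi :
  (forall i, measurable_wrt G (a i)) -> (forall i, i \notin r -> exists c, a i = cst c) ->
  measurable_wrt G W -> bdd W -> measurable_wrt G phi ->
  Ex (fun w => W w * cos (Zc a w + phi w)) =
  Ex (fun w => W w * (damp a w * cos (phi w))).
Proof.
have sG := hG.1.
elim: r a W => [|i r IH] a W ma ca mW bW mphi.
  have [c ac] : exists c : 'I_d -> R, forall i, a i = cst (c i).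
    have /choice[c hc] : forall i, exists c, a i = cst c by move=> i; exact: ca.
    by exists c.
  pose S theta w := \sum_i c i * Z w i 0 + theta.
  have mS theta : measurable_wrt (sigma_vec Z) (fun w => cos (S theta w)).
    apply: mcosf; first exact: sigma_vecP.1.
    apply: measurable_wrtD; [exact: sigma_vecP.1| |exact: measurable_wrt_cst sigma_vecP.1 _].
    apply: measurable_wrt_sum => [|j _]; first exact: sigma_vecP.1.
    apply: measurable_wrtZ; first exact: sigma_vecP.1.
    by move=> B hB; apply: sub_sigma_algebra; exists j.
  have bcosS (f : T -> R) : bdd (fun w => cos (f w)) by exact: bcos.
  have mWc (th : R) : measurable_wrt G (fun w => W w * cos (phi w + th)).
    apply: measurable_wrtM => //; apply: mcosf => //.
    by apply: measurable_wrtD => //; exact: measurable_wrt_cst.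
  have step (th t2 : R) : Ex (fun w => cos (S th w) * (W w * cos (phi w + t2))) =
      expR (- ((\sum_i c i ^+ 2) / 2)) * cos th * Ex (fun w => W w * cos (phi w + t2)).
    rewrite (Ex_indep sigma_vecP hG ind)//; last exact: bddM.
    by rewrite /S Ex_cos_gaussian.
  have ii (th t2 : R) : integ (fun w => cos (S th w) * (W w * cos (phi w + t2))).
    apply: integM_bdd => //; first exact: (measurable_wrt_fun sigma_vecP.2 (mS th)).
    by apply: integ_bdd; [exact: (measurable_wrt_fun hG.2 (mWc t2))|exact: bddM].
  rewrite (_ : (fun w => W w * _) = fun w => cos (S 0 w) * (W w * cos (phi w + 0)) -
    cos (S (- (pi / 2)) w) * (W w * cos (phi w - pi / 2))); last first.
    apply/funext => w; rewrite /S -!sin_cos !addr0 cosD /Zc.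
    under eq_bigr do rewrite ac; rewrite /cst; ring.
  rewrite ExB// !step cosN cos_pihalf cos0 mulr0 mul0r subr0 mulr1.
  rewrite -ExZ; last by apply: integ_bdd; [exact: (measurable_wrt_fun hG.2 (mWc 0))|exact: bddM].
  apply: eq_Rintegral => w _; rewrite /damp; under [in RHS]eq_bigr do rewrite ac.
  by rewrite /cst addr0 mulrCA.
have [g [mg gr gB]] := finite_valued_approx hG (ma i).
pose upd (b : T -> R) j := if j == i then b else a j.
have mupd b : measurable_wrt G b -> forall j, measurable_wrt G (upd b j).
  by move=> mb j; rewrite /upd; case: ifP.
have fin m : Ex (fun w => W w * cos (Zc (upd (g m)) w + phi w)) =
    Ex (fun w => W w * (damp (upd (g m)) w * cos (phi w))).
  have [rm hr] := gr m.
  pose ind_ y := \1_(g m @^-1` [set y]) : T -> R.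
  have mind y : measurable_wrt G (ind_ y).
    by apply: measurable_wrt_indic => //; apply: (mg m); exists [set y] => //; rewrite setTI.
  have part (h : (T -> R) -> T -> R) : (forall b b' w, b w = b' w -> h b w = h b' w) ->
      (fun w => W w * h (g m) w) = fun w => \sum_(y <- undup rm) (W w * ind_ y w) * h (cst y) w.
    move=> hh; apply/funext => w; rewrite (bigD1_seq (g m w)) ?mem_undup ?undup_uniq//=.
    rewrite big1 => [|y yg]; last first.
      by rewrite /ind_ indicE memNset ?mulr0 ?mul0r// => /= e; rewrite e eqxx in yg.
    by rewrite addr0 /ind_ indicE mem_set// mulr1; congr (_ * _); exact: hh.
  have updw b b' w : b w = b' w -> forall j, upd b j w = upd b' j w.
    by move=> e j; rewrite /upd; case: ifP.
  have mc (y : R) : measurable_wrt G (cst y : T -> R) by exact: measurable_wrt_cst.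
  rewrite (part (fun b w => cos (Zc (upd b) w + phi w))); last first.
    by move=> b b' w e; rewrite /Zc; under eq_bigr do rewrite (updw _ _ _ e).
  rewrite (part (fun b w => damp (upd b) w * cos (phi w))); last first.
    by move=> b b' w e; rewrite /damp; under eq_bigr do rewrite (updw _ _ _ e).
  have bWi y : bdd (fun w => W w * ind_ y w) by apply: bddM => //; exact: bdd_indic.
  have mWi y : measurable_wrt G (fun w => W w * ind_ y w) by exact: measurable_wrtM.
  have iWi y : integ (fun w => W w * ind_ y w).
    by apply: integ_bdd => //; exact: (measurable_wrt_fun hG.2).
  rewrite Ex_sum => [|y _]; last first.
    under eq_fun do rewrite mulrC.
    by apply: integM_bdd => //; apply: mcosZ => //; exact: mupd.
  rewrite Ex_sum => [|y _]; last first.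
    under eq_fun do rewrite mulrC.
    apply: integM_bdd => //; first exact: (measurable_wrt_fun hG.2 (mdamp (mupd _ (mc y)) mphi)).
    by exists 1 => w; exact: bdamp.
  apply: eq_bigr => y _; apply: IH => //; first exact: mupd.
  move=> j jr; rewrite /upd; case: eqP => [_|/eqP ji]; first by exists y.
  by apply: ca; rewrite inE negb_or ji.
have [M WM] := bW; have mW' := measurable_wrt_fun hG.2 mW.
have cupd j w : upd (g m) j w @[m --> \oo] --> a j w.
  by rewrite /upd; case: eqP => [->|_]; [exact: gB|exact: cvg_cst].
have le1 (x y : R) w : `|y| <= 1 -> `|W w * y| <= M.
  by move=> y1; rewrite normrM (le_trans _ (WM w))// ler_piMr.
have [|||| _ c1] := @Ex_dom _ _ _ P (fun m w => W w * cos (Zc (upd (g m)) w + phi w))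
   (fun w => W w * cos (Zc a w + phi w)) (cst M).
- by move=> m; apply: measurable_funM => //; apply: mcosZ => //; exact: mupd.
- exact: integ_cst.
- move=> w; apply: cvgM; first exact: cvg_cst.
  apply: continuous_cvg; first exact: continuous_cos.
  apply: cvgD; last exact: cvg_cst.
  by apply: cvg_bigsum => j _; apply: cvgM => //; exact: cvg_cst.
- by move=> m w; apply: le1 => //; exact: cos_max.
have [|||| _ c2] := @Ex_dom _ _ _ P (fun m w => W w * (damp (upd (g m)) w * cos (phi w)))
   (fun w => W w * (damp a w * cos (phi w))) (cst M).
- move=> m; apply: measurable_funM => //.
  by apply: (measurable_wrt_fun hG.2); apply: mdamp => //; exact: mupd.
- exact: integ_cst.
- move=> w; apply: cvgM; first exact: cvg_cst.
  apply: cvgM; last exact: cvg_cst.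
  apply: continuous_cvg; first exact: continuous_expR.
  apply: cvgN; apply: cvgM; last exact: cvg_cst.
  apply: cvg_bigsum => j _; rewrite expr2; under eq_fun do rewrite expr2.
  exact: cvgM.
- by move=> m w; apply: le1 => //; exact: bdamp.
rewrite (_ : (fun n => _) = fun n => Ex (fun w => W w * (damp (upd (g n)) w * cos (phi w)))) in c1.
  exact: (cvg_unique _ c1 c2).
exact/funext.
Qed.

(** Conditionally on [G], the variable [sum_i a i * Z i] is Gaussian with
    variance [sum_i a i ^+ 2]. *)
Lemma Ex_cos_mixture (a : 'I_d -> T -> R) phi :
  (forall i, measurable_wrt G (a i)) -> measurable_wrt G phi ->
  Ex (fun w => cos (\sum_i a i w * Z w i 0 + phi w)) =
  Ex (fun w => expR (- ((\sum_i a i w ^+ 2) / 2)) * cos (phi w)).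
Proof.
move=> ma mphi.
have := @Ex_cos_freeze (enum 'I_d) a (cst 1) phi ma _ _ _ mphi.
move=> E; transitivity (Ex (fun w => cst 1 w * cos (Zc a w + phi w))).
  by apply: eq_Rintegral => w _; rewrite mul1r.
rewrite E; first by apply: eq_Rintegral => w _; rewrite mul1r.
- by move=> i; rewrite mem_enum.
- exact: measurable_wrt_cst hG.1 _.
- exact: bdd_cst.
Qed.

End gaussian_mixture.

(** * Trigonometric approximation on boxes *)

Section trigonometric_approximation.
Context {R : realType} (m : nat).
Local Notation S := 'rV[R]_m.
Implicit Types (c : 'I_m -> R) (theta : R) (x y : S) (f g t h : S -> R).

Definition phase c x := \sum_i c i * x 0 i.

Inductive trig_poly : (S -> R) -> Prop :=
| trig_cos c theta : trig_poly (fun x => cos (phase c x + theta))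
| trig_add f g : trig_poly f -> trig_poly g -> trig_poly (fun x => f x + g x)
| trig_scale a f : trig_poly f -> trig_poly (fun x => a * f x).

Lemma trig_cst (a : R) : trig_poly (cst a).
Proof.
rewrite (_ : cst a = fun x => a * cos (phase (fun=> 0) x + 0)).
  by apply: trig_scale; exact: trig_cos.
apply/funext => x; rewrite /phase big1 => [|i _]; last by rewrite mul0r.
by rewrite addr0 cos0 mulr1.
Qed.

Lemma trig_mul f g : trig_poly f -> trig_poly g -> trig_poly (fun x => f x * g x).
Proof.
move=> tf tg; elim: tf => [c theta|f1 f2 _ h1 _ h2|a f1 _ h1].
- elim: tg => [c' theta'|g1 g2 _ h1 _ h2|a g1 _ h1].
  + rewrite (_ : (fun x => _) = fun x =>
      2^-1 * (cos (phase (fun i => c i + c' i) x + (theta + theta')) +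
              cos (phase (fun i => c i - c' i) x + (theta - theta')))).
      by apply: trig_scale; apply: trig_add; exact: trig_cos.
    apply/funext => x.
    have -> : phase (fun i => c i + c' i) x = phase c x + phase c' x.
      by rewrite /phase -big_split; apply: eq_bigr => i _; rewrite mulrDl.
    have -> : phase (fun i => c i - c' i) x = phase c x - phase c' x.
      by rewrite /phase -sumrB; apply: eq_bigr => i _; rewrite mulrBl.
    set a := phase c x; set b := phase c' x.
    rewrite (_ : a + b + (theta + theta') = (a + theta) + (b + theta')); last by ring.
    rewrite (_ : a - b + (theta - theta') = (a + theta) - (b + theta')); last by ring.
    by move: (a + theta) (b + theta') => u v; rewrite cosB cosD; field.
  + rewrite (_ : (fun x => _) = fun x => cos (phase c x + theta) * g1 x +
       cos (phase c x + theta) * g2 x); first exact: trig_add.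
    by apply/funext => x; rewrite mulrDr.
  + rewrite (_ : (fun x => _) = fun x => a * (cos (phase c x + theta) * g1 x)).
      exact: trig_scale.
    by apply/funext => x; rewrite mulrCA.
- rewrite (_ : (fun x => _) = fun x => f1 x * g x + f2 x * g x); first exact: trig_add.
  by apply/funext => x; rewrite mulrDl.
- rewrite (_ : (fun x => _) = fun x => a * (f1 x * g x)); first exact: trig_scale.
  by apply/funext => x; rewrite mulrA.
Qed.

Lemma trig_bounded f : trig_poly f -> exists2 M : R, 0 < M & forall x, `|f x| <= M.
Proof.
elim=> [c theta|f1 f2 _ [M1 p1 h1] _ [M2 p2 h2]|a f1 _ [M1 p1 h1]].
- by exists 1 => // x; exact: cos_max.
- exists (M1 + M2) => [|x]; first exact: addr_gt0.
  by rewrite (le_trans (ler_normD _ _))// lerD.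
- exists (`|a| * M1 + 1) => [|x]; first by rewrite ltr_wpDl// mulr_ge0// ltW.
  by rewrite normrM; apply: (@le_trans _ _ (`|a| * M1)); rewrite ?ler_wpM2l// lerDl.
Qed.

Lemma trig_continuous f : trig_poly f -> continuous f.
Proof.
elim=> [c theta|f1 f2 _ h1 _ h2|a f1 _ h1] x.
- have cp : phase c z @[z --> x] --> phase c x; last first.
    apply: (continuous_comp (f := fun x0 => phase c x0 + theta) (g := cos)).
      exact: cvgD cp (cvg_cst _).
    exact: continuous_cos.
  apply: (@cvg_bigsum R S (nbhs x) _ _ _ _ (fun i z => c i * z 0 i) (fun i => c i * x 0 i)).
  by move=> i _; apply: cvgM; [exact: cvg_cst|exact: coord_continuous].
- exact: (cvgD (h1 x) (h2 x)).
- exact: (cvgM (cvg_cst a) (h1 x)).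
Qed.

(** Polynomials without constant term converging to the absolute value,
    uniformly on [-1, 1]. *)
Fixpoint abs_poly n (x : R) : R :=
  if n is n'.+1 then abs_poly n' x + 2^-1 * (x * x + - 1 * (abs_poly n' x * abs_poly n' x)) else 0.

Lemma abs_polyP n (x : R) : `|x| <= 1 ->
  [/\ 0 <= abs_poly n x, abs_poly n x <= `|x| & (`|x| - abs_poly n x) * n.+1%:R <= 2].
Proof.
move=> x1; have x0 := normr_ge0 x.
elim: n => [|n [p0 px pn]] /=; first by rewrite subr0 mulr1; split=> //; lra.
set p := abs_poly n x in p0 px pn *.
have xx : x * x = `|x| * `|x| by rewrite -normrM ger0_norm// -expr2 sqr_ge0.
rewrite xx; set a := `|x| in x1 x0 px pn *.
split; [nra|nra|].
have e0 : 0 <= a - p by rewrite subr_ge0.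
rewrite -[n.+2]addn1 natrD; set k : R := n.+1%:R in pn *.
set e := a - p in pn e0.
have -> : a - (p + 2^-1 * (a * a + -1 * (p * p))) = e * (1 - a + e / 2).
  by rewrite /e; field.
have ea : e <= a by rewrite /e lerBlDr lerDl.
apply: (@le_trans _ _ (e * (1 - e / 2) * (k + 1))).
  rewrite ler_wpM2r ?addr_ge0 ?ler0n// ler_wpM2l//; lra.
have -> : e * (1 - e / 2) * (k + 1) = (e * k + e) * (1 - e / 2) by ring.
nra.
Qed.

Lemma trig_abs_poly n t : trig_poly t -> trig_poly (fun x => abs_poly n (t x)).
Proof.
move=> tt; elim: n => [|n IH] /=; first exact: trig_cst.
apply: trig_add => //; apply: trig_scale; apply: trig_add; first exact: trig_mul.
by apply: trig_scale; exact: trig_mul.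
Qed.

Definition trig_limit f := forall eps : R, 0 < eps ->
  exists2 t, trig_poly t & forall x, `|f x - t x| <= eps.

Lemma trig_limit_poly t : trig_poly t -> trig_limit t.
Proof. by move=> tt eps e0; exists t => // x; rewrite subrr normr0 ltW. Qed.

Lemma trig_limitD f g : trig_limit f -> trig_limit g -> trig_limit (fun x => f x + g x).
Proof.
move=> hf hg eps e0; have e2 : 0 < eps / 2 by rewrite divr_gt0.
have [t1 tt1 h1] := hf _ e2; have [t2 tt2 h2] := hg _ e2.
exists (fun x => t1 x + t2 x); first exact: trig_add.
move=> x; rewrite opprD addrACA (le_trans (ler_normD _ _))//.
by rewrite [leRHS]splitr lerD.
Qed.

Lemma trig_limitZ a f : trig_limit f -> trig_limit (fun x => a * f x).
Proof.
move=> hf eps e0; have a0 : 0 < `|a| + 1 by rewrite ltr_wpDl.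
have [t tt ht] := hf _ (divr_gt0 e0 a0).
exists (fun x => a * t x); first exact: trig_scale.
move=> x; rewrite -mulrBr normrM.
apply: (@le_trans _ _ ((`|a| + 1) * (eps / (`|a| + 1)))).
  by apply: ler_pM => //; rewrite lerDl.
by rewrite mulrC divfK// gt_eqF.
Qed.

Lemma trig_limit_abs f : trig_limit f -> trig_limit (fun x => `|f x|).
Proof.
move=> hf eps e0; have e2 : 0 < eps / 2 by rewrite divr_gt0.
have [t tt ht] := hf _ e2; have [M M0 tM] := trig_bounded tt.
have [n] : exists n : nat, 4 * M / eps <= n.+1%:R.
  exists (Num.truncn (4 * M / eps)); apply: ltW; apply: truncnS_gt.
rewrite ler_pdivrMr// => hn.
exists (fun x => M * abs_poly n (M^-1 * t x)).
  by apply: trig_scale; apply: trig_abs_poly; exact: trig_scale.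
move=> x; have s1 : `|M^-1 * t x| <= 1.
  by rewrite normrM gtr0_norm ?invr_gt0// ler_pdivrMl// mulr1.
have [p0 ps pn] := abs_polyP n s1.
rewrite [leRHS]splitr.
rewrite (_ : _ - _ = (`|f x| - `|t x|) + (`|t x| - M * abs_poly n (M^-1 * t x))); last by ring.
rewrite (le_trans (ler_normD _ _))// lerD//.
  by rewrite (le_trans (ler_dist_dist _ _)).
have -> : `|t x| = M * `|M^-1 * t x|.
  by rewrite normrM gtr0_norm ?invr_gt0// mulrA divff ?gt_eqF// mul1r.
rewrite -mulrBr normrM gtr0_norm// ger0_norm ?subr_ge0//.
rewrite -(ler_pM2r (_ : 0 < n.+1%:R :> R))// -mulrA.
apply: (@le_trans _ _ (M * 2)); first by rewrite ler_wpM2l// ltW.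
lra.
Qed.

(** As in the lattice form of the Stone-Weierstrass theorem, closure under
    absolute values gives closure under maxima and minima. *)
Lemma trig_limit_max f g : trig_limit f -> trig_limit g ->
  trig_limit (fun x => Num.max (f x) (g x)).
Proof.
move=> hf hg.
rewrite (_ : (fun x => _) = fun x => 2^-1 * ((f x + g x) + `|f x + - 1 * g x|)).
  apply: trig_limitZ; apply: trig_limitD; first exact: trig_limitD.
  by apply: trig_limit_abs; apply: trig_limitD => //; exact: trig_limitZ.
apply/funext => x; rewrite mulN1r.
have [fg|fg] := leP (f x) (g x).
  by rewrite ler0_norm ?subr_le0//; field.
by rewrite gtr0_norm ?subr_gt0//; field.
Qed.

Lemma trig_limit_min f g : trig_limit f -> trig_limit g ->
  trig_limit (fun x => Num.min (f x) (g x)).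
Proof.
move=> hf hg.
rewrite (_ : (fun x => _) = fun x => - 1 * Num.max (- 1 * f x) (- 1 * g x)).
  by apply: trig_limitZ; apply: trig_limit_max; exact: trig_limitZ.
by apply/funext => x; rewrite !mulN1r -oppr_min opprK.
Qed.

Definition box (A : R) : set S := [set x | forall i, `|x 0 i| <= A].

Lemma box_compact A : compact (box A).
Proof.
rewrite (_ : box A = [set v : S | forall i, `[- A, A]%classic (v ord0 i)]).
  by apply: (@rV_compact R m (fun=> `[- A, A]%classic)) => i; exact: segment_compact.
by apply/seteqP; split=> x h i; have := h i; rewrite /= in_itv/= ler_norml.
Qed.

Lemma cos_quadratic (z : R) : `|z| <= 4^-1 -> z ^+ 2 / 4 <= 1 - cos z.
Proof.
move=> z4; have := cos_taylor2 0 z; rewrite add0r cos0 sin0 mulr0 subr0 mulr1.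
rewrite -(real_normK (num_real z)) ler_norml => /andP[_].
have := normr_ge0 z; set a := `|z| in z4 * => a0 h.
have : a * a * a <= 4^-1 * (a * a) by rewrite mulrC ler_wpM2r ?mulr_ge0.
by rewrite expr2 in h *; lra.
Qed.

(** A substitute for the squared distance to [y]: on the box it only vanishes
    at [y]. *)
Definition trig_dist (L : R) y x := \sum_i (1 - cos ((x 0 i - y 0 i) / L)).

Lemma trig_distP L y : trig_poly (trig_dist L y).
Proof.
rewrite /trig_dist; elim: (index_enum _) => [|i r IH].
  rewrite (_ : (fun x => _) = cst 0); first exact: trig_cst.
  by apply/funext => x; rewrite big_nil.
rewrite (_ : (fun x => _) = fun x => (1 + - 1 * cos (phase (fun j => (j == i)%:R / L) x +
    - (y 0 i / L))) + \sum_(j <- r) (1 - cos ((x 0 j - y 0 j) / L))).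
  apply: trig_add => //; apply: trig_add; first exact: trig_cst.
  by apply: trig_scale; exact: trig_cos.
apply/funext => x; rewrite big_cons mulN1r; congr (1 - cos _ + _).
rewrite /phase (bigD1 i)//= eqxx big1 ?addr0 => [|j /negbTE ->]; last by rewrite !mul0r.
by rewrite mul1r mulrBl mulrC.
Qed.

Lemma trig_dist0 L y : trig_dist L y y = 0.
Proof. by rewrite /trig_dist big1// => i _; rewrite subrr mul0r cos0 subrr. Qed.

Lemma trig_dist_ge0 L y x : 0 <= trig_dist L y x.
Proof. by rewrite sumr_ge0// => i _; rewrite subr_ge0 cos_le1. Qed.

(** Near [y] continuity suffices; away from [y] a large multiple of [trig_dist]
    exceeds the oscillation [2 * M] of [h]. *)
Lemma trig_majorant h (M A eps : R) y : continuous h -> (forall x, `|h x| <= M) ->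
  0 < eps -> 0 < A -> box A y ->
  exists b, [/\ trig_poly b, b y < h y + eps & forall x, box A x -> h x <= b x].
Proof.
move=> ch hM e0 A0 yA; pose L := 8 * A; have L0 : 0 < L by rewrite mulr_gt0.
have M0 : 0 <= M by apply: le_trans (hM y).
have e2 : 0 < eps / 2 by rewrite divr_gt0.
have /nbhs_ballP[r /= r0 hr] : nbhs y [set x | h x < h y + eps / 2].
  by apply: (cvgr_lt _ (ch y)); rewrite ltrDl.
pose N := 2 * M / (r ^+ 2 / (4 * L ^+ 2)).
have q0 : 0 < r ^+ 2 / (4 * L ^+ 2) by rewrite divr_gt0 ?mulr_gt0 ?exprn_gt0.
have N0 : 0 <= N by apply: divr_ge0; [exact: mulr_ge0|exact: ltW].
exists (fun x => (h y + eps / 2) + N * trig_dist L y x); split.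
- by apply: trig_add; [exact: trig_cst|apply: trig_scale; exact: trig_distP].
- by rewrite trig_dist0 mulr0 addr0 ltrD2l ltr_pdivrMr// ltr_pMr// ltr1n.
move=> x xA; have [near_y|/existsNP[i /negP]] :=
  pselect (forall i, `|y 0 i - x 0 i| < r).
  have : ball y r x.
    by split=> // i j; rewrite ord1; exact: near_y.
  move/hr => /= hx; apply: (le_trans (ltW hx)); rewrite lerDl mulr_ge0//.
  exact: trig_dist_ge0.
rewrite -leNgt => ri.
have d : r ^+ 2 / (4 * L ^+ 2) <= trig_dist L y x.
  rewrite /trig_dist (bigD1 i)//= ler_wpDr//.
    by rewrite sumr_ge0// => j _; rewrite subr_ge0 cos_le1.
  apply: le_trans (cos_quadratic _); last first.
    rewrite normrM normfV (gtr0_norm L0) ler_pdivrMr// /L.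
    apply: (le_trans (ler_normB _ _)); have := xA i; have := yA i; lra.
  have -> : r ^+ 2 / (4 * L ^+ 2) = r ^+ 2 / L ^+ 2 / 4.
    by rewrite invfM mulrA mulrAC.
  rewrite ler_wpM2r// expr_div_n ler_wpM2r ?invr_ge0 ?exprn_ge0 ?(ltW L0)//.
  rewrite -(real_normK (num_real (x 0 i - y 0 i))) distrC lerXn2r// nnegrE//.
  exact: ltW.
have : 2 * M <= N * trig_dist L y x.
  rewrite -[leLHS](@divfK _ (r ^+ 2 / (4 * L ^+ 2))) ?gt_eqF//.
  by rewrite ler_wpM2l.
have := hM x; have := hM y; rewrite !ler_norml => /andP[? ?] /andP[? ?]; lra.
Qed.

(** Finitely many majorants cover the compact box, and their minimum is close
    to [h] there; clipping it at [M] gives the global bound. *)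
Lemma trig_approx_box h (M A eps : R) : continuous h -> (forall x, `|h x| <= M) ->
  0 < eps -> 0 < A ->
  exists2 t, trig_poly t & (forall x, box A x -> `|h x - t x| <= eps) /\
    (forall x, `|t x| <= M + eps).
Proof.
move=> ch hM e0 A0; have e2 : 0 < eps / 2 by rewrite divr_gt0.
have M0 : 0 <= M by apply: le_trans (hM 0).
have /choice[b hb] : forall y, exists b, box A y ->
    [/\ trig_poly b, b y < h y + eps / 2 & forall x, box A x -> h x <= b x].
  move=> y; have [yA|nyA] := pselect (box A y); last by exists (cst 0).
  by have [b ?] := trig_majorant ch hM e2 A0 yA; exists b.
pose V y := [set x | b y x < h x + eps / 2].
have oV y : box A y -> open (V y).
  move=> /hb[tb _ _]; rewrite (_ : V y = (fun x => b y x - h x) @^-1` [set z | z < eps / 2]).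
    apply: open_comp; last exact: open_lt.
    have cb : continuous (b y) by exact: trig_continuous.
    by move=> x _; exact: (cvgB (cb x) (ch x)).
  by apply/seteqP; split=> x /=; rewrite /V /= ltrBlDl.
have := @box_compact A; rewrite compact_cover => /(_ S (box A) V oV)[|D DA cov].
  by move=> y yA; exists y => //; have [_ ? _] := hb _ yA.
have [g [tg hg gb]] : exists g, [/\ trig_limit g, (forall x, box A x -> h x <= g x) &
    forall y, y \in finmap.enum_fset D -> forall x, g x <= b y x].
  have : forall y, y \in finmap.enum_fset D -> box A y by move=> y yD; have := DA y yD; rewrite inE.
  move: (finmap.enum_fset D) => s0; elim: s0 => [_|y s IH hs].
    exists (cst M); split=> //; first exact/trig_limit_poly/trig_cst.
    by move=> x _; rewrite (le_trans (ler_norm _)).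
  have [|g [tg hg gs]] := IH; first by move=> z zs; apply: hs; rewrite inE zs orbT.
  have [tb _ hby] := hb y (hs y (mem_head _ _)).
  exists (fun x => Num.min (b y x) (g x)); split.
  - by apply: trig_limit_min => //; exact: trig_limit_poly.
  - by move=> x xA; rewrite le_min hby//= hg.
  - move=> z; rewrite inE => /predU1P[-> x|zs x]; first by rewrite ge_min lexx.
    by rewrite ge_min gs// orbT.
pose k x := Num.min (Num.max (g x) (- M)) M.
have tk : trig_limit k.
  apply: trig_limit_min; last exact/trig_limit_poly/trig_cst.
  by apply: trig_limit_max => //; exact/trig_limit_poly/trig_cst.
have [t tt ht] := tk _ e2; exists t => //; split=> x.
  move=> xA; have h1 := hg x xA; have [y yD Vyx] := cov x xA.
  have h2 := gb y yD x; rewrite /V /= in Vyx.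
  have hk : `|h x - k x| <= eps / 2.
    have := hM x; rewrite ler_norml => /andP[m1 m2].
    have kx : k x = Num.min (g x) M by rewrite /k max_l//; lra.
    rewrite kx ler_norml; have [gM|gM] := leP (g x) M; apply/andP; split; lra.
  rewrite (_ : h x - t x = (h x - k x) + (k x - t x)); last by ring.
  by rewrite (le_trans (ler_normD _ _))// [leRHS]splitr lerD.
have kM : `|k x| <= M.
  by rewrite ler_norml /k ge_min lexx orbT andbT le_min le_max lexx orbT/=; lra.
rewrite (_ : t x = k x - (k x - t x)); last by ring.
rewrite (le_trans (ler_normB _ _))// lerD//.
by rewrite (le_trans (ht x))// ler_pdivrMr// ler_peMr ?ler1n// ltW.
Qed.

End trigonometric_approximation.

(** * Trigonometric functions determine convergence in distribution *)

Section determining_class.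
Context {R : realType} (m : nat).
Local Notation S := 'rV[R]_m.

Section one_space.
Context {disp : measure_display} {T : measurableType disp}.
Variables (P : probability T R) (Y : T -> S).
Hypothesis mY : forall i, measurable_fun setT (fun w => Y w 0 i).
Local Notation Ex := (Rintegral P setT).

Lemma measurable_trig t : trig_poly t -> measurable_fun setT (fun w => t (Y w)).
Proof.
elim=> [c theta|f g _ hf _ hg|a f _ hf].
- apply: (measurableT_comp (f := cos)).
    by apply: continuous_measurable_fun; exact: continuous_cos.
  apply: measurable_funD => //; apply: measurable_sum => i.
  exact: measurable_funM.
- exact: measurable_funD.
- exact: measurable_funM.
Qed.

Lemma integ_trig t : trig_poly t -> integ P (fun w => t (Y w)).
Proof.
move=> tt; apply: integ_bdd; first exact: measurable_trig.
by have [M _ hM] := trig_bounded tt; exists M => w; exact: hM.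
Qed.

(** Continuous functions of random vectors are pointwise limits of
    trigonometric polynomials; this avoids comparing the Borel sets of a
    product with the products of Borel sets. *)
Lemma measurable_continuous_bounded (h : S -> R) (M : R) : continuous h ->
  (forall x, `|h x| <= M) -> measurable_fun setT (fun w => h (Y w)).
Proof.
move=> ch hM.
have /choice[t ht] : forall n, exists t, trig_poly t /\
    forall x, box n.+1%:R x -> `|h x - t x| <= n.+1%:R^-1.
  move=> n; have i0 : 0 < n.+1%:R^-1 :> R by rewrite invr_gt0.
  have [t tt [hb _]] := trig_approx_box ch hM i0 (ltr0Sn _ n).
  by exists t.
apply: (@measurable_fun_cvg _ _ _ setT (fun n w => t n (Y w))) => //.
  by move=> n; apply: measurable_trig; exact: (ht n).1.
move=> w _; apply/cvgrPdist_le => eps e0; near=> n.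
apply: le_trans ((ht n).2 _ _) _.
  move=> i; apply: (@le_trans _ _ (\sum_j `|Y w 0 j|)).
    by rewrite (bigD1 i)//= lerDl sumr_ge0.
  apply: (@le_trans _ _ n%:R); last by rewrite ler_nat.
  near: n; exact: nbhs_infty_ger.
rewrite -[leRHS]invrK lef_pV2 ?posrE ?invr_gt0//.
apply: (@le_trans _ _ n%:R); last by rewrite ler_nat.
near: n; exact: nbhs_infty_ger.
Unshelve. all: by end_near. Qed.

Lemma prob_tail (i : 'I_m) (delta : R) : 0 < delta -> exists2 A : R, 0 < A &
  (P [set w | (A <= `|Y w 0 i|)%R] <= delta%:E)%E.
Proof.
move=> d0; pose E n := [set w | (n.+1%:R <= `|Y w 0 i|)%R].
have mE n : measurable (E n) by exact: measurable_abs_ge.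
have [||||_ c] := @Ex_dom _ _ _ P (fun n => \1_(E n)) (cst 0) (cst 1).
- by move=> n; exact: measurable_indic.
- exact: integ_cst.
- move=> x; apply: cvg_near_cst; near=> n; rewrite indicE memNset// /E/=.
  apply/negP; rewrite -ltNge; apply: (@lt_le_trans _ _ n.+1%:R) => //.
  apply: (@le_lt_trans _ _ n%:R); last by rewrite ltr_nat.
  near: n; exact: nbhs_infty_ger.
- by move=> n x; rewrite indicE ger0_norm ?boolr_le1.
rewrite Ex_cst in c; move/near0P: c => /(_ _ d0)[n _ /(_ n (leqnn n)) h].
exists n.+1%:R => //; rewrite -(fineK (fin_num_measure P _ (mE n))) lee_fin.
by rewrite -Ex_indic// (le_trans (ler_norm _)).
Unshelve. all: by end_near. Qed.

(** A function is replaced by its trigonometric approximation on a box, up to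
    the mass outside. *)
Lemma Ex_trig_approx (h t : S -> R) (M eps delta : R) (A : 'I_m -> R) (B : R) :
  measurable_fun setT (fun w => h (Y w)) -> trig_poly t -> (forall x, `|h x| <= M) ->
  (forall x, box B x -> `|h x - t x| <= eps) -> (forall x, `|t x| <= M + eps) ->
  0 < eps <= 1 -> (forall i, A i <= B) ->
  (forall i, (P [set w | (A i <= `|Y w 0 i|)%R] <= delta%:E)%E) ->
  `|Ex (fun w => h (Y w)) - Ex (fun w => t (Y w))| <= eps + (2 * M + 1) * (m%:R * delta).
Proof.
move=> mh tt hM ht tM /andP[e0 e1] AB hA.
have it := integ_trig tt.
have ih : integ P (fun w => h (Y w)) by apply: integ_bdd => //; exists M => w.
pose E i := [set w | (A i <= `|Y w 0 i|)%R].
have mE i : measurable (E i) by exact: measurable_abs_ge.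
pose b w := eps + (2 * M + 1) * \sum_i \1_(E i) w.
have iE : integ P (fun w => \sum_i \1_(E i) w).
  by apply: integ_sum => i _; exact: integ_indic.
have ib : integ P b.
  by apply: integD; [exact: integ_cst|exact: integZ].
have M0 : 0 <= M.
  by apply: le_trans (hM 0).
rewrite -ExB//; apply: (@le_trans _ _ (Ex b)).
  apply: Ex_abs_le => //; first exact: integB.
  move=> w; rewrite /b; have [hb|/existsNP[i /negP]] := pselect (box B (Y w)).
    rewrite (le_trans (ht _ hb))// lerDl mulr_ge0 ?addr_ge0 ?mulr_ge0//.
    by apply: sumr_ge0 => i _; rewrite indicE.
  rewrite -ltNge => Bi; have wE : w \in E i by rewrite inE /E/= (le_trans (AB i))// ltW.
  rewrite (bigD1 i)//= indicE wE mulrDr mulr1.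
  rewrite (le_trans (ler_normB _ _))//.
  have h0 : 0 <= (2 * M + 1) * \sum_(j | j != i) (\1_(E j) w : R).
    by rewrite mulr_ge0 ?addr_ge0 ?mulr_ge0// sumr_ge0// => j _; rewrite indicE.
  have := hM (Y w); have := tM (Y w); lra.
rewrite /b ExD ?Ex_cst; [|exact: integ_cst|exact: integZ].
rewrite lerD2l ExZ// ler_wpM2l ?addr_ge0 ?mulr_ge0//.
rewrite Ex_sum => [|i _]; last exact: integ_indic.
rewrite (_ : m%:R * delta = \sum_(i < m) delta); last first.
  by rewrite mulr_natl sumr_const card_ord.
apply: ler_sum => i _; rewrite Ex_indic//.
rewrite -lee_fin fineK; [exact: hA|exact: fin_num_measure].
Qed.

End one_space.

Context {disp : measure_display} {T : measurableType disp}.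
Context {disp' : measure_display} {T' : measurableType disp'}.
Variables (P : probability T R) (P' : probability T' R).
Variables (Y_ : nat -> T -> S) (Y : T' -> S).
Hypothesis mY_ : forall n, (1 <= n)%N -> forall i, measurable_fun setT (fun w => Y_ n w 0 i).
Hypothesis mY : forall i, measurable_fun setT (fun w => Y w 0 i).
Hypothesis tight : forall i (delta : R), 0 < delta -> exists2 A : R, 0 < A &
  \forall n \near \oo, (P [set w | (A <= `|Y_ n w 0 i|)%R] <= delta%:E)%E.
Hypothesis cf : forall (c : 'I_m -> R) (theta : R),
  Rintegral P setT (fun w => cos (phase c (Y_ n w) + theta)) @[n --> \oo] -->
  Rintegral P' setT (fun w => cos (phase c (Y w) + theta)).

(** By tightness all laws live on a common box up to a small mass, and on it
    [h] is uniformly close to a trigonometric polynomial. *)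
Lemma trig_determining (h : S -> R) : continuous h ->
  (exists M : R, forall x, `|h x| <= M) ->
  ('E_P[h \o Y_ n] @[n --> \oo] --> 'E_P'[h \o Y])%E.
Proof.
move=> ch [M hM].
have M0 : 0 <= M by apply: le_trans (hM 0).
have mh' : measurable_fun setT (fun w => h (Y w)) by exact: measurable_continuous_bounded hM.
have mh n : (1 <= n)%N -> measurable_fun setT (fun w => h (Y_ n w)).
  by move=> n1; apply: measurable_continuous_bounded hM => //; exact: mY_.
have ct t : trig_poly t -> Rintegral P setT (fun w => t (Y_ n w)) @[n --> \oo] -->
    Rintegral P' setT (fun w => t (Y w)).
  elim=> [c theta|f g tf hf tg hg|a f tf hf]; first exact: cf.
  - rewrite ExD; [|exact: integ_trig|exact: integ_trig].
    apply: (cvg_trans _ (cvgD hf hg)); apply: near_eq_cvg; near=> n.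
    have n1 : (1 <= n)%N by near: n; exact: nbhs_infty_gt.
    by rewrite /= ExD//; apply: integ_trig => //; exact: mY_.
  - rewrite ExZ; last exact: integ_trig.
    apply: (cvg_trans _ (cvgM (cvg_cst a) hf)); apply: near_eq_cvg; near=> n.
    have n1 : (1 <= n)%N by near: n; exact: nbhs_infty_gt.
    by rewrite /= ExZ//; apply: integ_trig => //; exact: mY_.
rewrite unlock /= [X in _ --> X]Ex_EFin; last first.
  by apply: integ_bdd => //; exists M => w.
suff : Rintegral P setT (fun w => h (Y_ n w)) @[n --> \oo] --> Rintegral P' setT (fun w => h (Y w)).
  move=> c; apply: cvg_EFin => //; near=> n.
  have n1 : (1 <= n)%N by near: n; exact: nbhs_infty_gt.
  rewrite /= Ex_EFin//; apply: integ_bdd; first exact: mh.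
  by exists M => w.
apply/cvgrPdist_le => eps0 e0.
pose eps := Num.min 1 (eps0 / 8).
have e : 0 < eps by rewrite lt_min ltr01 divr_gt0.
have e8 : eps <= eps0 / 8 by rewrite ge_min lexx orbT.
have e1 : 0 < eps <= 1 by rewrite e ge_min lexx.
pose D := (2 * M + 1) * (m%:R + 1).
have D0 : 0 < D by rewrite mulr_gt0 ?ltr_wpDl ?mulr_ge0.
pose delta := eps / D; have d0 : 0 < delta by rewrite divr_gt0.
have dD : (2 * M + 1) * (m%:R * delta) <= eps.
  rewrite mulrA /delta mulrCA ler_piMr ?(ltW e)// ler_pdivrMr// mul1r.
  by rewrite ler_wpM2l ?lerDl// addr_ge0 ?mulr_ge0.
have /choice[A hA] : forall i, exists A : R, 0 < A /\
  \forall n \near \oo, (P [set w | (A <= `|Y_ n w 0 i|)%R] <= delta%:E)%E.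
  by move=> i; have [A A0 h1] := tight i d0; exists A.
have /choice[A' hA'] : forall i, exists A : R, 0 < A /\
  (P' [set w | (A <= `|Y w 0 i|)%R] <= delta%:E)%E.
  by move=> i; have [A0 A1 h1] := prob_tail P' mY i d0; exists A0.
pose B := 1 + \sum_i A i + \sum_i A' i.
have sA (C : 'I_m -> R) i : (forall j, 0 < C j) -> C i <= \sum_j C j.
  by move=> C0; rewrite (bigD1 i)//= lerDl sumr_ge0// => j _; exact: ltW.
have s0 (C : 'I_m -> R) : (forall j, 0 < C j) -> 0 <= \sum_j C j.
  by move=> C0; rewrite sumr_ge0// => j _; exact: ltW.
have A0 i : 0 < A i := (hA i).1.
have A'0 i : 0 < A' i := (hA' i).1.
have B0 : 0 < B by rewrite /B; have := s0 A A0; have := s0 A' A'0; lra.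
have AB i : A i <= B by rewrite /B; have := sA A i A0; have := s0 A' A'0; lra.
have A'B i : A' i <= B by rewrite /B; have := sA A' i A'0; have := s0 A A0; lra.
have [t tt [ht tM]] := trig_approx_box ch hM e B0.
have h' := Ex_trig_approx mY mh' tt hM ht tM e1 A'B (fun i => (hA' i).2).
have /cvgrPdist_le/(_ _ e) ce := ct t tt.
have hall : \forall n \near \oo, forall i, (P [set w | (A i <= `|Y_ n w 0 i|)%R] <= delta%:E)%E.
  have : \forall n \near \oo, forall i, i \in enum 'I_m ->
      (P [set w | (A i <= `|Y_ n w 0 i|)%R] <= delta%:E)%E.
    elim: (enum 'I_m) => [|i r IH]; first exact: nearW.
    near=> n => j; rewrite inE => /predU1P[->|jr]; first by near: n; exact: (hA i).2.
    by move: j jr; near: n.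
  by apply: filterS => n h1 i; apply: h1; rewrite mem_enum.
near=> n.
have n1 : (1 <= n)%N by near: n; exact: nbhs_infty_gt.
have hn : forall i, (P [set w | (A i <= `|Y_ n w 0 i|)%R] <= delta%:E)%E by near: n.
have hc : `|Rintegral P' setT (fun w => t (Y w)) - Rintegral P setT (fun w => t (Y_ n w))| <= eps.
  by near: n.
have h1 := Ex_trig_approx (mY_ n1) (mh n n1) tt hM ht tM e1 AB hn.
move: h' h1 hc; set a := Rintegral P' _ (fun w => h _); set b := Rintegral P _ (fun w => h _).
set c := Rintegral P' _ _; set d := Rintegral P _ _.
rewrite !ler_norml => /andP[? ?] /andP[? ?] /andP[? ?]; apply/andP; split; lra.
Unshelve. all: by end_near. Qed.

End determining_class.

(** * Projections of a lag martingale row *)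

Section euclidean_norm.
Context {R : realType} (d : nat).
Implicit Types (a b : 'cV[R]_d).

Lemma enorm_ge0 a : 0 <= enorm a. Proof. exact: sqrtr_ge0. Qed.

Lemma coord_le_enorm a i : `|a i 0| <= enorm a.
Proof.
rewrite -sqrtr_sqr; apply: ler_wsqrtr.
by rewrite (bigD1 i)//= lerDl sumr_ge0// => j _; rewrite sqr_ge0.
Qed.

Lemma cauchy_schwarz_sum (f g : 'I_d -> R) :
  (\sum_i f i * g i) ^+ 2 <= (\sum_i f i ^+ 2) * (\sum_i g i ^+ 2).
Proof.
have h : 0 <= \sum_i \sum_j (f i * g j - f j * g i) ^+ 2.
  by rewrite sumr_ge0// => i _; rewrite sumr_ge0// => j _; rewrite sqr_ge0.
have e : \sum_i \sum_j (f i * g j - f j * g i) ^+ 2 =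
    2 * ((\sum_i f i ^+ 2) * (\sum_i g i ^+ 2) - (\sum_i f i * g i) ^+ 2).
  have s2 (u v : 'I_d -> R) : (\sum_i u i) * (\sum_j v j) = \sum_i \sum_j u i * v j.
    by rewrite mulr_suml; apply: eq_bigr => i _; rewrite mulr_sumr.
  transitivity (\sum_i \sum_j (f i ^+ 2 * g j ^+ 2) + \sum_i \sum_j (g i ^+ 2 * f j ^+ 2)
      - 2 * \sum_i \sum_j ((f i * g i) * (f j * g j))).
    rewrite mulr_sumr -big_split/= -sumrB; apply: eq_bigr => i _.
    rewrite mulr_sumr -big_split/= -sumrB; apply: eq_bigr => j _; ring.
  by rewrite -!s2 [(\sum_i g i ^+ 2) * _]mulrC expr2; ring.
by move: h; rewrite e; lra.
Qed.

Lemma enormB a b : enorm (a - b) <= enorm a + enorm b.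
Proof.
rewrite -(@ler_pXn2r _ 2)// ?nnegrE ?addr_ge0 ?enorm_ge0//.
have s0 (c : 'cV[R]_d) : 0 <= \sum_i c i 0 ^+ 2 by rewrite sumr_ge0// => i _; rewrite sqr_ge0.
rewrite sqrrD !sqr_sqrtr//.
have -> : \sum_i (a - b) i 0 ^+ 2 =
    \sum_i a i 0 ^+ 2 + \sum_i b i 0 ^+ 2 - 2 * \sum_i a i 0 * b i 0.
  rewrite mulr_sumr -big_split/= -sumrB; apply: eq_bigr => i _.
  by rewrite !mxE; ring.
have h : `|\sum_i a i 0 * b i 0| <= enorm a * enorm b.
  rewrite -(@ler_pXn2r _ 2)// ?nnegrE ?mulr_ge0 ?enorm_ge0//.
  by rewrite real_normK ?num_real// exprMn !sqr_sqrtr// cauchy_schwarz_sum.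
by rewrite mulr2n; move: h; rewrite ler_norml => /andP[]; lra.
Qed.

End euclidean_norm.

Section sqint_norms.
Context {disp : measure_display} {T : measurableType disp} {R : realType}.
Variable P : probability T R.
Local Notation sqint := (sqint P).
Implicit Types f g : T -> R.

Lemma sqint_enorm d (Y : T -> 'cV[R]_d) : (forall a, sqint (fun w => Y w a 0)) ->
  sqint (fun w => enorm (Y w)).
Proof.
move=> hY; split.
  have ms : measurable_fun setT (Num.sqrt : R -> R).
    by apply: continuous_measurable_fun => x; exact: sqrt_continuous.
  apply: (measurableT_comp ms).
  by apply: measurable_sum => a; apply: measurable_funX; exact: (hY a).1.
rewrite (_ : (fun w => _) = fun w => \sum_a Y w a 0 ^+ 2).
  by apply: integ_sum => a _; exact: (hY a).2.
apply/funext => w; rewrite sqr_sqrtr// sumr_ge0// => a _; exact: sqr_ge0.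
Qed.

Lemma sqint_max f g : sqint f -> sqint g -> sqint (fun w => Num.max (f w) (g w)).
Proof.
move=> hf hg.
have habs h : sqint h -> sqint (fun w => `|h w|).
  move=> [mh ih]; apply: (sqint_le _ _ (conj mh ih)); first exact: measurableT_comp.
  by move=> w; rewrite normr_id.
apply: (sqint_le _ _ (sqintD (habs _ hf) (habs _ hg))).
  exact: measurable_maxr hf.1 hg.1.
move=> w; rewrite [leRHS]ger0_norm ?addr_ge0//.
by have [_|_] := leP (f w) (g w); rewrite ?lerDl ?lerDr.
Qed.

Lemma sqint_bigmax (I : eqType) (r : seq I) (f : I -> T -> R) :
  (forall i, i \in r -> sqint (f i)) ->
  sqint (fun w => \big[Num.max/0]_(i <- r) f i w).
Proof.
elim: r => [_|i r IH h].
  by under eq_fun do rewrite big_nil; exact: sqint_cst.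
under eq_fun do rewrite big_cons.
apply: sqint_max; first by apply: h; rewrite mem_head.
by apply: IH => j jr; apply: h; rewrite inE jr orbT.
Qed.

Lemma indic_ge (f : T -> R) (e : R) w : \1_[set x | e <= f x] w = (e <= f w)%R%:R :> R.
Proof.
rewrite indicE; congr (_%:R); congr nat_of_bool.
by apply/idP/idP => [/set_mem//|h]; apply/mem_set.
Qed.

End sqint_norms.

(** The common step of the comparison of the three Lindeberg sums. *)
Lemma tail_le {R : realType} (a b c e : R) : 0 <= a -> 0 < c -> a <= c * b ->
  a ^+ 2 * (e <= a)%R%:R <= c ^+ 2 * (b ^+ 2 * (e / c <= b)%R%:R).
Proof.
move=> a0 c0 ab.
have b0 : 0 <= c * b by exact: le_trans ab.
have [ea|_] := leP e a; last first.
  rewrite mulr0; apply: mulr_ge0; first exact: sqr_ge0.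
  by apply: mulr_ge0 => //; exact: sqr_ge0.
rewrite ler_pdivrMr// [b * c]mulrC (le_trans ea ab) !mulr1 -exprMn.
by rewrite lerXn2r// nnegrE.
Qed.

Section horizons.
Variables (s K : nat) (p : nat -> nat).
Local Notation q := (horizon s K p).

Lemma horizon_start : (0 < s)%N -> q s.-1 = 0%N.
Proof. by case: s => // s' _; rewrite /horizon /= subnn. Qed.

Lemma horizonP k : (0 < s <= k)%N ->
  [/\ (q k.-1 <= q k)%N, (ext_lag K p (k + q k) <= q k)%N &
      forall q', (q k.-1 <= q')%N -> (ext_lag K p (k + q') <= q')%N -> (q k <= q')%N].
Proof.
move=> /andP[s0 sk]; have k0 := leq_trans s0 sk.
have -> : q k.-1 = horizon_from s K p (k - s) by rewrite /horizon prednK.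
rewrite /horizon subSn//=; case: ex_minnP => m /andP[h1 h2] h3.
rewrite subnKC// in h2 h3 *; split=> // q' h4 h5.
by apply: h3; rewrite h4.
Qed.

Lemma ext_lag_le_max r : (s <= r)%N -> (ext_lag K p r <= max_lag s K p)%N.
Proof.
move=> sr; rewrite /ext_lag; case: ifP => // rK.
by apply: (@leq_bigmax_seq _ _ xpredT p r) => //; rewrite mem_index_iota sr.
Qed.

(** Minimality of the horizon: the largest lag is always admissible. *)
Lemma horizon_le_max k : (0 < s <= k)%N -> (q k <= max_lag s K p)%N.
Proof.
move=> /andP[s0 /subnKC <-]; elim: (k - s)%N => [|t IH].
  rewrite addn0; have /horizonP[_ _ h] : (0 < s <= s)%N by rewrite s0 leqnn.
  apply: h; first by rewrite horizon_start.
  by apply: ext_lag_le_max; rewrite leq_addr.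
have /horizonP[_ _ h] : (0 < s <= s + t.+1)%N by rewrite s0 leq_addr.
rewrite addnS /= in h *; apply: h => //.
by apply: ext_lag_le_max; lia.
Qed.

Lemma sum_horizon_increments n : (0 < s <= n)%N ->
  (\sum_(s <= k < n.+1) (q k - q k.-1))%N = q n.
Proof.
move=> /andP[s0 /subnKC <-]; elim: (n - s)%N => [|t IH].
  by rewrite addn0 big_nat1 horizon_start// subn0.
rewrite addnS big_nat_recr/=; last by rewrite -addnS leq_addr.
rewrite IH subnKC//; have /horizonP[] : (0 < s <= (s + t).+1)%N by rewrite s0 -addnS leq_addr.
by [].
Qed.

End horizons.

Section row_decomposition.
Context {disp : measure_display} {T : measurableType disp} {R : realType}.
Variables (P : probability T R) (d s K : nat) (p : nat -> nat).
Variables (F : nat -> set (set T)) (X : nat -> T -> 'cV[R]_d).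
Local Notation q := (horizon s K p).
Local Notation prj := (Defs.proj P K F X).
Local Notation D := (mart_diff P s K p F X).
Local Notation integ := (integ P).
Local Notation sqint := (sqint P).
Local Notation Ex := (Rintegral P setT).

Hypothesis hF : filtration K F.
Hypothesis hs : (1 <= s <= K)%N.
Hypothesis hXm : forall j, (s <= j <= K)%N -> measurable_wrt_mx (F j) (X j).
Hypothesis hX2 : forall j, (s <= j <= K)%N -> forall a, sqint (fun w => X j w a 0).
Hypothesis hX0 : forall j, (s <= j <= K)%N ->
  {ae P, forall w, condexp_mx P (F (j - p j - 1)%N) (X j) w = 0}.

Let hFk k : (k <= K)%N -> sub_sigma_field (F k). Proof. exact: hF.1. Qed.

Lemma projE j l a w : prj j l w a 0 = condexp P (F l) (fun w' => ext_var K X j w' a 0) w.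
Proof. by rewrite /Defs.proj /condexp_mx mxE. Qed.

Lemma sqint_ext_var j a : (s <= j)%N -> sqint (fun w => ext_var K X j w a 0).
Proof.
move=> sj; rewrite /ext_var; case: leqP => jK; first by apply: hX2; rewrite sj.
rewrite (_ : (fun w => _) = cst 0); first exact: sqint_cst.
by apply/funext => w; rewrite /= mxE.
Qed.

Lemma measurable_proj j l a : (l <= K)%N -> measurable_wrt (F l) (fun w => prj j l w a 0).
Proof.
move=> lK; under eq_fun do rewrite projE.
exact: measurable_wrt_condexp (hFk lK) _.
Qed.

Lemma sqint_proj j l a : (l <= K)%N -> (s <= j)%N -> sqint (fun w => prj j l w a 0).
Proof.
move=> lK sj; under eq_fun do rewrite projE.
by apply: sqint_condexp (hFk lK) _; exact: sqint_ext_var.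
Qed.

(** The almost sure identities behind the telescoping sum: a projection on the
    present is the variable itself, the projection at the horizon vanishes by
    the lag condition, and so do those beyond the end of the row. *)
Definition good w := [/\ forall k, (s <= k <= K)%N -> prj k k w = X k w,
  forall k, (s <= k <= K)%N -> prj (k + q k) k.-1 w = 0 &
  forall j l, (l <= K)%N -> (K < j)%N -> prj j l w = 0].

Let ae_imp (b : bool) (Q : T -> Prop) : (b -> {ae P, forall w, Q w}) ->
  {ae P, forall w, b -> Q w}.
Proof. by case: b => [/(_ isT)|_]; [apply: filterS => w h _|exact: aeW]. Qed.

Let ae_ord (n : nat) (Q : 'I_n -> T -> Prop) : (forall i, {ae P, forall w, Q i w}) ->
  {ae P, forall w, forall i, Q i w}.
Proof.
move=> h; have : {ae P, forall w, forall i (hi : (i < n)%N), Q (Ordinal hi) w}.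
  apply/ae_foralln => i; have [lt|ge] := pselect (i < n)%N; last by apply: aeW => w hi.
  by apply: filterS (h (Ordinal lt)) => w h1 hi; rewrite (bool_irrelevance hi lt).
by apply: filterS => w h1 [i hi]; exact: h1.
Qed.

(** The tower property extends the lag condition to all earlier fields. *)
Let proj_out j l : (l <= K)%N -> (s <= j)%N -> (l + ext_lag K p j < j)%N ->
  {ae P, forall w, prj j l w = 0}.
Proof.
move=> lK sj; rewrite /ext_lag => lj.
suff : {ae P, forall w, forall a, prj j l w a 0 = 0}.
  by apply: filterS => w h; apply/matrixP => a b; rewrite ord1 h mxE.
apply: ae_ord => a.
suff : {ae P, forall w, condexp P (F l) (fun w' => ext_var K X j w' a 0) w = 0}.
  by apply: filterS => w; rewrite projE.
have ii := sqint_integ (sqint_ext_var a sj).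
move: lj ii; rewrite /ext_var; case: ifP => jK lj ii; last first.
  apply: condexp_ae0 (hFk lK) ii _; apply: aeW => w /=; by rewrite mxE.
have sjK : (s <= j <= K)%N by rewrite sj.
have jpK : (j - p j - 1 <= K)%N by rewrite -subnDA (leq_trans (leq_subr _ _)).
apply: (condexp_sub0 (hFk lK) (hFk jpK)) => //.
  by apply: hF.2; rewrite jpK andbT -subnDA addnC subnDA leq_subRL; lia.
by apply: filterS (hX0 sjK) => w /matrixP/(_ a 0); rewrite !mxE.
Qed.

Lemma ae_good : {ae P, forall w, good w}.
Proof.
have h1 : {ae P, forall w, forall k, (s <= k <= K)%N -> prj k k w = X k w}.
  apply/ae_foralln => k; apply: ae_imp => sk; have /andP[sk1 kK] := sk.
  suff : {ae P, forall w, forall a, prj k k w a 0 = X k w a 0}.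
    by apply: filterS => w h; apply/matrixP => a b; rewrite ord1 h.
  apply: ae_ord => a.
  have m : measurable_wrt (F k) (fun w => X k w a 0) by exact: hXm.
  have := condexp_self (hFk kK) (sqint_integ (hX2 sk a)) m.
  by apply: filterS => w; rewrite projE /ext_var kK.
have h2 : {ae P, forall w, forall k, (s <= k <= K)%N -> prj (k + q k) k.-1 w = 0}.
  apply/ae_foralln => k; apply: ae_imp => /andP[sk kK].
  have s0 : (0 < s)%N by case/andP: hs.
  have sk0 : (0 < s <= k)%N by rewrite s0.
  apply: proj_out; first by rewrite (leq_trans (leq_pred _)).
    by rewrite (leq_trans sk)// leq_addr.
  have [_ hq _] := horizonP K p sk0.
  by rewrite -ltnS -addSn prednK ?(leq_trans s0)// ltnS leq_add2l.
have h3 : {ae P, forall w, forall j l, (l <= K)%N -> (K < j)%N -> prj j l w = 0}.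
  apply/ae_foralln => j; apply/ae_foralln => l; apply: ae_imp => lK; apply: ae_imp => Kj.
  apply: proj_out => //; first by case/andP: hs => _ /leq_trans; apply; exact: ltnW.
  by rewrite /ext_lag ifN -?ltnNge// addn0 (leq_ltn_trans lK).
by apply: filterS3 h1 h2 h3 => w g1 g2 g3.
Qed.

(** The projections that enter the window when its horizon grows. *)
Definition row_rem (w : T) : 'cV[R]_d :=
  \sum_(s <= k < K.+1) \sum_(q k.-1 <= i < q k) prj (k + i) k.-1 w.

Let window n w := \sum_(0 <= i < (q n).+1) prj (n + i) n w.

Let telescope n w : good w -> (s <= n <= K)%N ->
  \sum_(s <= k < n.+1) D k w = window n w + \sum_(s <= j < n) X j w -
    \sum_(s <= k < n.+1) \sum_(q k.-1 <= i < q k) prj (k + i) k.-1 w.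
Proof.
move=> [g1 g2 g3] /andP[/subnKC <-]; have /andP[s0 _] := hs.
have DE k : (s <= k <= K)%N -> D k w = window k w -
    (\sum_(0 <= i < q k.-1) prj (k + i) k.-1 w + \sum_(q k.-1 <= i < q k) prj (k + i) k.-1 w).
  move=> sk; have /andP[sk1 _] := sk.
  have [|qq _ _] := @horizonP s K p k; first by rewrite s0.
  rewrite -big_cat_nat//= /mart_diff /window /proj_diff sumrB; congr (_ - _).
  by rewrite big_nat_recr//= g2// addr0.
elim: (n - s)%N => [|t IH] tK.
  rewrite addn0 in tK *; rewrite !big_nat1 DE ?leqnn// horizon_start// big_geq// add0r.
  by rewrite [\sum_(s <= j < s) _]big_geq// addr0.
have stK : (s <= (s + t).+1 <= K)%N by rewrite -addnS leq_addr.
have stK' : (s <= s + t <= K)%N by rewrite leq_addr (leq_trans _ tK)// addnS.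
rewrite addnS in tK *.
rewrite [in LHS]big_nat_recr/=; last by rewrite -addnS leq_addr.
rewrite IH; last by case/andP: stK'.
rewrite DE//= [\sum_(s <= j < (s + t).+1) X j w]big_nat_recr/=; last by rewrite leq_addr.
rewrite [in RHS](big_nat_recr (s + t).+1 s)/=; last by rewrite -addnS leq_addr.
have -> : window (s + t) w = X (s + t) w + \sum_(0 <= i < q (s + t)) prj ((s + t).+1 + i) (s + t) w.
  rewrite /window big_nat_recl//= addn0 g1//; congr (_ + _).
  by apply: eq_bigr => i _; rewrite addnS.
set W := window _ w; set A := X _ w; set B := \sum_(0 <= i < _) _.
set C := \sum_(s <= j < _) X j w; set E := \sum_(s <= k < _) _.
set G := \sum_(_ <= i < _) _.
apply/matrixP => a b; rewrite !mxE; ring.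
Qed.

(** Telescoping: the projections at time [k.-1] subtracted in [D k] are those
    added in [D k.-1], except the vector [X k.-1] itself, which has just
    left the window, and the terms of [row_rem], which have just entered it. *)
Lemma row_sumE w : good w ->
  row_sum s K X w = \sum_(s <= k < K.+1) D k w + row_rem w.
Proof.
move=> g; have /andP[s0 sK] := hs; rewrite (telescope g) ?sK ?leqnn//.
rewrite /row_rem subrK; have [g1 _ g3] := g.
rewrite /window big_nat_recl//= addn0 g1 ?sK ?leqnn// big1 => [|i _].
  by rewrite addr0 /row_sum big_nat_recr//= addrC.
by apply: g3; rewrite ?leqnn// addnS ltnS leq_addr.
Qed.

(** The horizon starts at 0 and is nondecreasing, so that [row_rem] has as many
    terms as its last value, which is at most the largest lag. *)
Lemma row_rem_le w a :
  `|row_rem w a 0| <= (max_lag s K p)%:R * max_remainder P s K p F X w.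
Proof.
have /andP[s0 sK] := hs; set m := max_remainder _ _ _ _ _ _ _.
have m0 : 0 <= m by exact: bigmax_ge_id.
apply: (@le_trans _ _ (\sum_(s <= k < K.+1) \sum_(q k.-1 <= i < q k) m)).
  rewrite /row_rem summxE (le_trans (ler_norm_sum _ _ _))//.
  rewrite !big_nat; apply: ler_sum => k sk.
  rewrite summxE (le_trans (ler_norm_sum _ _ _))//.
  rewrite !big_nat; apply: ler_sum => i qi.
  rewrite (le_trans (coord_le_enorm _ _))//.
  apply: (@bigmax_sup_seq _ _ _ _ _ k) => //; first by rewrite mem_index_iota.
  by apply: (@bigmax_sup_seq _ _ _ _ _ i) => //; rewrite mem_index_iota.
rewrite (eq_bigr (fun k => (q k - q k.-1)%:R * m)); last first.
  by move=> k _; rewrite sumr_const_nat mulr_natl.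
rewrite -mulr_suml -natr_sum sum_horizon_increments ?s0// ler_wpM2r// ler_nat.
by apply: horizon_le_max; rewrite s0.
Qed.

Lemma mart_diffE k a w : D k w a 0 =
  \sum_(0 <= i < (q k).+1) (prj (k + i) k w a 0 - prj (k + i) k.-1 w a 0).
Proof. by rewrite /mart_diff summxE; apply: eq_bigr => i _; rewrite !mxE. Qed.

Let predK k : (s <= k <= K)%N -> (k.-1 <= K)%N.
Proof. by move=> /andP[_]; exact: leq_trans (leq_pred _). Qed.

Let predF k : (s <= k <= K)%N -> F k.-1 `<=` F k.
Proof. by move=> /andP[_ kK]; apply: hF.2; rewrite leq_pred. Qed.

Lemma measurable_mart_diff k a : (s <= k <= K)%N ->
  measurable_wrt (F k) (fun w => D k w a 0).
Proof.
move=> sk; have /andP[sk1 kK] := sk; under eq_fun do rewrite mart_diffE.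
have sG := (hFk kK).1.
apply: measurable_wrt_sum => // i _; apply: measurable_wrtB => //.
  exact: measurable_proj.
apply: measurable_wrt_sub (predF sk) _; exact: measurable_proj (predK sk).
Qed.

Lemma sqint_mart_diff k a : (s <= k <= K)%N -> sqint (fun w => D k w a 0).
Proof.
move=> sk; have /andP[sk1 kK] := sk; under eq_fun do rewrite mart_diffE.
apply: sqint_sum => i _; have ski : (s <= k + i)%N by rewrite (leq_trans sk1)// leq_addr.
by apply: sqintB; [exact: sqint_proj|exact: sqint_proj (predK sk) ski].
Qed.

Lemma Ex_mart_diff0 k a B : (s <= k <= K)%N -> measurable_wrt (F k.-1) B -> bdd B ->
  Ex (fun w => B w * D k w a 0) = 0.
Proof.
move=> sk mB bB; have /andP[sk1 kK] := sk.
have hG := hFk (predK sk); have mB' := measurable_wrt_fun hG.2 mB.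
have ie i : integ (fun w => ext_var K X (k + i) w a 0).
  by apply: sqint_integ; apply: sqint_ext_var; rewrite (leq_trans sk1)// leq_addr.
have ip i l : (l <= K)%N -> integ (fun w => B w * prj (k + i) l w a 0).
  move=> lK; apply: integM_bdd => //; apply: sqint_integ; apply: sqint_proj => //.
  by rewrite (leq_trans sk1)// leq_addr.
under eq_fun do rewrite mart_diffE mulr_sumr.
rewrite Ex_sum => [|i _]; last first.
  by under eq_fun do rewrite mulrBr; apply: integB; [exact: ip|exact: ip (predK sk)].
rewrite big1// => i _; under eq_fun do rewrite mulrBr.
rewrite ExB; [|exact: ip|exact: ip (predK sk)].
have E l (lK : (l <= K)%N) : F k.-1 `<=` F l ->
    Ex (fun w => B w * prj (k + i) l w a 0) = Ex (fun w => B w * ext_var K X (k + i) w a 0).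
  move=> sub; under eq_fun do rewrite projE.
  by apply: (condexp_mul (hFk lK)) => //; exact: measurable_wrt_sub sub mB.
by rewrite (E k kK (predF sk)) (E k.-1 (predK sk) (fun A h => h)) subrr.
Qed.

Let measurable_row (f : nat -> T -> R) :
  (forall k, (s <= k <= K)%N -> measurable_fun setT (f k)) ->
  measurable_fun setT (fun w => \sum_(s <= k < K.+1) f k w).
Proof.
move=> mf; under eq_fun do rewrite big_nat big_mkcond/=.
apply: measurable_sum => k; have [sk|_] := boolP (s <= k < K.+1)%N; first exact: mf.
exact: measurable_cst.
Qed.

Let measurable_condexp k (f : T -> R) : (k <= K)%N ->
  measurable_fun setT (condexp P (F k) f).
Proof.
move=> kK; apply: (@measurable_wrt_fun _ _ _ (F k)); first exact: (hFk kK).2.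
exact: measurable_wrt_condexp (hFk kK) _.
Qed.

Lemma measurable_max_remainder : measurable_fun setT (max_remainder P s K p F X).
Proof.
suff [] : sqint (max_remainder P s K p F X) by [].
apply: sqint_bigmax => k; rewrite mem_index_iota => /andP[sk kK].
apply: sqint_bigmax => i _; apply: sqint_enorm => a; apply: sqint_proj.
  by rewrite (leq_trans (leq_pred _)).
by rewrite (leq_trans sk)// leq_addr.
Qed.

Lemma measurable_lindeberg1 (eps : R) :
  measurable_fun setT (lindeberg1 P s K p F X eps).
Proof. by apply: measurable_row => k sk; exact: measurable_condexp (predK sk). Qed.

Lemma measurable_lindeberg2 (eps : R) :
  measurable_fun setT (lindeberg2 P s K p F X eps).
Proof. by apply: measurable_row => k sk; exact: measurable_condexp (predK sk). Qed.

Lemma measurable_lindeberg3 (eps : R) :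
  measurable_fun setT (lindeberg3 P s K p F X eps).
Proof. by apply: measurable_row => k sk; exact: measurable_condexp (predK sk). Qed.

Lemma measurable_cond_quad_var a b :
  measurable_fun setT (fun w => cond_quad_var P s K p F X w a b).
Proof.
under eq_fun do rewrite summxE; apply: measurable_row => k sk.
by under eq_fun do rewrite mxE; exact: measurable_condexp (predK sk).
Qed.

Lemma measurable_variance_matrix a b :
  measurable_fun setT (fun w => variance_matrix P s K p F X w a b).
Proof.
have mc k i (Y Z : T -> 'cV[R]_d) x y : (s <= k <= K)%N ->
    measurable_fun setT (fun w => condcov P (F (k - i - 1)%N) Y Z w x y).
  move=> /andP[_ kK]; under eq_fun do rewrite mxE; apply: measurable_condexp.
  by rewrite -subnDA (leq_trans (leq_subr _ _)).
under eq_fun do rewrite /variance_matrix !mxE !summxE; apply: measurable_funD.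
  by apply: measurable_row => k sk; exact: mc.
apply: measurable_funM => //; apply: measurable_row => k sk.
under eq_fun do rewrite summxE; under eq_fun do rewrite big_mkcond.
apply: measurable_sum => j; have [_|_] := boolP (lag_set s K p k j != [::]); last exact: measurable_cst.
under eq_fun do rewrite !mxE; apply: measurable_funM => //.
have kj : (k - max_lag_set s K p k j - 1 <= K)%N.
  by case/andP: sk => _ kK; rewrite -subnDA (leq_trans (leq_subr _ _)).
by apply: measurable_funD; exact: measurable_condexp kj.
Qed.

Variable u : 'I_d -> R.

(** One-dimensional projections reduce the statement to scalar rows. *)
Definition proj_mart k w : R := \sum_a u a * D k w a 0.

Let dd a b k w : R := (D k w *m (D k w)^T) a b.

Let quad k w : R := \sum_a \sum_b u a * u b * condexp P (F k.-1) (dd a b k) w.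

(** The conditional variance of [proj_mart], made nonnegative everywhere and
    not only almost everywhere. *)
Definition proj_var k w : R := Num.max 0 (quad k w).

Let ddE a b k w : dd a b k w = D k w a 0 * D k w b 0.
Proof. by rewrite /dd mxE big_ord_recl big_ord0 addr0 !mxE. Qed.

Let idd a b k : (s <= k <= K)%N -> integ (dd a b k).
Proof.
move=> sk; rewrite (_ : dd a b k = fun w => D k w a 0 * D k w b 0); last first.
  by apply/funext => w; exact: ddE.
by apply: sqintM; exact: sqint_mart_diff.
Qed.

Let quad_ok k : (s <= k <= K)%N -> [/\ measurable_wrt (F k.-1) (quad k), integ (quad k),
  (forall B, measurable_wrt (F k.-1) B -> bdd B ->
     Ex (fun w => B w * quad k w) = Ex (fun w => B w * proj_mart k w ^+ 2)) &
  {ae P, forall w, proj_var k w = quad k w}].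
Proof.
move=> sk; have hG := hFk (predK sk); have sG := hG.1.
have mq : measurable_wrt (F k.-1) (quad k).
  apply: measurable_wrt_sum => // a _; apply: measurable_wrt_sum => // b _.
  by apply: measurable_wrtZ => //; exact: measurable_wrt_condexp.
have iq : integ (quad k).
  apply: integ_sum => a _; apply: integ_sum => b _; apply: integZ; exact: integ_condexp.
have eq B : measurable_wrt (F k.-1) B -> bdd B ->
     Ex (fun w => B w * quad k w) = Ex (fun w => B w * proj_mart k w ^+ 2).
  move=> mB bB; have mB' := measurable_wrt_fun hG.2 mB.
  transitivity (\sum_a \sum_b u a * u b * Ex (fun w => B w * dd a b k w)).
    under eq_fun do rewrite mulr_sumr; rewrite Ex_sum => [|a _]; last first.
      apply: integM_bdd => //; apply: integ_sum => b _; apply: integZ; exact: integ_condexp.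
    apply: eq_bigr => a _; under eq_fun do rewrite mulr_sumr; rewrite Ex_sum => [|b _]; last first.
      by apply: integM_bdd => //; apply: integZ; exact: integ_condexp.
    apply: eq_bigr => b _; under eq_fun do rewrite mulrCA; rewrite ExZ; last first.
      by apply: integM_bdd => //; exact: integ_condexp.
    by rewrite (condexp_mul hG (idd a b sk) mB bB).
  symmetry.
  rewrite (_ : (fun w => _) = fun w => \sum_a \sum_b u a * u b * (B w * dd a b k w)).
    rewrite Ex_sum => [|a _]; last first.
      by apply: integ_sum => b _; apply: integZ; apply: integM_bdd => //; exact: idd.
    apply: eq_bigr => a _; rewrite Ex_sum => [|b _]; last first.
      by apply: integZ; apply: integM_bdd => //; exact: idd.
    by apply: eq_bigr => b _; rewrite ExZ//; apply: integM_bdd => //; exact: idd.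
  apply/funext => w; rewrite /proj_mart expr2 mulr_suml mulr_sumr; apply: eq_bigr => a _.
  by rewrite !mulr_sumr; apply: eq_bigr => b _; rewrite ddE; ring.
split=> //.
have m0 : measurable_wrt (F k.-1) (cst 0 : T -> R) by exact: measurable_wrt_cst.
have := Ex_le_ae hG (integ_cst P 0) iq m0 mq.
case=> [A GA|N [mN PN sub]]; last first.
  exists N; split=> // w /= h; apply: sub => /= h1; apply: h.
  by rewrite /proj_var max_r.
rewrite eq//; [|exact: measurable_wrt_indic|exact: bdd_indic].
rewrite (_ : (fun x => _) = cst 0); last by apply/funext => x; rewrite /= mulr0.
rewrite Ex_cst; apply: Ex_ge0 => w; by rewrite mulr_ge0 ?sqr_ge0// indicE.
Qed.

Lemma mart_row_proj : mart_row P F s K proj_mart proj_var.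
Proof.
move=> k sk; have /andP[sk1 kK] := sk.
have hG := hFk (predK sk); have sG := hG.1.
have mx : measurable_wrt (F k) (proj_mart k).
  apply: measurable_wrt_sum => [|a _]; first exact: (hFk kK).1.
  by apply: measurable_wrtZ; [exact: (hFk kK).1|exact: measurable_mart_diff].
have sx : sqint (proj_mart k).
  by apply: sqint_sum => a _; apply: sqintZ; exact: sqint_mart_diff.
have [mq iq eq aq] := quad_ok sk.
have mv : measurable_wrt (F k.-1) (proj_var k).
  by apply: measurable_wrt_max => //; exact: measurable_wrt_cst.
have iv : integ (proj_var k).
  apply: integ_le iq; first exact: (measurable_wrt_fun hG.2 mv).
  move=> w; rewrite /proj_var; have [h|h] := leP 0 (quad k w) => //.
  by rewrite normr0.
split=> //.
- move=> B mB iB; apply: (Ex_mul0 hG) => //; first exact: sqint_integ.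
  move=> A GA; under eq_fun do rewrite mulr_sumr.
  have iA a : integ (fun x => \1_A x * D k x a 0).
    by apply: integM_indic; [exact: hG.2|apply: sqint_integ; exact: sqint_mart_diff].
  rewrite Ex_sum => [|a _]; last by under eq_fun do rewrite mulrCA; exact: integZ.
  rewrite big1// => a _; under eq_fun do rewrite mulrCA.
  rewrite ExZ// Ex_mart_diff0 ?mulr0//; [exact: measurable_wrt_indic|exact: bdd_indic].
- by split=> // w; rewrite /proj_var le_max lexx.
- move=> B mB bB; have mB' := measurable_wrt_fun hG.2 mB.
  rewrite -eq//; apply: Ex_ae_eq; [exact: integM_bdd|exact: integM_bdd|].
  by apply: filterS aq => w ->.
Qed.

Let ae_row (f g : nat -> T -> R) :
  (forall k, (s <= k <= K)%N -> {ae P, forall w, f k w = g k w}) ->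
  {ae P, forall w, \sum_(s <= k < K.+1) f k w = \sum_(s <= k < K.+1) g k w}.
Proof.
move=> h; have : {ae P, forall w, forall k, (s <= k <= K)%N -> f k w = g k w}.
  by apply/ae_foralln => k; apply: ae_imp => sk; exact: h.
apply: filterS => w hw; rewrite big_nat [RHS]big_nat; apply: eq_bigr => k sk.
exact: hw.
Qed.

Lemma sum_proj_var : {ae P, forall w, \sum_(s <= k < K.+1) proj_var k w =
  \sum_a \sum_b u a * u b * cond_quad_var P s K p F X w a b}.
Proof.
have h k : (s <= k <= K)%N -> {ae P, forall w, proj_var k w = quad k w}.
  by move=> /quad_ok[].
apply: filterS (ae_row h) => w ->; rewrite /quad exchange_big; apply: eq_bigr => a _.
rewrite exchange_big; apply: eq_bigr => b _; rewrite -mulr_sumr; congr (_ * _).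
by rewrite /cond_quad_var summxE; apply: eq_bigr => k _; rewrite mxE.
Qed.

(** Any pointwise bound for the truncated squares gives a Lindeberg row. *)
Lemma lindeberg_row_proj (g : nat -> T -> R) (C eps : R) : 0 <= C ->
  (forall k, (s <= k <= K)%N -> [/\ integ (g k), (forall w, 0 <= g k w) &
     forall w, proj_mart k w ^+ 2 * (eps <= `|proj_mart k w|)%R%:R <= C * g k w]) ->
  let l k w := Num.max 0 (C * condexp P (F k.-1) (g k) w) in
  lindeberg_row P F s K proj_mart eps l /\
  {ae P, forall w, \sum_(s <= k < K.+1) l k w =
    C * \sum_(s <= k < K.+1) condexp P (F k.-1) (g k) w}.
Proof.
move=> C0 hg l; have le k : (s <= k <= K)%N ->
    {ae P, forall w, l k w = C * condexp P (F k.-1) (g k) w}.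
  move=> sk; have [ig g0 _] := hg k sk.
  apply: filterS (condexp_ge0 (hFk (predK sk)) ig g0) => w h.
  by rewrite /l max_r// mulr_ge0.
split; last by apply: filterS (ae_row le) => w ->; rewrite mulr_sumr.
move=> k sk; have [ig g0 gx] := hg k sk; have hG := hFk (predK sk); have sG := hG.1.
have mc : measurable_wrt (F k.-1) (fun w => C * condexp P (F k.-1) (g k) w).
  by apply: measurable_wrtZ => //; exact: measurable_wrt_condexp.
have ic : integ (fun w => C * condexp P (F k.-1) (g k) w).
  by apply: integZ; exact: integ_condexp.
have ml : measurable_wrt (F k.-1) (l k).
  by apply: measurable_wrt_max => //; exact: measurable_wrt_cst.
have il : integ (l k).
  apply: integ_le ic; first exact: (measurable_wrt_fun hG.2 ml).
  move=> w; rewrite /l; have [//|_] := leP 0 (C * condexp P (F k.-1) (g k) w).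
  by rewrite normr0.
split=> //; first by move=> w; rewrite /l le_max lexx.
move=> B mB bB B0; have mB' := measurable_wrt_fun hG.2 mB.
have [_ sx _ _ _] := mart_row_proj sk.
have iBg : integ (fun w => B w * (C * g k w)).
  by apply: integM_bdd => //; exact: integZ.
apply: (@le_trans _ _ (Ex (fun w => B w * (C * g k w)))).
  apply: Ex_le => // [|w]; last by rewrite ler_wpM2l.
  by apply: integM_bdd => //; exact: integ_tail.
suff -> : Ex (fun w => B w * (C * g k w)) = Ex (fun w => B w * l k w) by [].
transitivity (Ex (fun w => B w * (C * condexp P (F k.-1) (g k) w))).
  have E (f : T -> R) : (fun w => B w * (C * f w)) = fun w => C * (B w * f w).
    by apply/funext => w; rewrite mulrCA.
  rewrite !E !ExZ ?(condexp_mul hG)//; apply: integM_bdd => //; exact: integ_condexp.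
apply: Ex_ae_eq; [exact: integM_bdd|exact: integM_bdd|].
by apply: filterS (le k sk) => w ->.
Qed.

Local Notation sn := (sum_norm P s K p F X).
Local Notation mn := (max_norm P s K p F X).
Local Notation mp := (max_norm_proj P s K p F X).

Definition norm_coef : R := 1 + \sum_a `|u a|.

Lemma norm_coef_gt0 : 0 < norm_coef.
Proof. by rewrite /norm_coef ltr_pwDl// sumr_ge0. Qed.

Let sn_ge0 k w : 0 <= sn k w.
Proof. by rewrite /sum_norm sumr_ge0// => i _; exact: enorm_ge0. Qed.

Let mn_ge0 k w : 0 <= mn k w. Proof. exact: bigmax_ge_id. Qed.

Let mp_ge0 k w : 0 <= mp k w. Proof. exact: bigmax_ge_id. Qed.

Let proj_mart_le k w : `|proj_mart k w| <= norm_coef * sn k w.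
Proof.
have Dle a : `|D k w a 0| <= sn k w.
  rewrite /mart_diff summxE (le_trans (ler_norm_sum _ _ _))//.
  by apply: ler_sum => i _; exact: coord_le_enorm.
rewrite /proj_mart (le_trans (ler_norm_sum _ _ _))//.
rewrite mulrDl mul1r (le_trans _ (_ : (\sum_a `|u a|) * sn k w <= _)) ?lerDr ?sn_ge0//.
by rewrite mulr_suml; apply: ler_sum => a _; rewrite normrM ler_wpM2l.
Qed.

Let sn_le k w : sn k w <= (q k).+1%:R * mn k w.
Proof.
rewrite /sum_norm mulr_natl -[X in _ *+ X]subn0 -sumr_const_nat.
rewrite !big_nat; apply: ler_sum => i iq; rewrite /max_norm.
by apply: (@bigmax_sup_seq _ _ _ _ _ i) => //; rewrite mem_index_iota.
Qed.

Let mn_le k w : mn k w <= 2 * mp k w.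
Proof.
have m0 : 0 <= 2 * mp k w by rewrite mulr_ge0.
rewrite /max_norm big_nat_cond; apply: (big_ind (fun x => x <= 2 * mp k w)) => // [x y hx hy|i /andP[iq _]].
  by rewrite ge_max hx.
rewrite /proj_diff (le_trans (enormB _ _))// mulr_natl mulr2n lerD//.
  apply: (@bigmax_sup_seq _ _ _ _ _ i) => //; first by rewrite mem_index_iota.
  by apply: (@bigmax_sup_seq _ _ _ _ _ 0%N) => //; rewrite subn0.
apply: (@bigmax_sup_seq _ _ _ _ _ i) => //; first by rewrite mem_index_iota.
by apply: (@bigmax_sup_seq _ _ _ _ _ 1%N) => //; rewrite subn1.
Qed.

Let sqint_proj_diff k i a : (s <= k <= K)%N ->
  sqint (fun w => proj_diff P K F X i k w a 0).
Proof.
move=> sk; have /andP[sk1 kK] := sk.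
rewrite (_ : (fun w => _) = fun w => prj (k + i) k w a 0 - prj (k + i) k.-1 w a 0).
  have ski : (s <= k + i)%N by rewrite (leq_trans sk1)// leq_addr.
  by apply: sqintB; [exact: sqint_proj|exact: sqint_proj (predK sk) ski].
by apply/funext => w; rewrite !mxE.
Qed.

Let sqint_sn k : (s <= k <= K)%N -> sqint (sn k).
Proof.
move=> sk; apply: sqint_sum => i _; apply: sqint_enorm => a.
exact: sqint_proj_diff.
Qed.

Let sqint_mn k : (s <= k <= K)%N -> sqint (mn k).
Proof.
move=> sk; apply: sqint_bigmax => i _; apply: sqint_enorm => a.
exact: sqint_proj_diff.
Qed.

Let sqint_mp k : (s <= k <= K)%N -> sqint (mp k).
Proof.
move=> sk; have /andP[sk1 kK] := sk.
apply: sqint_bigmax => i _; apply: sqint_bigmax => j _; apply: sqint_enorm => a.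
apply: sqint_proj; first by rewrite (leq_trans (leq_subr _ _)).
by rewrite (leq_trans sk1)// leq_addr.
Qed.

Let tail_integ (f : T -> R) (e : R) : (forall w, 0 <= f w) -> sqint f ->
  integ (fun w => f w ^+ 2 * \1_[set x | e <= f x] w).
Proof.
move=> f0 sf; rewrite (_ : (fun w => _) = fun w => f w ^+ 2 * (e <= `|f w|)%R%:R).
  exact: integ_tail.
by apply/funext => w; rewrite indic_ge ger0_norm.
Qed.

Let tail1 (eps : R) k w : proj_mart k w ^+ 2 * (eps <= `|proj_mart k w|)%R%:R <=
  norm_coef ^+ 2 * (sn k w ^+ 2 * \1_[set x | eps / norm_coef <= sn k x] w).
Proof.
rewrite indic_ge -(real_normK (num_real (proj_mart k w))).
apply: tail_le; [exact: normr_ge0|exact: norm_coef_gt0|exact: proj_mart_le].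
Qed.

Let tail2 (e : R) k w : sn k w ^+ 2 * \1_[set x | e <= sn k x] w <=
  (q k).+1%:R ^+ 2 * mn k w ^+ 2 * \1_[set x | e / (q k).+1%:R <= mn k x] w.
Proof. by rewrite !indic_ge -mulrA; apply: tail_le => //; exact: sn_le. Qed.

Let tail3 (e : R) k w : (q k).+1%:R ^+ 2 * mn k w ^+ 2 * \1_[set x | e / (q k).+1%:R <= mn k x] w <=
  4 * (q k).+1%:R ^+ 2 * mp k w ^+ 2 * \1_[set x | e / (2 * (q k).+1%:R) <= mp k x] w.
Proof.
rewrite !indic_ge; set N : R := (q k).+1%:R.
have N2 : 0 <= N ^+ 2 by exact: sqr_ge0.
have h := tail_le (e / N) (mn_ge0 k w) (ltr0n R 2) (mn_le k w).
have := ler_wpM2l N2 h; rewrite (_ : e / (2 * N) = e / N / 2); last by rewrite invfM; ring.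
by move=> h1; rewrite -mulrA; apply: (le_trans h1); rewrite le_eqVlt; apply/orP; left; apply/eqP; ring.
Qed.

(** The three Lindeberg sums are ordered up to constants: the absolute
    value of [u . D k] is at most a multiple of the sum of the norms of the
    terms of [D k], this sum is at most their number times their maximum,
    and each term is a difference of two projections. *)
Lemma lindeberg_row1 (eps : R) : exists l, lindeberg_row P F s K proj_mart eps l /\
  {ae P, forall w, \sum_(s <= k < K.+1) l k w =
     norm_coef ^+ 2 * lindeberg1 P s K p F X (eps / norm_coef) w}.
Proof.
eexists; apply: (lindeberg_row_proj (exprn_ge0 2 (ltW norm_coef_gt0))) => k sk; split.
- by apply: tail_integ => //; exact: sqint_sn.
- by move=> w; rewrite mulr_ge0 ?sqr_ge0// indicE.
- by move=> w; exact: tail1.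
Qed.

Lemma lindeberg_row2 (eps : R) : exists l, lindeberg_row P F s K proj_mart eps l /\
  {ae P, forall w, \sum_(s <= k < K.+1) l k w =
     norm_coef ^+ 2 * lindeberg2 P s K p F X (eps / norm_coef) w}.
Proof.
eexists; apply: (lindeberg_row_proj (exprn_ge0 2 (ltW norm_coef_gt0))) => k sk; split.
- under eq_fun do rewrite -mulrA.
  by apply: integZ; apply: tail_integ => //; exact: sqint_mn.
- by move=> w; rewrite !mulr_ge0 ?sqr_ge0// indicE.
- move=> w; apply: (le_trans (tail1 eps k w)).
  by rewrite ler_wpM2l ?sqr_ge0//; exact: tail2.
Qed.

Lemma lindeberg_row3 (eps : R) : exists l, lindeberg_row P F s K proj_mart eps l /\
  {ae P, forall w, \sum_(s <= k < K.+1) l k w =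
     norm_coef ^+ 2 * lindeberg3 P s K p F X (eps / norm_coef) w}.
Proof.
eexists; apply: (lindeberg_row_proj (exprn_ge0 2 (ltW norm_coef_gt0))) => k sk; split.
- under eq_fun do rewrite -mulrA.
  by apply: integZ; apply: tail_integ => //; exact: sqint_mp.
- by move=> w; rewrite !mulr_ge0 ?sqr_ge0// indicE.
- move=> w; apply: (le_trans (tail1 eps k w)).
  by rewrite ler_wpM2l ?sqr_ge0//; apply: le_trans (tail2 _ _ _) (tail3 _ _ _).
Qed.

End row_decomposition.

(** * Pairs of random variables and entries of random matrices *)

Section pair_criterion.
Context {R : realType} (d : nat).
Local Notation S := 'rV[R]_(d + 1).

Let unrow (x : S) : 'cV[R]_d * R := ((lsubmx x)^T, rsubmx x 0 0).

Let unrow_continuous : continuous unrow.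
Proof.
move=> x; apply: (@cvg_pair _ _ _ (nbhs x) (nbhs (lsubmx x)^T) (nbhs (rsubmx x 0 0))).
  move=> A /nbhs_ballP[e /= e0 eA]; apply/nbhs_ballP; exists e => //= y [_ xy].
  by apply: eA; split=> // i j; rewrite !mxE; exact: xy.
by rewrite mxE; under eq_fun do rewrite mxE; exact: coord_continuous.
Qed.

Let row_of (y : 'cV[R]_d) (v : R) : S := row_mx y^T (const_mx v).

Let row_ofK y v : unrow (row_of y v) = (y, v).
Proof. by rewrite /unrow /row_of row_mxKl row_mxKr trmxK mxE. Qed.

Let phase_row (c : 'I_(d + 1) -> R) y v : phase c (row_of y v) =
  \sum_a c (lshift 1 a) * y a 0 + c (rshift d 0) * v.
Proof.
rewrite /phase big_split_ord/= big_ord1; congr (_ + _ * _).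
  by apply: eq_bigr => a _; rewrite row_mxEl mxE.
by rewrite row_mxEr mxE.
Qed.

Context {disp : measure_display} {T : measurableType disp}.
Context {disp' : measure_display} {T' : measurableType disp'}.
Variables (P : probability T R) (P' : probability T' R).
Variables (Y_ : nat -> T -> 'cV[R]_d) (V : T -> R) (Y : T' -> 'cV[R]_d) (V' : T' -> R).
Hypothesis mY_ : forall n, (1 <= n)%N -> forall a, measurable_fun setT (fun w => Y_ n w a 0).
Hypothesis mV : measurable_fun setT V.
Hypothesis mY : forall a, measurable_fun setT (fun w => Y w a 0).
Hypothesis mV' : measurable_fun setT V'.
Hypothesis tight : forall a (delta : R), 0 < delta -> exists2 A : R, 0 < A &
  \forall n \near \oo, (P [set w | (A <= `|Y_ n w a 0|)%R] <= delta%:E)%E.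
Hypothesis cf : forall (u : 'I_d -> R) (v theta : R),
  Rintegral P setT (fun w => cos (\sum_a u a * Y_ n w a 0 + (v * V w + theta))) @[n --> \oo] -->
  Rintegral P' setT (fun w => cos (\sum_a u a * Y w a 0 + (v * V' w + theta))).

(** The pair is read as a single row vector, whose trigonometric functions
    involve the two components jointly. *)
Lemma cvg_in_distr_pair :
  cvg_in_distr P P' (fun n w => (Y_ n w, V w)) (fun w => (Y w, V' w)).
Proof.
move=> h ch [M hM].
have := @trig_determining R (d + 1) _ T _ T' P P' (fun n w => row_of (Y_ n w) (V w))
  (fun w => row_of (Y w) (V' w)) _ _ _ _ (h \o unrow).
have -> : (fun n => 'E_P[(h \o unrow) \o (fun w => row_of (Y_ n w) (V w))])%E =
    (fun n => 'E_P[h \o (fun w => (Y_ n w, V w))])%E.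
  by apply/funext => n; congr expectation; apply/funext => w; rewrite /= row_ofK.
have -> : (h \o unrow) \o (fun w => row_of (Y w) (V' w)) = h \o (fun w => (Y w, V' w)).
  by apply/funext => w; rewrite /= row_ofK.
apply.
- move=> n n1 i; case: (split_ordP i) => j ->.
    by under eq_fun do rewrite row_mxEl mxE; exact: mY_.
  by under eq_fun do rewrite row_mxEr mxE.
- move=> i; case: (split_ordP i) => j ->.
    by under eq_fun do rewrite row_mxEl mxE; exact: mY.
  by under eq_fun do rewrite row_mxEr mxE.
- move=> i delta d0; case: (split_ordP i) => j ->.
    have [A A0 hA] := tight j d0; exists A => //.
    apply: filterS hA => n; set B := [set w | _]; rewrite (_ : [set w | _] = B)//.
    by apply/seteqP; split=> w /=; rewrite /B/= /row_of row_mxEl mxE.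
  have mr a : measurable_fun setT (fun w : T => (const_mx (V w) : 'rV[R]_1) 0 a).
    by under eq_fun do rewrite mxE.
  have [A A0 hA] := prob_tail P mr 0 d0; exists A => //.
  apply: nearW => n; move: hA; set B := [set w | _]; rewrite (_ : [set w | _] = B)//.
  by apply/seteqP; split=> w /=; rewrite /B/= /row_of row_mxEr !mxE.
- move=> c theta.
  have E (y : 'cV[R]_d) (v : R) : cos (phase c (row_of y v) + theta) =
      cos (\sum_a c (lshift 1 a) * y a 0 + (c (rshift d 0) * v + theta)).
    by rewrite phase_row addrA.
  have := @cf (fun a => c (lshift 1 a)) (c (rshift d 0)) theta.
  rewrite (_ : Rintegral P' setT _ = Rintegral P' setT (fun w =>
    cos (phase c (row_of (Y w) (V' w)) + theta))).
    apply: cvg_trans; apply: near_eq_cvg; apply: nearW => n.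
    by apply: eq_Rintegral => w _; rewrite E.
  by apply: eq_Rintegral => w _; rewrite E.
- by move=> x; apply: continuous_comp; [exact: unrow_continuous|exact: ch].
- by exists M => x; exact: hM.
Qed.

End pair_criterion.

Section cvg_in_prob_entries.
Context {disp : measure_display} {T : measurableType disp} {R : realType}.
Variable P : probability T R.

Let cvg0_small (A : nat -> set T) : (forall n, (1 <= n)%N -> measurable (A n)) ->
  P (A n) @[n --> \oo] --> 0%E -> forall delta : R, 0 < delta ->
  \forall n \near \oo, (P (A n) <= delta%:E)%E.
Proof.
move=> mA /fine_cvgP[_ /cvgrPdist_le h] delta d0; near=> n.
have n1 : (1 <= n)%N by near: n; exact: nbhs_infty_gt.
rewrite -(fineK (fin_num_measure P _ (mA n n1))) lee_fin.
rewrite (le_trans (ler_norm _))// -normrN -[- _]sub0r; near: n; exact: h.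
Unshelve. all: by end_near. Qed.

Lemma cvg_in_prob_real (Y_ : nat -> T -> R) :
  (forall n, (1 <= n)%N -> measurable_fun setT (Y_ n)) ->
  cvg_in_prob P Y_ (cst 0) -> cvgp0 P Y_.
Proof.
move=> mY h; split; first by exists 1%N => // n /=; exact: mY.
move=> eps e0 delta d0.
apply: cvg0_small d0 => [n n1|]; first by apply: measurable_abs_ge; exact: mY.
have := h eps e0; rewrite (_ : (fun n => P [set w | (eps <= `|Y_ n w - cst 0 w|)%R]) =
  fun n => P [set w | (eps <= `|Y_ n w|)%R])//.
by apply/funext => n; congr (P _); apply/seteqP; split=> w /=; rewrite subr0.
Qed.

Lemma cvg_in_prob_mx m n (Y_ : nat -> T -> 'M[R]_(m, n)) (Y : T -> 'M[R]_(m, n)) :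
  (forall r, (1 <= r)%N -> forall i j, measurable_fun setT (fun w => Y_ r w i j)) ->
  (forall i j, measurable_fun setT (fun w => Y w i j)) ->
  cvg_in_prob P Y_ Y -> forall i j, cvgp0 P (fun r w => Y_ r w i j - Y w i j).
Proof.
move=> mY_ mY h i j.
have mij r a b : (1 <= r)%N -> measurable_fun setT (fun w => (Y_ r w - Y w) a b).
  by move=> r1; under eq_fun do rewrite !mxE; apply: measurable_funB => //; exact: mY_.
split.
  by exists 1%N => // r /= r1; have := mij r i j r1; under eq_fun do rewrite !mxE.
move=> eps e0 delta d0.
have mN r : (1 <= r)%N -> measurable_fun setT (fun w => `|Y_ r w - Y w|).
  move=> r1; have mb (s : seq ('I_m * 'I_n)) : measurable_fun setT
      (fun w => \big[Num.max/0]_(ij <- s) `|(Y_ r w - Y w) ij.1 ij.2|).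
    elim: s => [|ij s IH]; first by under eq_fun do rewrite big_nil; exact: measurable_cst.
    under eq_fun do rewrite big_cons; apply: measurable_maxr => //.
    by apply: measurableT_comp => //; exact: mij.
  by under eq_fun do rewrite [Num.norm _]mx_normrE; exact: mb.
have mE r : (1 <= r)%N -> measurable [set w | eps <= `|Y_ r w - Y w|].
  move=> r1; rewrite -[X in measurable X]setTI.
  by apply: measurable_fun_le => //; exact: mN.
have := cvg0_small mE (h eps e0) d0; apply: filter_app; near=> r.
have r1 : (1 <= r)%N by near: r; exact: nbhs_infty_gt.
apply: le_trans; apply: le_measure; rewrite ?inE.
- have := measurable_abs_ge eps (mij r i j r1).
  by under eq_set do rewrite !mxE.
- exact: mE.
move=> w /= /le_trans; apply.
rewrite [leRHS]mx_normrE.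
have := @le_bigmax _ _ _ 0 (fun ij => `|(Y_ r w - Y w) ij.1 ij.2|) (i, j).
by rewrite /= !mxE.
Unshelve. all: by end_near. Qed.

End cvg_in_prob_entries.

(** * Limits of linear forms of the row sums *)

Section lag_martingale_array.
Context {R : realType} {disp : measure_display} {T : measurableType disp}.
Variables (P : probability T R) (d : nat).
Variables (k s : nat -> nat) (p : nat -> nat -> nat).
Variables (F : nat -> nat -> set (set T)) (X : nat -> nat -> T -> 'cV[R]_d).
Variable Psi : T -> 'M[R]_d.
Local Notation integ := (integ P).
Local Notation Ex := (Rintegral P setT).

Hypothesis hk_mono : forall m n, (1 <= m <= n)%N -> (k m <= k n)%N.
Hypothesis hF : forall n, (1 <= n)%N -> filtration (k n) (F n).
Hypothesis hs : forall n, (1 <= n)%N -> (1 <= s n <= k n)%N.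
Hypothesis hX : lag_martingale_difference P s k p F X.
Hypothesis hX2 : square_integrable P s k X.
Hypothesis hPsi_meas : measurable_wrt_mx (limit_field k F) Psi.
Hypothesis hPsi_psd : forall w, psd (Psi w).
Hypothesis h1 : cvg_in_prob P
  (fun n => variance_matrix P (s n) (k n) (p n) (F n) (X n)) Psi.
Hypothesis h1' : cvg_in_prob P
  (fun n w => cond_quad_var P (s n) (k n) (p n) (F n) (X n) w -
              variance_matrix P (s n) (k n) (p n) (F n) (X n) w) (cst 0).
Hypothesis h2 : cvg_in_prob P
  (fun n w => (max_lag (s n) (k n) (p n))%:R *
              max_remainder P (s n) (k n) (p n) (F n) (X n) w) (cst 0).
Hypothesis h3 : [\/ forall eps : R, 0 < eps -> cvg_in_prob P
    (fun n w => lindeberg1 P (s n) (k n) (p n) (F n) (X n) eps w) (cst 0),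
  forall eps : R, 0 < eps -> cvg_in_prob P
    (fun n w => lindeberg2 P (s n) (k n) (p n) (F n) (X n) eps w) (cst 0) |
  forall eps : R, 0 < eps -> cvg_in_prob P
    (fun n w => lindeberg3 P (s n) (k n) (p n) (F n) (X n) eps w) (cst 0)].

Let row_meas n : (1 <= n)%N -> forall j, (s n <= j <= k n)%N ->
  measurable_wrt_mx (F n j) (X n j).
Proof. by move=> n1 j sj; have [] := hX n1 sj. Qed.

Let row_sqint n : (1 <= n)%N -> forall j, (s n <= j <= k n)%N ->
  forall a, sqint P (fun w => X n j w a 0).
Proof. by move=> n1 j sj a; exact: Lfun2_sqint (hX2 n1 sj a). Qed.

Let row_lag n : (1 <= n)%N -> forall j, (s n <= j <= k n)%N ->
  {ae P, forall w, condexp_mx P (F n (j - p n j - 1)%N) (X n j) w = 0}.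
Proof. by move=> n1 j sj; have [] := hX n1 sj. Qed.

Let limit_ok : sub_sigma_field (limit_field k F).
Proof. exact: limit_field_sub hF. Qed.

Let mPsi a b : measurable_fun setT (fun w => Psi w a b).
Proof. exact: (measurable_wrt_fun limit_ok.2 (hPsi_meas (i := a) (j := b))). Qed.

Let xbar n := row_sum (s n) (k n) (X n).

Let mxbar n : (1 <= n)%N -> forall a, measurable_fun setT (fun w => xbar n w a 0).
Proof.
move=> n1 a; under eq_fun do rewrite /xbar /row_sum summxE big_nat big_mkcond/=.
apply: measurable_sum => j; have [sj|_] := boolP (s n <= j < (k n).+1)%N.
  exact: (row_sqint n1 sj a).1.
exact: measurable_cst.
Qed.

Section direction.
Variable u : 'I_d -> R.

Let xi n := proj_mart P (s n) (k n) (p n) (F n) (X n) u.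
Let v n := proj_var P (s n) (k n) (p n) (F n) (X n) u.
Definition eta2 w : R := \sum_a \sum_b u a * u b * Psi w a b.

Let rowM n : (1 <= n)%N -> mart_row P (F n) (s n) (k n) (xi n) (v n).
Proof.
move=> n1; apply: mart_row_proj; [exact: hF|exact: row_sqint].
Qed.

Let eta2_ge0 w : 0 <= eta2 w.
Proof.
have [_ /(_ (\col_a u a))] := hPsi_psd w; rewrite mxE; congr (_ <= _).
rewrite /eta2 exchange_big; apply: eq_bigr => b _; rewrite mxE mulr_suml.
by apply: eq_bigr => a _; rewrite !mxE mulrAC.
Qed.

Lemma measurable_eta2 : measurable_wrt (limit_field k F) eta2.
Proof.
have sG := limit_ok.1.
apply: measurable_wrt_sum => // a _; apply: measurable_wrt_sum => // b _.
by apply: measurable_wrtZ => //; exact: hPsi_meas.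
Qed.

Let msum n (f : nat -> T -> R) : (forall j, (s n <= j <= k n)%N -> measurable_fun setT (f j)) ->
  measurable_fun setT (fun w => \sum_(s n <= j < (k n).+1) f j w).
Proof.
move=> mf; under eq_fun do rewrite big_nat big_mkcond/=.
apply: measurable_sum => j; have [sj|_] := boolP (s n <= j < (k n).+1)%N; first exact: mf.
exact: measurable_cst.
Qed.

Let bound_var : cvgp0 P (fun n w => \sum_(s n <= j < (k n).+1) v n j w - eta2 w).
Proof.
have mq n : (1 <= n)%N -> forall a b, measurable_fun setT
    (fun w => cond_quad_var P (s n) (k n) (p n) (F n) (X n) w a b).
  by move=> n1 a b; apply: measurable_cond_quad_var; [exact: hF].
have mvm n : (1 <= n)%N -> forall a b, measurable_fun setT
    (fun w => variance_matrix P (s n) (k n) (p n) (F n) (X n) w a b).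
  by move=> n1 a b; apply: measurable_variance_matrix; [exact: hF].
have c1 := cvg_in_prob_mx mvm mPsi h1.
have c2 a b : cvgp0 P (fun n w => cond_quad_var P (s n) (k n) (p n) (F n) (X n) w a b -
     variance_matrix P (s n) (k n) (p n) (F n) (X n) w a b).
  pose A n w := cond_quad_var P (s n) (k n) (p n) (F n) (X n) w.
  pose B n w := variance_matrix P (s n) (k n) (p n) (F n) (X n) w.
  have E n w i j : (A n w - B n w) i j = A n w i j - B n w i j by rewrite mxE [X in _ + X]mxE.
  have mAB n : (1 <= n)%N -> forall i j, measurable_fun setT (fun w => (A n w - B n w) i j).
    move=> n1 i j; under eq_fun do rewrite E.
    by apply: measurable_funB; [exact: mq|exact: mvm].
  have m0 (i j : 'I_d) : measurable_fun setT (fun w : T => (cst 0 w : 'M[R]_d) i j).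
    exact: measurable_cst.
  have := cvg_in_prob_mx mAB m0 h1' a b.
  rewrite (_ : (fun r w => _) = fun n w => A n w a b - B n w a b)//.
  by apply/funext => n; apply/funext => w; rewrite E [X in _ - X](_ : _ = 0) ?subr0// mxE.
have c3 : cvgp0 P (fun n w => \sum_a \sum_b u a * u b *
    (cond_quad_var P (s n) (k n) (p n) (F n) (X n) w a b - Psi w a b)).
  apply: cvgp0_sum => a _; apply: cvgp0_sum => b _; apply: cvgp0Z.
  have := cvgp0D (c2 a b) (c1 a b).
  by under [X in cvgp0 P X]eq_fun do under eq_fun do rewrite addrA subrK.
have mv n : (1 <= n)%N -> measurable_fun setT
    (fun w => \sum_(s n <= j < (k n).+1) v n j w - eta2 w).
  move=> n1; apply: measurable_funB; last exact: (measurable_wrt_fun limit_ok.2 measurable_eta2).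
  by apply: msum => j sj; have [_ _ _ [_ _ iv] _] := rowM n1 sj; exact: integ_meas iv.
apply: cvgp0_le_ae c3; first by exists 1%N => // n /= n1; exact: mv.
exists 1%N => // n /= n1.
have := sum_proj_var (p n) (hF n1) (row_sqint n1) u.
apply: filterS => w; rewrite -/(v n) => ->; rewrite le_eqVlt; apply/orP; left; apply/eqP; congr `|_|.
rewrite /eta2 -sumrB; apply: eq_bigr => a _; rewrite -sumrB.
by apply: eq_bigr => b _; rewrite mulrBr.
Qed.

Let lind_of (L : nat -> R -> T -> R) :
  (forall n, (1 <= n)%N -> forall eps : R, measurable_fun setT (L n eps)) ->
  (forall n, (1 <= n)%N -> forall eps : R, exists l,
     lindeberg_row P (F n) (s n) (k n) (xi n) eps l /\
     {ae P, forall w, \sum_(s n <= j < (k n).+1) l j w =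
        norm_coef u ^+ 2 * L n (eps / norm_coef u) w}) ->
  (forall eps : R, 0 < eps -> cvg_in_prob P (fun n w => L n eps w) (cst 0)) ->
  forall eps : R, 0 < eps -> exists l : nat -> nat -> T -> R,
    (forall n, (1 <= n)%N -> lindeberg_row P (F n) (s n) (k n) (xi n) eps (l n)) /\
    cvgp0 P (fun n x => \sum_(s n <= j < (k n).+1) l n j x).
Proof.
move=> mL hL cL eps e0.
have /choice[l hl] : forall n, exists l : nat -> T -> R, (1 <= n)%N ->
    lindeberg_row P (F n) (s n) (k n) (xi n) eps l /\
     {ae P, forall w, \sum_(s n <= j < (k n).+1) l j w =
        norm_coef u ^+ 2 * L n (eps / norm_coef u) w}.
  case=> [|n]; first by exists (fun _ => cst 0).
  by have [l ?] := hL n.+1 isT eps; exists l.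
exists l; split=> [n n1|]; first by have [] := hl n n1.
have c : cvgp0 P (fun n w => norm_coef u ^+ 2 * L n (eps / norm_coef u) w).
  apply: cvgp0Z; apply: cvg_in_prob_real => [n n1|]; first exact: mL.
  by apply: cL; rewrite divr_gt0// norm_coef_gt0.
apply: cvgp0_le_ae c; exists 1%N => // n /= n1; have [h ae] := hl n n1.
  by apply: msum => j sj; have [_ _ il _] := h j sj; exact: integ_meas il.
by apply: filterS ae => w ->.
Qed.

Let lind (eps : R) : 0 < eps -> exists l : nat -> nat -> T -> R,
  (forall n, (1 <= n)%N -> lindeberg_row P (F n) (s n) (k n) (xi n) eps (l n)) /\
  cvgp0 P (fun n x => \sum_(s n <= j < (k n).+1) l n j x).
Proof.
case: h3 => h; move: eps.
- apply: (lind_of _ _ h) => n n1 eps; first exact: measurable_lindeberg1 (hF n1) _.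
  exact: (lindeberg_row1 (p n) (hF n1) (row_sqint n1)).
- apply: (lind_of _ _ h) => n n1 eps; first exact: measurable_lindeberg2 (hF n1) _.
  exact: (lindeberg_row2 (p n) (hF n1) (row_sqint n1)).
- apply: (lind_of _ _ h) => n n1 eps; first exact: measurable_lindeberg3 (hF n1) _.
  exact: (lindeberg_row3 (p n) (hF n1) (row_sqint n1)).
Qed.

Let rem n w := \sum_a u a * xbar n w a 0 - \sum_(s n <= j < (k n).+1) xi n j w.

Let mxi n : (1 <= n)%N -> measurable_fun setT (fun w => \sum_(s n <= j < (k n).+1) xi n j w).
Proof.
by move=> n1; apply: msum => j sj; have [_ sx _ _ _] := rowM n1 sj; exact: sx.1.
Qed.

Let mux n : (1 <= n)%N -> measurable_fun setT (fun w => \sum_a u a * xbar n w a 0).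
Proof.
by move=> n1; apply: measurable_sum => a; apply: measurable_funM => //; exact: mxbar.
Qed.

Let rem_small : cvgp0 P rem.
Proof.
have c : cvgp0 P (fun n w => norm_coef u * ((max_lag (s n) (k n) (p n))%:R *
              max_remainder P (s n) (k n) (p n) (F n) (X n) w)).
  apply: cvgp0Z; apply: cvg_in_prob_real h2 => n n1; apply: measurable_funM => //.
  by apply: measurable_max_remainder; [exact: hF|exact: row_sqint].
apply: cvgp0_le_ae c; exists 1%N => // n /= n1.
  by apply: measurable_funB; [exact: mux|exact: mxi].
have := ae_good (hF n1) (hs n1) (row_meas n1) (row_sqint n1) (row_lag n1).
apply: filterS => w g; rewrite /rem /xbar (row_sumE (hs n1) g).
set r := row_rem _ _ _ _ _ _ _; set m := _ * max_remainder _ _ _ _ _ _ _.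
have rm a : `|r a 0| <= m by exact: row_rem_le (hs n1) _ _.
have -> : \sum_a u a * (\sum_(s n <= j < (k n).+1) mart_diff P (s n) (k n) (p n) (F n) (X n) j w + r) a 0
   - \sum_(s n <= j < (k n).+1) xi n j w = \sum_a u a * r a 0.
  rewrite /xi /proj_mart exchange_big -sumrB; apply: eq_bigr => a _.
  by rewrite mxE summxE mulrDr mulr_sumr addrAC subrr add0r.
apply: (@le_trans _ _ (\sum_a `|u a| * m)).
  rewrite (le_trans (ler_norm_sum _ _ _))//; apply: ler_sum => a _.
  by rewrite normrM ler_wpM2l.
have m0 : 0 <= m by rewrite mulr_ge0//; exact: bigmax_ge_id.
rewrite [leRHS]ger0_norm; last by rewrite mulr_ge0// ltW// norm_coef_gt0.
by rewrite -mulr_suml /norm_coef ler_wpM2r// lerDr.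
Qed.

Let cos_split (a b : R) : cos (a + b) = cos b * cos (a + 0) - sin b * cos (a + - (pi / 2)).
Proof. by rewrite addr0 cosD cosB cos_pihalf sin_pihalf mulr0 add0r mulr1; ring. Qed.

(** The row sum differs from the sum of the martingale differences by a term
    that vanishes in probability, and the cosine of a sum splits into two
    products to which the scalar limit theorem applies. *)
Lemma projection_limit (phi : T -> R) : measurable_wrt (limit_field k F) phi ->
  Ex (fun w => cos (\sum_a u a * xbar n w a 0 + phi w)) @[n --> \oo] -->
  Ex (fun w => expR (- (eta2 w / 2)) * cos (phi w)).
Proof.
move=> mphi; have sG := limit_ok.1.
have mtrig (f : R -> R) : continuous f -> measurable_wrt (limit_field k F) (fun w => f (phi w)).
  by move=> cf; apply: (measurable_wrt_comp sG) mphi; exact: continuous_measurable_fun.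
have mc := mtrig _ (@continuous_cos R); have ms := mtrig _ (@continuous_sin R).
have bc (f : T -> R) : bdd (fun w => cos (f w)) by exists 1 => w; exact: cos_max.
have bs (f : T -> R) : bdd (fun w => sin (f w)) by exists 1 => w; exact: sin_max.
have clt := scalar_stable_limit hk_mono hF hs rowM lind eta2_ge0 measurable_eta2 bound_var.
have l1 := clt 0 _ mc (bc phi).
have l2 := clt (- (pi / 2)) _ ms (bs phi).
have mS n (n1 : (1 <= n)%N) (th : R) : measurable_fun setT
    (fun w => cos (\sum_(s n <= j < (k n).+1) xi n j w + th)).
  apply: (measurableT_comp (f := cos)).
    by apply: continuous_measurable_fun; exact: continuous_cos.
  by apply: measurable_funD => //; exact: mxi.
have ip (f g : T -> R) : measurable_fun setT f -> bdd f -> measurable_fun setT g -> bdd g ->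
    integ (fun w => f w * g w).
  by move=> mf bf mg bg; apply: integM_bdd => //; exact: integ_bdd.
have mc' := measurable_wrt_fun limit_ok.2 mc.
have ms' := measurable_wrt_fun limit_ok.2 ms.
have mphi' := measurable_wrt_fun limit_ok.2 mphi.
have lS : Ex (fun w => cos (\sum_(s n <= j < (k n).+1) xi n j w + phi w)) @[n --> \oo] -->
    Ex (fun w => expR (- (eta2 w / 2)) * cos (phi w)).
  rewrite (_ : Rintegral P setT _ = cos 0 * Ex (fun w => cos (phi w) * expR (- (eta2 w / 2))) -
      cos (- (pi / 2)) * Ex (fun w => sin (phi w) * expR (- (eta2 w / 2)))); last first.
    rewrite cosN cos_pihalf cos0 mul1r mul0r subr0.
    by apply: eq_Rintegral => w _; rewrite mulrC.
  apply: (cvg_trans _ (cvgB l1 l2)); apply: near_eq_cvg; near=> n.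
  have n1 : (1 <= n)%N by near: n; exact: nbhs_infty_gt.
  rewrite !fctE -ExB.
  - by apply: eq_Rintegral => w _; rewrite [RHS]cos_split.
  - by apply: ip => //; exact: mS.
  - by apply: ip => //; exact: mS.
pose Y n w := cos (\sum_a u a * xbar n w a 0 + phi w) -
   cos (\sum_(s n <= j < (k n).+1) xi n j w + phi w).
have m1 n : (1 <= n)%N -> measurable_fun setT (fun w => cos (\sum_a u a * xbar n w a 0 + phi w)).
  move=> n1; apply: (measurableT_comp (f := cos)).
    by apply: continuous_measurable_fun; exact: continuous_cos.
  by apply: measurable_funD => //; exact: mux.
have m2 n : (1 <= n)%N -> measurable_fun setT
    (fun w => cos (\sum_(s n <= j < (k n).+1) xi n j w + phi w)).
  move=> n1; apply: (measurableT_comp (f := cos)).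
    by apply: continuous_measurable_fun; exact: continuous_cos.
  by apply: measurable_funD => //; exact: mxi.
have cY : cvgp0 P Y.
  apply: cvgp0_le rem_small; exists 1%N => // n /= n1.
    by apply: measurable_funB; [exact: m1|exact: m2].
  move=> w; rewrite /Y /rem; set a := \sum_a _; set b := \sum_(_ <= j < _) _.
  have -> : a + phi w = (b + phi w) + (a - b) by ring.
  exact: cos_increment.
have bY : \forall n \near \oo, forall w, `|Y n w| <= 2.
  apply: nearW => n w; rewrite (le_trans (ler_normB _ _))//.
  by rewrite (_ : 2 = 1 + 1)// lerD// cos_max.
have EY : Ex (Y n) @[n --> \oo] --> (0 : R).
  have /near0P h := Ex_cvgp0 bY cY; apply/near0P => delta d0; near=> n.
  have n1 : (1 <= n)%N by near: n; exact: nbhs_infty_gt.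
  apply: (@le_trans _ _ `|Ex (fun w => `|Y n w|)|); last by near: n; exact: h.
  rewrite (le_trans _ (ler_norm _))// Ex_abs//.
  by apply: integB; apply: integ_bdd; rewrite /=; [exact: m1|exact: bc|exact: m2|exact: bc].
rewrite -[X in _ --> X]add0r; apply: (cvg_trans _ (cvgD EY lS)); apply: near_eq_cvg; near=> n.
have n1 : (1 <= n)%N by near: n; exact: nbhs_infty_gt.
rewrite !fctE /Y ExB; [by rewrite subrK|apply: integ_bdd|apply: integ_bdd].
- exact: m1.
- exact: bc.
- exact: m2.
- exact: bc.
Unshelve. all: by end_near. Qed.

Lemma projection_tight (delta : R) : 0 < delta -> exists2 A : R, 0 < A &
  \forall n \near \oo, (P [set w | (A <= `|\sum_a u a * xbar n w a 0|)%R] <= delta%:E)%E.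
Proof.
move=> d0; have d2 : 0 < delta / 2 by rewrite divr_gt0.
have [A A0 hA] := scalar_tight hF hs rowM measurable_eta2 bound_var d2.
have [_ /(_ 1 ltr01 _ d2) hr] := rem_small.
exists (A + 1); first by rewrite addr_gt0.
near=> n; have n1 : (1 <= n)%N by near: n; exact: nbhs_infty_gt.
have mr : measurable_fun setT (rem n) by apply: measurable_funB; [exact: mux|exact: mxi].
have mA := measurable_abs_ge A (mxi n1); have mB := measurable_abs_ge 1 mr.
have pA : (P [set w | (A <= `|\sum_(s n <= j < (k n).+1) xi n j w|)%R] <= (delta / 2)%:E)%E.
  by near: n.
have pB : (P [set w | (1 <= `|rem n w|)%R] <= (delta / 2)%:E)%E by near: n.
rewrite [delta]splitr EFinD; apply: (le_trans _ (leeD pA pB)).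
apply: le_trans (measureU2 _ mA mB) => //; apply: le_measure; rewrite ?inE.
- exact: measurable_abs_ge (mux n1).
- exact: measurableU.
move=> w /= h; have [hA'|hA'] := leP A `|\sum_(s n <= j < (k n).+1) xi n j w|; [by left|right].
move: h hA'; rewrite /rem; set x := \sum_a _; set y := \sum_(_ <= j < _) _ => h hA'.
by have := ler_normB (x - y) (- y); rewrite opprK subrK normrN /=; lra.
Unshelve. all: by end_near. Qed.

End direction.
End lag_martingale_array.

(** * Extensions of the probability space *)

Section extension.
Context {R : realType} {disp : measure_display} {T : measurableType disp}.
Context {disp' : measure_display} {T' : measurableType disp'}.
Variables (P : probability T R) (P' : probability T' R) (pi : T' -> T).
Hypothesis hext : is_extension P P' pi.

Lemma Ex_extension (f : T -> R) : measurable_fun setT f -> bdd f ->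
  Rintegral P' setT (fun w => f (pi w)) = Rintegral P setT f.
Proof.
move=> mf [M fM]; have [mpi Ppi] := hext.
rewrite /Rintegral; congr fine.
transitivity (\int[pushforward P' pi]_w (f w)%:E)%E.
  rewrite integral_pushforward//; first exact/measurable_EFinP.
  rewrite preimage_setT; apply: (integ_bdd P' (f := fun w => f (pi w))).
    exact: measurableT_comp.
  by exists M => w; exact: fM.
have E := @eq_measure_integral _ T R setT P
  (measure_function_pushforward__canonical__measure_function_Measure P' mpi).
by apply: E => A mA _; exact: Ppi.
Qed.

Lemma lift_field (G : set (set T)) : sub_sigma_field G ->
  sub_sigma_field (preimage_set_system setT pi G).
Proof.
move=> hG; split; first by apply: sigma_algebra_preimage; exact: hG.1.
by move=> _ [A GA <-]; apply: hext.1 => //; exact: hG.2.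
Qed.

Lemma lift_measurable (G : set (set T)) (f : T -> R) : measurable_wrt G f ->
  measurable_wrt (preimage_set_system setT pi G) (fun w => f (pi w)).
Proof.
move=> mf _ [B mB <-]; exists (f @^-1` B); last by rewrite !setTI.
by apply: mf; exists B => //; rewrite setTI.
Qed.

End extension.

(** * Stable convergence of the row sums *)

Theorem theorem3
  (R : realType) (disp : measure_display) (T : measurableType disp)
  (P : probability T R) (d : nat)
  (k s : nat -> nat) (p : nat -> nat -> nat)
  (F : nat -> nat -> set (set T)) (X : nat -> nat -> T -> 'cV[R]_d)
  (Psi : T -> 'M[R]_d)
  (hk_mono : forall m n, (1 <= m <= n)%N -> (k m <= k n)%N)
  (hk_ge : forall n, (1 <= n)%N -> (n <= k n)%N)
  (hF : forall n, (1 <= n)%N -> filtration (k n) (F n))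
  (hs : forall n, (1 <= n)%N -> (1 <= s n <= k n)%N)
  (hp : forall n j, (1 <= n)%N -> (s n <= j <= k n)%N -> (p n j < j)%N)
  (hX : lag_martingale_difference P s k p F X)
  (hX2 : square_integrable P s k X)
  (hPsi_meas : measurable_wrt_mx (limit_field k F) Psi)
  (hPsi_psd : forall w, psd (Psi w))
  (h1 : cvg_in_prob P
          (fun n => variance_matrix P (s n) (k n) (p n) (F n) (X n)) Psi)
  (h1' : cvg_in_prob P
           (fun n w => cond_quad_var P (s n) (k n) (p n) (F n) (X n) w -
                       variance_matrix P (s n) (k n) (p n) (F n) (X n) w)
           (cst 0))
  (h2 : cvg_in_prob P
          (fun n w => (max_lag (s n) (k n) (p n))%:R *
                      max_remainder P (s n) (k n) (p n) (F n) (X n) w)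
          (cst 0))
  (h3 : [\/ forall eps : R, 0 < eps -> cvg_in_prob P
              (fun n w =>
                 lindeberg1 P (s n) (k n) (p n) (F n) (X n) eps w)
              (cst 0),
            forall eps : R, 0 < eps -> cvg_in_prob P
              (fun n w =>
                 lindeberg2 P (s n) (k n) (p n) (F n) (X n) eps w)
              (cst 0) |
            forall eps : R, 0 < eps -> cvg_in_prob P
              (fun n w =>
                 lindeberg3 P (s n) (k n) (p n) (F n) (X n) eps w)
              (cst 0)])
  (disp' : measure_display) (T' : measurableType disp')
  (P' : probability T' R) (pi : T' -> T) (Z : T' -> 'cV[R]_d)
  (hext : is_extension P P' pi)
  (hZ : standard_gaussian P' Z)
  (hZG : indep_fields P' (sigma_vec Z)
           (preimage_set_system setT pi (limit_field k F))) :
  stable_cvg P P' pi (limit_field k F)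
    (fun n => row_sum (s n) (k n) (X n))
    (fun w => psd_sqrt (Psi (pi w)) *m Z w).

Proof.
move=> V mV.
have sL := limit_field_sub hF.
have sG := sL.1.
have [mpi Ppi] := hext.
have mV' : measurable_fun setT V := measurable_wrt_fun sL.2 mV.
pose G' := preimage_set_system setT pi (limit_field k F).
have hG' : sub_sigma_field G' by exact: (lift_field hext sL).
have mS := measurable_psd_sqrt sG hPsi_meas hPsi_psd.
have mZ a : measurable_fun setT (fun w => Z w a 0).
  by move=> _ B mB; rewrite setTI; apply: (hZ.1 a 0); exists B => //; rewrite setTI.
have mSZ a : measurable_fun setT (fun w => (psd_sqrt (Psi (pi w)) *m Z w) a 0).
  under eq_fun do rewrite mxE; apply: measurable_sum => b; apply: measurable_funM => //.
  apply: (measurableT_comp (f := fun w => psd_sqrt (Psi w) a b)) => //.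
  exact: (measurable_wrt_fun sL.2 (mS a b)).
apply: cvg_in_distr_pair => //.
- move=> n n1 a; under eq_fun do rewrite /row_sum summxE big_nat big_mkcond/=.
  apply: measurable_sum => j; have [sj|_] := boolP (s n <= j < (k n).+1)%N.
    by have [m _] := Lfun2_sqint (hX2 n j n1 sj a).
  exact: measurable_cst.
- exact: measurableT_comp.
- move=> a delta d0.
  have [A A0 hA] := projection_tight hF hs hX hX2 hPsi_meas h1 h1' h2 (fun b => (b == a)%:R) d0.
  exists A => //; apply: filterS hA => n; set B := [set w | _]; rewrite (_ : [set w | _] = B)//.
  apply/seteqP; split=> w; rewrite /B/= (bigD1 a)//= eqxx mul1r big1 ?addr0// => b /negbTE ->;
    by rewrite mul0r.
move=> u v theta.
(* The part of the phase that comes from [V] is known in the limit field. *)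
pose phi w := v * V w + theta.
have mphi : measurable_wrt (limit_field k F) phi.
  apply: measurable_wrtD => //; last exact: measurable_wrt_cst.
  exact: measurable_wrtZ.
have lim := projection_limit hk_mono hF hs hX hX2 hPsi_meas hPsi_psd h1 h1' h2 h3 mphi.
pose y : 'cV[R]_d := \col_a u a.
pose a_ i w := (psd_sqrt (Psi w) *m y) i 0.
have ma i : measurable_wrt (limit_field k F) (a_ i).
  rewrite (_ : a_ i = fun w => \sum_b psd_sqrt (Psi w) i b * y b 0); last first.
    by apply/funext => w; rewrite /a_ mxE.
  apply: measurable_wrt_sum => // b _.
  apply: measurable_wrtM => //; exact: measurable_wrt_cst.
have ma' i : measurable_wrt G' (fun w => a_ i (pi w)) by exact: lift_measurable.
have mphi' : measurable_wrt G' (fun w => phi (pi w)) by exact: lift_measurable.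
(* Given the limit field, [u . (Psi^(1/2) Z)] is Gaussian with variance
   [u . (Psi u)], the squared norm of [Psi^(1/2) u]. *)
have mix := Ex_cos_mixture hZ hG' hZG ma' mphi'.
have E1 w : \sum_i a_ i (pi w) * Z w i 0 = \sum_a u a * (psd_sqrt (Psi (pi w)) *m Z w) a 0.
  have [[sS _] _ _] := psd_sqrtP (hPsi_psd (pi w)).
  rewrite (eq_bigr (fun i => \sum_b u b * (psd_sqrt (Psi (pi w)) b i * Z w i 0))) => [|i _].
    by rewrite exchange_big; apply: eq_bigr => b _; rewrite -mulr_sumr mxE.
  rewrite /a_ mxE mulr_suml; apply: eq_bigr => b _; rewrite -{1}sS !mxE; ring.
have E2 w : \sum_i a_ i w ^+ 2 = eta2 Psi u w.
  have [[sS _] SS _] := psd_sqrtP (hPsi_psd w).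
  rewrite -(qf_sqr y sS) -mulmxE SS /qf mxE /eta2 exchange_big; apply: eq_bigr => b _.
  by rewrite mxE mulr_suml; apply: eq_bigr => a _; rewrite !mxE; ring.
rewrite (_ : Rintegral P' setT _ = Rintegral P setT (fun w => expR (- (eta2 Psi u w / 2)) * cos (phi w))).
  exact: lim.
rewrite -(Ex_extension hext); last 2 first.
- apply: (measurable_wrt_fun sL.2); apply: measurable_wrtM => //.
    apply: (measurable_wrt_comp sG (k := fun x => expR (- (x / 2)))).
      apply: (measurableT_comp (f := expR)); first exact: measurable_expR.
      by apply: measurable_funN; exact: mulrr_measurable.
    exact: measurable_eta2.
  by apply: (measurable_wrt_comp sG) mphi; apply: continuous_measurable_fun; exact: continuous_cos.
- exists 1 => w; rewrite normrM mulr_ile1// ?cos_max// ger0_norm ?expR_ge0//.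
  rewrite -expR0 ler_expR oppr_le0 divr_ge0// -E2 sumr_ge0// => i _; exact: sqr_ge0.
under [RHS]eq_Rintegral do rewrite -E2; rewrite -mix.
by apply: eq_Rintegral => w _; rewrite E1.
Qed.
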